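(* Let $g:\mathbb{R}^d\to\mathbb{C}$ be a continuous symbol function with real part $g_R\ge 0$, and let $X\in(\mathscr{V}(\mathbb{R}^d)\widehat{\boxtimes}C_{FD}(\mathbb{R}^+))'$. Then there exists a unique solution $U\in(\mathscr{V}(\mathbb{R}^d)\widehat{\boxtimes}C_{FD}(\mathbb{R}^+))'$ to the equation $$\frac{\partial U}{\partial t}+\mathcal{L}_gU=X$$ (in the sense of $\mathscr{S}'(\mathbb{R}^d\times\mathbb{R})$).
   Context: Here $d\ge1$, $\mathbb{R}^+=[0,\infty)$, $\mathbb{N}=\{0,1,2,\dots\}$. A symbol function is a measurable, polynomially bounded function $g:\mathbb{R}^d\to\mathbb{C}$ that is Hermitian (its real part $g_R$ is even and its imaginary part $g_I$ is odd). For $n\ge1$, $\mathscr{M}(\mathbb{R}^n)$ is the space of complex Radon measures ($\sigma$-additive complex functions on bounded Borel sets), and $\mathscr{M}_{SG}(\mathbb{R}^n)$ the space of slow-growing ones, i.e. those with $\int(1+|x|^2)^{-N}d|\mu|(x)<\infty$ for some $N\in\mathbb{N}$; $\mathscr{M}_{SG}(\mathbb{R}^n)\subset\mathscr{S}'(\mathbb{R}^n)$. $\mathscr{M}_{SG}(\mathbb{R}^d\times\mathbb{R}^+)$ is the set of $\mu\in\mathscr{M}_{SG}(\mathbb{R}^d\times\mathbb{R})$ with support in $\mathbb{R}^d\times\mathbb{R}^+$. $\mathscr{F}_S$ is the Fourier transform in the space variable only, $\mathscr{F}_S(\psi)(\xi,t)=(2\pi)^{-d/2}\int_{\mathbb{R}^d}e^{-i\xi^Tx}\psi(x,t)dx$,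 extended to $\mathscr{S}'(\mathbb{R}^d\times\mathbb{R})$ by $\langle\mathscr{F}_S(T),\psi\rangle=\langle T,\mathscr{F}_S(\psi)\rangle$. As spaces of tempered distributions on $\mathbb{R}^d\times\mathbb{R}$: $(\mathscr{V}(\mathbb{R}^d)\widehat{\boxtimes}C_{FD}(\mathbb{R}))'=\mathscr{F}_S(\mathscr{M}_{SG}(\mathbb{R}^d\times\mathbb{R}))$ and $(\mathscr{V}(\mathbb{R}^d)\widehat{\boxtimes}C_{FD}(\mathbb{R}^+))'=\mathscr{F}_S(\mathscr{M}_{SG}(\mathbb{R}^d\times\mathbb{R}^+))$; equivalently, these are the tempered distributions whose spatial Fourier transform is a slow-growing measure over $\mathbb{R}^d\times\mathbb{R}$ (respectively, one supported in $\mathbb{R}^d\times\mathbb{R}^+$). The operator $\mathcal{L}_g$ is defined on $(\mathscr{V}(\mathbb{R}^d)\widehat{\boxtimes}C_{FD}(\mathbb{R}))'$ by $\mathcal{L}_g(T)=\mathscr{F}_S^{-1}(g\,\mathscr{F}_S(T))$, where $g\mu$ denotes the measure $A\mapsto\int_Ag(\xi)d\mu(\xi,t)$. *)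

(* Defs.v *)
From HB Require Import structures.
From mathcomp Require Import all_boot all_order all_algebra.
From mathcomp Require Import all_classical all_reals all_analysis.
From mathcomp Require Import complex.

Set Implicit Arguments.
Unset Strict Implicit.
Unset Printing Implicit Defensive.

Import Order.TTheory GRing.Theory Num.Theory.
Import numFieldTopology.Exports numFieldNormedType.Exports.

Local Open Scope classical_set_scope.
Local Open Scope ring_scope.
Local Open Scope complex_scope.

(* MathComp-Analysis attaches the norm topology to variables of the numeric
   structures only; these instances make it available on the concrete R[i]. *)
HB.instance Definition _ (R : rcfType) := PseudoPointedMetric.copy R[i] R[i]^o.
HB.instance Definition _ (R : rcfType) := NormedModule.copy R[i] R[i]^o.

Notation spacetime R d := ('rV[R]_d * R)%type.

Notation borel T := (g_sigma_algebraType (@open T)).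

(* The norms of 'rV[R]_d and of products are sup norms: the Euclidean square
   norms |x|^2 on R^d and |(x, t)|^2 on R^d x R are written out. *)
Definition sqnorm_space (R : realType) (d : nat) (x : 'rV[R]_d) : R :=
  \sum_(i < d) x 0 i ^+ 2.

Definition sqnorm (R : realType) (d : nat) (z : spacetime R d) : R :=
  sqnorm_space z.1 + z.2 ^+ 2.

Definition dotp (R : realType) (d : nat) (x y : 'rV[R]_d) : R :=
  \sum_(i < d) x 0 i * y 0 i.

Definition symbol_function (R : realType) (d : nat) (g : 'rV[R]_d -> R[i]) :=
  [/\ measurable_fun setT (g : borel 'rV[R]_d -> borel R[i]),
      exists (c : R) (N : nat), forall x,
        Normc.normc (g x) <= c * (1 + sqnorm_space x) ^+ N,
      forall x, complex.Re (g (- x)) = complex.Re (g x)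
    & forall x, complex.Im (g (- x)) = - complex.Im (g x)].

Section ComplexRadonMeasures.
Context (R : realType) (d : nat).
Local Notation E := (spacetime R d).

Definition bounded_borel (A : set E) :=
  measurable (A : set (borel E)) /\ bounded_set A.

(* Complex Radon measures are sigma-additive on bounded Borel sets. They are
   represented by total set functions, whose values on other sets are
   irrelevant: none of the definitions below depends on them. *)
Definition radon (mu : set E -> R[i]) :=
  forall F : nat -> set E,
    (forall n, bounded_borel (F n)) -> trivIset setT F ->
    bounded_set (\bigcup_n F n) ->
    (fun n => \sum_(i < n) mu (F i)) @ \oo --> mu (\bigcup_n F n).

Definition variation_measure (mu : set E -> R[i]) (A : set (borel E)) : \bar R :=
  ereal_sup [set s | exists (n : nat) (F : nat -> set E),
    [/\ forall i, bounded_borel (F i) /\ F i `<=` A,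
        trivIset setT F
      & s = (\sum_(i < n) Normc.normc (mu (F i)))%:E]].

Definition msupport (mu : set E -> R[i]) : set E :=
  [set z | forall U : set E, open U -> U z -> (0 < variation_measure mu U)%E].

Definition slow_growing (mu : set E -> R[i]) :=
  radon mu /\ exists N : nat,
    (\int[variation_measure mu]_z ((1 + sqnorm z) ^- N)%:E < +oo)%E.

Definition slow_growing_pos (mu : set E -> R[i]) :=
  slow_growing mu /\ msupport mu `<=` [set z | 0 <= z.2].

(* Positive part of the Jordan decomposition of a signed Radon measure; the
   negative part of nu is positive_part (\- nu). *)
Definition positive_part (nu : set E -> R) (A : set (borel E)) : \bar R :=
  ereal_sup [set (nu B)%:E | B in [set B | bounded_borel B /\ B `<=` A]].

Definition signed_integral (nu : set E -> R) (A : set E) (f : E -> R) : R :=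
  fine (\int[positive_part nu]_(z in (A : set (borel E))) (f z)%:E)
  - fine (\int[positive_part (\- nu)]_(z in (A : set (borel E))) (f z)%:E).

Definition radon_integral (mu : set E -> R[i]) (A : set E) (f : E -> R[i]) :
    R[i] :=
  let mu1 := @complex.Re R \o mu in let mu2 := @complex.Im R \o mu in
  let f1 := @complex.Re R \o f in let f2 := @complex.Im R \o f in
  (signed_integral mu1 A f1 - signed_integral mu2 A f2)
  +i* (signed_integral mu1 A f2 + signed_integral mu2 A f1).

Definition mul_measure (g : 'rV[R]_d -> R[i]) (mu : set E -> R[i]) :
    set E -> R[i] :=
  fun A => radon_integral mu A (fun z => g z.1).

End ComplexRadonMeasures.

Section TemperedDistributions.
Context (R : realType) (d : nat).
Local Notation E := (spacetime R d).

(* Some i is the i-th space variable, None is the time variable. *)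
Definition direction (j : option 'I_d) : E :=
  if j is Some i then (delta_mx 0 i, 0) else (0, 1).

Definition pderiv (j : option 'I_d) (psi : E -> R[i]) : E -> R[i] :=
  fun z => 'D_(direction j) (@complex.Re R \o psi) z
           +i* 'D_(direction j) (@complex.Im R \o psi) z.

Definition mderiv (s : seq (option 'I_d)) (psi : E -> R[i]) : E -> R[i] :=
  foldr pderiv psi s.

Definition smooth (psi : E -> R[i]) :=
  forall s : seq (option 'I_d),
    continuous (mderiv s psi) /\
    forall j z, derivable (@complex.Re R \o mderiv s psi) z (direction j) /\
                derivable (@complex.Im R \o mderiv s psi) z (direction j).

Definition schwartz (psi : E -> R[i]) :=
  smooth psi /\
  forall (s : seq (option 'I_d)) (N : nat), exists M : R, forall z,
    (1 + sqnorm z) ^+ N * Normc.normc (mderiv s psi z) <= M.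

(* Distributions are represented by functionals on all functions E -> R[i],
   of which only the values on Schwartz functions are meaningful; equality of
   distributions is eq_distr. *)
Definition functional := (E -> R[i]) -> R[i].

Definition eq_distr (S T : functional) :=
  forall psi, schwartz psi -> S psi = T psi.

(* Continuity is for the topology of the seminorms
   sup_z (1 + |z|^2)^N |D^s psi z|. *)
Definition tempered (T : functional) :=
  (forall (a : R[i]) (phi psi : E -> R[i]), schwartz phi -> schwartz psi ->
     T (fun z => a * phi z + psi z) = a * T phi + T psi) /\
  (forall phi, schwartz phi -> forall e : R, 0 < e ->
     exists (N : nat) (r : R), 0 < r /\
       forall psi, schwartz psi ->
         (forall s : seq (option 'I_d), (size s <= N)%N -> forall z,
            (1 + sqnorm z) ^+ N *
              Normc.normc (mderiv s (fun y => psi y - phi y) z) <= r) ->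
         Normc.normc (T psi - T phi) <= e).

Definition distr_of_measure (mu : set E -> R[i]) : functional :=
  fun psi => radon_integral mu setT psi.

Definition time_derivative (T : functional) : functional := fun psi => - T (pderiv None psi).

End TemperedDistributions.

(* Lebesgue measure on R^n, as the iterated product of the one on R: this
   unfolds the product measure of the library along 'rV_n.+1 = R x 'rV_n. *)
Fixpoint lebesgue_rV (R : realType) (n : nat) : set (borel 'rV[R]_n) -> \bar R :=
  match n with
  | 0 => fun A => \d_ (0 : borel 'rV[R]_0) A
  | m.+1 => fun A =>
      (\int[@lebesgue_measure R]_s
         lebesgue_rV [set x | A (row_mx (s%:M : 'rV[R]_1) x)])%E
  end.

Section SpatialFourier.
Context (R : realType) (d : nat).
Local Notation E := (spacetime R d).

Definition space_integral (f : 'rV[R]_d -> R[i]) : R[i] :=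
  fine (\int[@lebesgue_rV R d]_x (complex.Re (f x))%:E)
  +i* fine (\int[@lebesgue_rV R d]_x (complex.Im (f x))%:E).

Definition expi (a : R) : R[i] := cos a +i* sin a.

Definition fourier_space (psi : E -> R[i]) : E -> R[i] :=
  fun z => ((2 * pi) `^ (- (d%:R / 2)))%:C *
           space_integral (fun x => expi (- dotp z.1 x) * psi (x, z.2)).

Definition fourier_distr (T : functional R d) : functional R d :=
  fun psi => T (fourier_space psi).

(* The Fourier transform is a bijection of the space of tempered
   distributions; this picks the preimage of T. *)
Definition inv_fourier_distr (T : functional R d) : functional R d :=
  get [set W | tempered W /\ eq_distr (fourier_distr W) T].

Definition VCFD_dual (T : functional R d) :=
  tempered T /\ exists2 mu, slow_growing mu &
    eq_distr T (fourier_distr (distr_of_measure mu)).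

Definition VCFD_dual_pos (T : functional R d) :=
  tempered T /\ exists2 mu, slow_growing_pos mu &
    eq_distr T (fourier_distr (distr_of_measure mu)).

(* The slow-growing measure that represents T, unique on bounded Borel sets. *)
Definition measure_of_distr (T : functional R d) : set E -> R[i] :=
  get [set mu | slow_growing mu /\ eq_distr T (distr_of_measure mu)].

(* Meaningful on VCFD_dual only. *)
Definition Lop (g : 'rV[R]_d -> R[i]) (T : functional R d) : functional R d :=
  inv_fourier_distr
    (distr_of_measure (mul_measure g (measure_of_distr (fourier_distr T)))).

Definition solution (g : 'rV[R]_d -> R[i]) (X U : functional R d) :=
  eq_distr (fun psi => time_derivative U psi + Lop g U psi) X.

End SpatialFourier.

(* Main.v *)
From HB Require Import structures.
From mathcomp Require Import all_boot all_order all_algebra.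
From mathcomp Require Import all_classical all_reals all_analysis.
From mathcomp Require Import measurable_realfun complex ring lra.
Require Import Defs.

(* Idea. Write mu_X for the measure with X = F_S mu_X. Testing the equation
   against psi and setting chi = F_S psi, it becomes
     int (- d_t chi + g(- xi) chi) dmu = int chi dmu_X   for all Schwartz chi,
   an equation on the measure mu of U alone.

   Existence: mu is the superposition of the half-lines (xi, s + r), r >= 0,
   with density exp(- g(- xi) r), over (xi, s) distributed as mu_X; it is slow
   growing since Re g >= 0 and supported in t >= 0 since mu_X is.

   Uniqueness: for the difference J of two solutions, the test functions
   chi = exp(- Q), Q a polynomial, give in a limit
     J (f(xi) e^(-|xi|^2 - p t) (p + g(- xi))) = 0   for all p > 0,
   first for indicators of orthants, then for all bounded Borel f. Replacing f
   by f / (p + g) leaves a Laplace transform in t, and the uniqueness theorem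
   for Laplace transforms gives J = 0.

   A complex Radon measure is handled as A |-> int_(p^-1 A) h dm for a density
   h and a map p on a sigma-finite measure space; uniqueness only uses that its
   integral is linear and satisfies dominated convergence. Fourier inversion on
   Schwartz functions is proved by Gaussian regularization. *)

Set Implicit Arguments.
Unset Strict Implicit.
Unset Printing Implicit Defensive.

Import Order.TTheory GRing.Theory Num.Theory.
Import numFieldTopology.Exports numFieldNormedType.Exports.
Import HBNNSimple.
Local Open Scope classical_set_scope.
Local Open Scope ring_scope.
Local Open Scope complex_scope.

(** * Complex numbers and Borel sets *)

Notation cRe := (@complex.Re _).
Notation cIm := (@complex.Im _).
Notation normc := (@Normc.normc _).

(** The symbol is continuous but not smooth, so that [exp(- g(- xi) r) chi] is in general no
    Schwartz function and the adjoint equation cannot be solved within the test functions. This is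
    why uniqueness goes through a resolvent: multiplication by [1 / (p + g)] happens only after the
    class of test functions has been enlarged from Schwartz functions to bounded Borel functions of
    [xi]. The enlargement uses no bump functions: the indicator of an orthant is a pointwise limit
    of functions [exp(- Q)], which are Schwartz as soon as the polynomial [Q] dominates a multiple
    of [|z|^2] up to a constant. A second obstacle is that the variation of a complex measure enters
    the definitions as a bare set function. A density of modulus 1 on four disjoint copies of
    space-time encodes the positive and negative parts of the real and imaginary parts at once,
    which avoids a polar decomposition; Fubini's theorem, dominated convergence and the product with
    [g] then concern ordinary integrals. *)

Lemma max0_subN (R : realDomainType) (a : R) : a = Num.max a 0 - Num.max (- a) 0.
Proof.
have [a0|/ltW a0] := lerP 0 a.
  by rewrite max_r ?oppr_le0// subr0.
by rewrite max_l ?oppr_ge0// sub0r opprK.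
Qed.

Section ComplexModulus.
Context (R : realType).
Implicit Types z w : R[i].

Lemma cReD z w : complex.Re (z + w) = complex.Re z + complex.Re w.
Proof. by case: z; case: w. Qed.
Lemma cImD z w : complex.Im (z + w) = complex.Im z + complex.Im w.
Proof. by case: z; case: w. Qed.
Lemma cReN z : complex.Re (- z) = - complex.Re z.
Proof. by case: z. Qed.
Lemma cImN z : complex.Im (- z) = - complex.Im z.
Proof. by case: z. Qed.
Lemma cReM z w : complex.Re (z * w) =
  complex.Re z * complex.Re w - complex.Im z * complex.Im w.
Proof. by case: z; case: w. Qed.
Lemma cImM z w : complex.Im (z * w) =
  complex.Re z * complex.Im w + complex.Im z * complex.Re w.
Proof. by case: z; case: w. Qed.

Lemma complex_eqP z w :
  complex.Re z = complex.Re w -> complex.Im z = complex.Im w -> z = w.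
Proof. by case: z => a b; case: w => c d /= -> ->. Qed.

Lemma normcE z : normc z = Num.sqrt (complex.Re z ^+ 2 + complex.Im z ^+ 2).
Proof. by case: z. Qed.

Lemma normc_ge0 z : 0 <= normc z.
Proof. by rewrite normcE sqrtr_ge0. Qed.

Lemma ler_norm_cRe z : `|complex.Re z| <= normc z.
Proof.
by rewrite normcE -sqrtr_sqr ler_sqrt ?lerDl ?sqr_ge0// addr_ge0 ?sqr_ge0.
Qed.

Lemma ler_norm_cIm z : `|complex.Im z| <= normc z.
Proof.
by rewrite normcE -sqrtr_sqr ler_sqrt ?lerDr ?sqr_ge0// addr_ge0 ?sqr_ge0.
Qed.

Lemma normc_le_ReIm z : normc z <= `|complex.Re z| + `|complex.Im z|.
Proof.
rewrite normcE -[leRHS]ger0_norm ?addr_ge0// -sqrtr_sqr ler_sqrt ?sqr_ge0//.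
rewrite sqrrD !real_normK ?num_real//.
by rewrite addrAC lerDl mulrn_wge0 ?mulr_ge0.
Qed.

Lemma normcM z w : normc (z * w) = normc z * normc w.
Proof. exact: Normc.normcM. Qed.

Lemma normcD z w : normc (z + w) <= normc z + normc w.
Proof. exact: le_normcD. Qed.

Lemma normcN z : normc (- z) = normc z.
Proof. by rewrite !normcE cReN cImN !sqrrN. Qed.

Lemma normcR (a : R) : normc (a%:C) = `|a|.
Proof. by rewrite normcE /= expr0n addr0 sqrtr_sqr. Qed.

Lemma normc_expi (a : R) : normc (expi a) = 1.
Proof. by rewrite normcE /= cos2Dsin2 sqrtr1. Qed.

Lemma expiD (a b : R) : expi (a + b) = expi a * expi b.
Proof.
by apply: complex_eqP; rewrite ?cReM ?cImM /= ?cosD ?sinD; ring.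
Qed.

Lemma expi0 : expi (0 : R) = 1.
Proof. by apply: complex_eqP; rewrite /= ?cos0 ?sin0. Qed.

Lemma continuous_cRe : continuous (cRe : R[i] -> R).
Proof.
move=> z; apply/(@cvgrPdist_lt _ _ _ _ (nbhs_filter z)) => e e0.
have e0' : 0 < e%:C by rewrite ltcR.
apply: filterS (nbhsx_ballx z e%:C e0') => w.
rewrite /ball /= ltcR -/(normc _) => /(le_lt_trans _); apply.
by rewrite -cReN -cReD ler_norm_cRe.
Qed.

Lemma continuous_cIm : continuous (cIm : R[i] -> R).
Proof.
move=> z; apply/(@cvgrPdist_lt _ _ _ _ (nbhs_filter z)) => e e0.
have e0' : 0 < e%:C by rewrite ltcR.
apply: filterS (nbhsx_ballx z e%:C e0') => w.
rewrite /ball /= ltcR -/(normc _) => /(le_lt_trans _); apply.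
by rewrite -cImN -cImD ler_norm_cIm.
Qed.

Lemma cvg_complex T (F : set_system T) (FF : Filter F) (f : T -> R[i]) (l : R[i]) :
  (cRe \o f) @ F --> complex.Re l ->
  (cIm \o f) @ F --> complex.Im l -> f @ F --> l.
Proof.
move=> fr fi; apply/cvgrPdist_lt => /= e e0.
have [er ee er0] : exists2 r : R, e = r%:C & 0 < r.
  case: e e0 => a b; rewrite ltcE /= => /andP[/eqP b0 a0].
  by exists a => //; rewrite b0.
rewrite ee; near=> x.
rewrite ltcR -/(normc _); apply: (le_lt_trans (normc_le_ReIm _)).
rewrite cReD cReN cImD cImN (splitr er) ltrD//.
  by near: x; move/cvgrPdist_lt : fr => fr; apply: (fr (er / 2)); rewrite divr_gt0.
by near: x; move/cvgrPdist_lt : fi => fi; apply: (fi (er / 2)); rewrite divr_gt0.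
Unshelve. all: by end_near. Qed.

Lemma cvg_cRe T (F : set_system T) (FF : Filter F) (f : T -> R[i]) (l : R[i]) :
  f @ F --> l -> (cRe \o f) @ F --> complex.Re l.
Proof. by move=> fl; apply: continuous_cvg fl; exact: continuous_cRe. Qed.

Lemma cvg_cIm T (F : set_system T) (FF : Filter F) (f : T -> R[i]) (l : R[i]) :
  f @ F --> l -> (cIm \o f) @ F --> complex.Im l.
Proof. by move=> fl; apply: continuous_cvg fl; exact: continuous_cIm. Qed.

End ComplexModulus.

Section BorelSets.

(** A set of [G] is the union of the basic sets that it contains, and there are countably many of
    them. This makes coordinatewise measurability enough for the Borel sigma-algebras below, which
    are generated by open sets and not defined as products. *)
Lemma measurable_fun_basis d (T : measurableType d) (Y : pointedType)
    (G : set (set Y)) (I : countType) (B : I -> set Y)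
    (f : T -> g_sigma_algebraType G) :
  (forall O : set Y, G O -> forall y, O y -> exists2 i, B i y & B i `<=` O) ->
  (forall i, measurable (f @^-1` B i)) -> measurable_fun setT f.
Proof.
move=> basisB mB; pose proof (@measurability _ _ T (g_sigma_algebraType G) setT f G erefl) as h.
apply: h => _ [ O oO <-].
rewrite setTI.
have -> : f @^-1` O = \bigcup_(i : I) (if pselect (B i `<=` O) then f @^-1` B i else set0).
  apply/seteqP; split=> [x Ofx|x [i _]].
    by have [i Bi BO] := basisB _ oO _ Ofx; exists i => //; case: pselect.
  by case: pselect => // BO; exact: BO.
apply: countable_bigcupT_measurable; first exact: countableP.
by move=> i; case: pselect => BO; [exact: mB|exact: measurable0].
Qed.

Lemma measurable_fun_generator (R : realType) (Y : pointedType) (G : set (set Y))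
    (f : Y -> R) :
  (forall x y, G (f @^-1` `]x, y[%classic)) ->
  measurable_fun setT (f : g_sigma_algebraType G -> R).
Proof.
move=> Gf.
pose proof (@measurability _ _ (g_sigma_algebraType G) R setT f _ (RGenOpens.measurableE R)) as h.
apply: h => _ [_ [x [y ->]] <-]; rewrite setTI; apply: sub_sigma_algebra; exact: Gf.
Qed.

Context (R : realType).

Lemma open_dist_lt (c r : R) : open [set y : R | `|c - y| < r].
Proof.
have -> : [set y : R | `|c - y| < r] = ball_ Num.norm c r by [].
exact: ball_open.
Qed.

Definition ratbox n (q : 'rV[rat]_n * rat) : set 'rV[R]_n :=
  [set y | forall i, `|ratr (q.1 0 i) - y 0 i| < ratr q.2].

Lemma rat_approx (x e : R) : 0 < e -> exists q : rat, `|x - ratr q| < e.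
Proof.
move=> e0; have /(@rat_in_itvoo R)[q] : x - e < x + e by lra.
rewrite in_itv /= => /andP[h1 h2]; exists q.
by rewrite ltr_norml; apply/andP; split; lra.
Qed.

Lemma ratbox_basis n (O : set 'rV[R]_n) : open O -> forall y, O y ->
  exists2 q, ratbox q y & ratbox q `<=` O.
Proof.
move=> oO y Oy; have /nbhs_ballP[e /= e0 eO] := oO _ Oy.
(* Radius below [e / 2]: the centre is within [r] of [y], so that the box around it stays within
   [2 r < e] of [y]. *)
have [r /andP[r0 re]] : exists r : rat, (0 < ratr r :> R) && (ratr r < e / 2).
  have /(@rat_in_itvoo R)[q] : 0 < e / 2 by rewrite divr_gt0.
  by rewrite in_itv /= => h; exists q.
have /choice[c hc] : forall i, exists q : rat, `|y 0 i - ratr q| < ratr r :> R.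
  by move=> i; exact: rat_approx.
exists (\row_i c i, r) => [i|x xc]; first by rewrite mxE distrC.
apply: eO; split=> // i j; rewrite ord1 /ball /=.
have := hc j; have := xc j; rewrite mxE /= => h1 h2.
rewrite (_ : _ - _ = (y 0 j - ratr (c j)) + (ratr (c j) - x 0 j)); last by ring.
apply: (le_lt_trans (ler_normD _ _)); lra.
Qed.

Lemma continuous_measurable_rV n (f : 'rV[R]_n -> R) :
  continuous f -> measurable_fun setT (f : borel 'rV[R]_n -> R).
Proof.
move=> cf; apply: measurable_fun_generator => x y.
by apply: open_comp => [z _|]; [exact: cf|exact: interval_open].
Qed.

Lemma continuous_measurable_spacetime n (f : spacetime R n -> R) :
  continuous f -> measurable_fun setT (f : borel (spacetime R n) -> R).
Proof.
move=> cf; apply: measurable_fun_generator => x y.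
by apply: open_comp => [z _|]; [exact: cf|exact: interval_open].
Qed.

Lemma measurable_coord n (i : 'I_n) :
  measurable_fun setT (fun x : borel 'rV[R]_n => x 0 i : R).
Proof. by apply: continuous_measurable_rV => x; exact: coord_continuous. Qed.

Lemma measurable_fun_rV d (T : measurableType d) n (f : T -> borel 'rV[R]_n) :
  (forall i, measurable_fun setT (fun x => f x 0 i : R)) -> measurable_fun setT f.
Proof.
move=> mf; apply: (measurable_fun_basis (@ratbox_basis n)) => q.
rewrite (_ : _ @^-1` _ = \bigcap_(i in [set: 'I_n])
   ((fun x => f x 0 i) @^-1` [set y | `|ratr (q.1 0 i) - y| < ratr q.2])); last first.
  by apply/seteqP; split=> [y h i _|y h i]; [exact: h|exact: h].
apply: fin_bigcap_measurable => // i _; rewrite -[X in measurable X]setTI.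
by apply: mf => //; apply: open_measurable; exact: open_dist_lt.
Qed.

Definition ratbox2 n (q : 'rV[rat]_n * rat * rat) : set (spacetime R n) :=
  ratbox q.1 `*` [set t : R | `|ratr q.2 - t| < ratr q.1.2].

Lemma ratbox2_basis n (O : set (spacetime R n)) : open O -> forall y, O y ->
  exists2 q, ratbox2 q y & ratbox2 q `<=` O.
Proof.
move=> oO y Oy; have /nbhs_ballP[e /= e0 eO] := oO _ Oy.
have [r /andP[r0 re]] : exists r : rat, (0 < ratr r :> R) && (ratr r < e / 2).
  have /(@rat_in_itvoo R)[q] : 0 < e / 2 by rewrite divr_gt0.
  by rewrite in_itv /= => h; exists q.
have /choice[c hc] : forall i, exists q : rat, `|y.1 0 i - ratr q| < ratr r :> R.
  by move=> i; exact: rat_approx.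
have [c' hc'] : exists q : rat, `|y.2 - ratr q| < ratr r by exact: rat_approx.
exists (\row_i c i, r, c') => /=.
  by split=> [i|] /=; rewrite ?mxE distrC.
move=> x [xc xc']; apply: eO; split; [split=> // i j; rewrite ord1|]; rewrite /ball /=.
  have := hc j; have := xc j; rewrite mxE /= => h1 h2.
  rewrite (_ : _ - _ = (y.1 0 j - ratr (c j)) + (ratr (c j) - x.1 0 j)); last by ring.
  apply: (le_lt_trans (ler_normD _ _)); lra.
rewrite (_ : _ - _ = (y.2 - ratr c') + (ratr c' - x.2)); last by ring.
move: xc' => /= xc'; apply: (le_lt_trans (ler_normD _ _)); lra.
Qed.

Lemma measurable_fun_spacetime d (T : measurableType d) n
    (f : T -> borel (spacetime R n)) :
  (forall i, measurable_fun setT (fun x => (f x).1 0 i : R)) ->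
  measurable_fun setT (fun x => (f x).2 : R) -> measurable_fun setT f.
Proof.
move=> mf mf2.
pose proof (@measurable_fun_basis _ T _ (@open (spacetime R n)) _ (@ratbox2 n) f (@ratbox2_basis n)) as h.
apply: h => q.
rewrite (_ : _ @^-1` _ = ((fun x => (f x).1) @^-1` ratbox q.1) `&`
   ((fun x => (f x).2) @^-1` [set t : R | `|ratr q.2 - t| < ratr q.1.2])) //.
apply: measurableI; rewrite -[X in measurable X]setTI.
  have /(_ measurableT) := measurable_fun_rV mf; apply.
  rewrite (_ : ratbox q.1 = \bigcap_(i in [set: 'I_n])
   ((fun x : borel 'rV[R]_n => x 0 i : R) @^-1` [set y | `|ratr (q.1.1 0 i) - y| < ratr q.1.2])); last first.
    by apply/seteqP; split=> [y h i _|y h i]; [exact: h|exact: h].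
  apply: fin_bigcap_measurable => // i _; rewrite -[X in measurable X]setTI.
  apply: measurable_coord => //; apply: open_measurable.
  exact: open_dist_lt.
apply: mf2 => //; apply: open_measurable.
exact: open_dist_lt.
Qed.

Lemma continuous_fst_coord n (i : 'I_n) :
  continuous (fun z : spacetime R n => z.1 0 i).
Proof.
move=> z; apply: (@continuous_comp _ _ _ fst (fun x : 'rV[R]_n => x 0 i)).
  exact: cvg_fst.
exact: coord_continuous.
Qed.

Lemma measurable_fst_coord n (i : 'I_n) :
  measurable_fun setT (fun z : borel (spacetime R n) => z.1 0 i : R).
Proof. by apply: continuous_measurable_spacetime => z; exact: continuous_fst_coord. Qed.

Lemma measurable_time n :
  measurable_fun setT (fun z : borel (spacetime R n) => z.2 : R).
Proof. by apply: continuous_measurable_spacetime => z; exact: cvg_snd. Qed.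

Lemma measurable_space n :
  measurable_fun setT (fun z : borel (spacetime R n) => z.1 : borel 'rV[R]_n).
Proof. by apply: measurable_fun_rV => i; exact: measurable_fst_coord. Qed.

End BorelSets.

(** * Complex integrals *)

(** The integral formula holds for simple functions by the definition of the density and passes to
    nonnegative functions by monotone convergence. *)
Lemma exists_density d (T : measurableType d) (R : realType)
    (m : {measure set T -> \bar R}) (k : T -> R) :
  (forall x, 0 <= k x) -> measurable_fun setT k ->
  exists nu : {measure set T -> \bar R},
    (forall A, nu A = \int[m]_(x in A) (k x)%:E)%E /\
    forall f : T -> \bar R, (forall x, (0 <= f x)%E) -> measurable_fun setT f ->
      (\int[nu]_x f x = \int[m]_x (f x * (k x)%:E))%E.
Proof.
move=> k0 mk; pose dens A := (\int[m]_(x in A) (k x)%:E)%E.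
have d0 : dens set0 = 0%E by rewrite /dens integral_set0.
have dge0 A : (0 <= dens A)%E by apply: integral_ge0 => x _; rewrite lee_fin.
have mkE : measurable_fun setT (EFin \o k) by exact/measurable_EFinP.
have dsa : semi_sigma_additive dens.
  move=> F mF tF mUF; rewrite /dens ge0_integral_bigcup//.
  - by apply: is_cvg_ereal_nneg_natsum_cond => n _ _; exact: dge0.
  - exact: measurable_funTS.
  - by move=> x _; rewrite lee_fin.
pose nu : {measure set T -> \bar R} := HB.pack dens (isMeasure.Build _ _ _ dens d0 dge0 dsa).
exists nu; split => // f f0 mf.
pose f_ := nnsfun_approx measurableT mf.
transitivity (limn (fun n => \int[nu]_x (f_ n x)%:E))%E.
  rewrite -monotone_convergence//.
  - apply: eq_integral => y _; apply/esym/cvg_lim => //.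
    by apply: cvg_nnsfun_approx.
  - by move=> n; exact/measurable_EFinP/measurable_funP.
  - by move=> n y _; rewrite lee_fin.
  - by move=> y _ a b ab; rewrite lee_fin; exact/lefP/nd_nnsfun_approx.
transitivity (limn (fun n => \int[m]_x ((f_ n x)%:E * (k x)%:E)))%E; last first.
  rewrite -monotone_convergence//.
  - apply: eq_integral => y _; apply/cvg_lim => //.
    apply: cvgeZr => //; exact: cvg_nnsfun_approx.
  - move=> n; apply: emeasurable_funM => //.
    exact/measurable_EFinP/measurable_funP.
  - by move=> n y _; rewrite mule_ge0// lee_fin.
  - move=> y _ a b ab; rewrite lee_wpmul2r ?lee_fin//.
    exact/lefP/nd_nnsfun_approx.
congr (limn _); apply/funext => n.
rewrite integralT_nnsfun sintegralE.
transitivity (\int[m]_x (\sum_(r \in range (f_ n))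
    (r%:E * ((\1_(f_ n @^-1` [set r]) x)%:E * (k x)%:E))))%E; last first.
  apply: eq_integral => x _; rewrite [in RHS]fimfunE -fsumEFin//.
  rewrite ge0_mule_fsuml; last by move=> r; rewrite nnfun_muleindic_ge0.
  by apply: eq_fsbigr => r _; rewrite EFinM muleA.
rewrite ge0_integral_fsum//; last 2 first.
- move=> r; apply: emeasurable_funM => //; apply: emeasurable_funM => //.
  exact/measurable_EFinP.
- move=> r x _; rewrite muleA mule_ge0 ?lee_fin//.
  by have := nnfun_muleindic_ge0 (f_ n) r x; rewrite lee_fin.
apply: eq_fsbigr => r /set_mem[y _ <-].
rewrite ge0_integralZl//; last 3 first.
- apply: emeasurable_funM => //; exact/measurable_EFinP.
- by move=> x _; rewrite mule_ge0 ?lee_fin.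
- by rewrite lee_fin.
congr (_ * _)%E; rewrite /nu /= /dens integral_mkcond.
apply: eq_integral => x _; rewrite patchE indicE.
by case: ifPn => h; rewrite ?mul1e ?mul0e.
Qed.

Lemma integrable_le d (T : measurableType d) (R : realType)
    (m : {measure set T -> \bar R}) (f g : T -> R) :
  measurable_fun setT f -> m.-integrable setT (EFin \o g) ->
  (forall x, `|f x| <= g x) -> m.-integrable setT (EFin \o f).
Proof.
move=> mf ig fg; apply: (le_integrable _ _ _ ig) => //.
  exact/measurable_EFinP.
by move=> x _; rewrite /= lee_fin (le_trans (fg x))// ler_norm.
Qed.

Section ComplexMeasurable.
Context d (T : measurableType d) (R : realType).
Implicit Types f g : T -> R[i].

Definition cmeasurable f :=
  measurable_fun setT (cRe \o f) /\ measurable_fun setT (cIm \o f).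

Lemma cmeasurable_cst c : cmeasurable (fun=> c).
Proof. by split; exact: measurable_cst. Qed.

Lemma cmeasurableD f g : cmeasurable f -> cmeasurable g ->
  cmeasurable (fun x => f x + g x).
Proof.
move=> [f1 f2] [g1 g2]; split; rewrite /comp /=.
  by under eq_fun do rewrite cReD; exact: measurable_funD.
by under eq_fun do rewrite cImD; exact: measurable_funD.
Qed.

Lemma cmeasurableM f g : cmeasurable f -> cmeasurable g ->
  cmeasurable (fun x => f x * g x).
Proof.
move=> [f1 f2] [g1 g2]; split; rewrite /comp /=.
  by under eq_fun do rewrite cReM; apply: measurable_funB; exact: measurable_funM.
by under eq_fun do rewrite cImM; apply: measurable_funD; exact: measurable_funM.
Qed.

Lemma cmeasurable_real (f : T -> R) :
  measurable_fun setT f -> cmeasurable (fun x => (f x)%:C).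
Proof. by move=> mf; split => //; exact: measurable_cst. Qed.

Lemma cmeasurable_expi (f : T -> R) :
  measurable_fun setT f -> cmeasurable (fun x => expi (f x)).
Proof.
move=> mf; split; apply: measurableT_comp mf.
  by apply: continuous_measurable_fun; exact: continuous_cos.
by apply: continuous_measurable_fun; exact: continuous_sin.
Qed.

Lemma measurable_normc f : cmeasurable f -> measurable_fun setT (normc \o f).
Proof.
move=> [f1 f2]; rewrite /comp /=; under eq_fun do rewrite normcE.
apply: (measurableT_comp (continuous_measurable_fun (@sqrt_continuous R))).
by apply: measurable_funD; exact: measurable_funX.
Qed.

Lemma cmeasurable_cvg (F : nat -> T -> R[i]) f :
  (forall n, cmeasurable (F n)) -> (forall x, F n x @[n --> \oo] --> f x) ->
  cmeasurable f.
Proof.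
move=> mF Ff; split.
  apply: (measurable_fun_cvg (h := fun n => cRe \o F n)).
    by move=> n; exact: (mF n).1.
  by move=> x _; exact: cvg_cRe (Ff x).
apply: (measurable_fun_cvg (h := fun n => cIm \o F n)).
  by move=> n; exact: (mF n).2.
by move=> x _; exact: cvg_cIm (Ff x).
Qed.

End ComplexMeasurable.

Lemma cmeasurable_comp d1 d2 (T1 : measurableType d1) (T2 : measurableType d2)
    (R : realType) (p : T1 -> T2) (f : T2 -> R[i]) :
  measurable_fun setT p -> cmeasurable f -> cmeasurable (fun x => f (p x)).
Proof. move=> mp [f1 f2]; split.
  by apply: (measurableT_comp f1 mp).
by apply: (measurableT_comp f2 mp). Qed.

Section ComplexIntegral.
Context d (T : measurableType d) (R : realType).
Implicit Types (f g : T -> R[i]).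

Context (m : {measure set T -> \bar R}).

Definition cint f : R[i] :=
  (\int[m]_x complex.Re (f x)) +i* (\int[m]_x complex.Im (f x)).

Definition cintegrable f :=
  m.-integrable setT (EFin \o (cRe \o f)) /\
  m.-integrable setT (EFin \o (cIm \o f)).

Lemma cintegrable_le f (g : T -> R) : cmeasurable f ->
  m.-integrable setT (EFin \o g) -> (forall x, normc (f x) <= g x) ->
  cintegrable f.
Proof.
move=> [f1 f2] ig fg; split; apply: (integrable_le _ ig) => // x.
  exact: le_trans (ler_norm_cRe _) (fg x).
exact: le_trans (ler_norm_cIm _) (fg x).
Qed.

Lemma cintegrable_measurable f : cintegrable f -> cmeasurable f.
Proof.
by move=> [/integrableP[/measurable_EFinP f1 _] /integrableP[/measurable_EFinP f2 _]].
Qed.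

Lemma integrable_normc f : cintegrable f -> m.-integrable setT (EFin \o (normc \o f)).
Proof.
move=> cf; have [f1 f2] := cf.
apply: (@integrable_le _ _ _ _ _ (fun x => `|complex.Re (f x)| + `|complex.Im (f x)|)).
- exact/measurable_normc/cintegrable_measurable.
- rewrite /comp; under eq_fun do rewrite EFinD.
  by apply: integrableD => //; exact: integrable_norm.
- by move=> x /=; rewrite ger0_norm ?normc_ge0 ?normc_le_ReIm.
Qed.

Lemma cintegrableZ (c : R[i]) f : cintegrable f -> cintegrable (fun x => c * f x).
Proof.
move=> [f1 f2]; split; rewrite /comp /=.
  under eq_fun do rewrite cReM EFinB !EFinM.
  by apply: integrableB => //; exact: integrableZl.
under eq_fun do rewrite cImM EFinD !EFinM.
by apply: integrableD => //; exact: integrableZl.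
Qed.

Lemma cintD f g : cintegrable f -> cintegrable g ->
  cint (fun x => f x + g x) = cint f + cint g.
Proof.
move=> [f1 f2] [g1 g2]; apply: complex_eqP; rewrite ?cReD ?cImD /=.
  by under eq_Rintegral do rewrite cReD; rewrite RintegralD.
by under eq_Rintegral do rewrite cImD; rewrite RintegralD.
Qed.

Lemma cintZ (c : R[i]) f : cintegrable f ->
  cint (fun x => c * f x) = c * cint f.
Proof.
move=> [f1 f2]; apply: complex_eqP; rewrite ?cReM ?cImM /=.
  under eq_Rintegral do rewrite cReM; rewrite RintegralB//; last 2 first.
  - by rewrite /comp; under eq_fun do rewrite EFinM; exact: integrableZl.
  - by rewrite /comp; under eq_fun do rewrite EFinM; exact: integrableZl.
  by rewrite !RintegralZl.
under eq_Rintegral do rewrite cImM; rewrite RintegralD//; last 2 first.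
- by rewrite /comp; under eq_fun do rewrite EFinM; exact: integrableZl.
- by rewrite /comp; under eq_fun do rewrite EFinM; exact: integrableZl.
by rewrite !RintegralZl.
Qed.

(** The factor 2 comes from estimating real and imaginary parts separately; only finiteness of the
    bound matters later. *)
Lemma normc_cint_le f (g : T -> R) : cintegrable f ->
  m.-integrable setT (EFin \o g) -> (forall x, normc (f x) <= g x) ->
  normc (cint f) <= 2 * \int[m]_x g x.
Proof.
move=> [f1 f2] ig fg; apply: (le_trans (normc_le_ReIm _)) => /=.
rewrite mulr_natl mulr2n; apply: lerD.
  apply: (le_trans (le_normr_Rintegral _ f1)) => //.
  apply: le_Rintegral => //; first exact: integrable_norm.
  by move=> x _ /=; exact: le_trans (ler_norm_cRe _) (fg x).
apply: (le_trans (le_normr_Rintegral _ f2)) => //.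
apply: le_Rintegral => //; first exact: integrable_norm.
by move=> x _ /=; exact: le_trans (ler_norm_cIm _) (fg x).
Qed.

Lemma cvg_Rintegral (F : nat -> T -> R) (f g : T -> R) :
  (forall n, measurable_fun setT (F n)) ->
  (forall x, F n x @[n --> \oo] --> f x) ->
  m.-integrable setT (EFin \o g) -> (forall n x, `|F n x| <= g x) ->
  (\int[m]_x F n x) @[n --> \oo] --> \int[m]_x f x.
Proof.
move=> mF Ff ig Fg.
have fin : (\int[m]_x (f x)%:E)%E \is a fin_num.
  apply: integrable_fin_num => //.
  apply: (@integrable_le _ _ _ _ _ g) => //.
    apply: (measurable_fun_cvg mF) => x _; exact: Ff.
  move=> x; have /cvg_norm h := Ff x; rewrite -(cvg_lim _ h)//.
  by apply: limr_le; [exact: cvgP h|near=> n; exact: Fg].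
rewrite /Rintegral; apply: fine_cvg; rewrite fineK//.
apply: (@dominated_cvg _ _ _ m _ _ (fun n x => (F n x)%:E) _ (EFin \o g)) => //.
- by move=> n; exact/measurable_EFinP.
- by move=> x _; apply: cvg_EFin => //; [exact: nearW|exact: Ff].
- by move=> n x _ /=; rewrite lee_fin.
Unshelve. all: by end_near. Qed.

Lemma cvg_cint (F : nat -> T -> R[i]) f (g : T -> R) :
  (forall n, cmeasurable (F n)) ->
  (forall x, F n x @[n --> \oo] --> f x) ->
  m.-integrable setT (EFin \o g) -> (forall n x, normc (F n x) <= g x) ->
  cint (F n) @[n --> \oo] --> cint f.
Proof.
move=> mF Ff ig Fg; apply: cvg_complex => /=.
  apply: (@cvg_Rintegral (fun n x => complex.Re (F n x)) _ g) => //.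
  - by move=> n; exact: (mF n).1.
  - by move=> x; exact: cvg_cRe (Ff x).
  - by move=> n x; exact: le_trans (ler_norm_cRe _) (Fg n x).
apply: (@cvg_Rintegral (fun n x => complex.Im (F n x)) _ g) => //.
- by move=> n; exact: (mF n).2.
- by move=> x; exact: cvg_cIm (Ff x).
- by move=> n x; exact: le_trans (ler_norm_cIm _) (Fg n x).
Qed.

End ComplexIntegral.

Section ComplexFubini.
Context d1 d2 (T1 : measurableType d1) (T2 : measurableType d2) (R : realType).
Context (m1 : {sigma_finite_measure set T1 -> \bar R}).
Context (m2 : {sigma_finite_measure set T2 -> \bar R}).

(** The inner integral is finite only for almost every [x], so that the extended and the real
    iterated integrals are compared almost everywhere. *)
Lemma Rintegral_prod1 (f : T1 * T2 -> R) :
  (m1 \x m2)%E.-integrable setT (EFin \o f) ->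
  \int[(m1 \x m2)%E]_z f z = \int[m1]_x \int[m2]_y f (x, y).
Proof.
move=> fi; have mf := measurable_int _ fi.
rewrite {1}/Rintegral -(integral12_prod_meas1 fi) /Rintegral; congr fine.
apply: ae_eq_integral => //.
- exact: (measurable_fubini_F fi).
- apply/measurable_EFinP; apply: (measurableT_comp (fine_measurable measurableT)) => //.
  exact: (measurable_fubini_F fi).
have := ae_integrable1 fi; apply: filterS => x ix _.
by rewrite fineK//; exact: integrable_fin_num.
Qed.

Lemma Rintegral_prod2 (f : T1 * T2 -> R) :
  (m1 \x m2)%E.-integrable setT (EFin \o f) ->
  \int[(m1 \x m2)%E]_z f z = \int[m2]_y \int[m1]_x f (x, y).
Proof.
move=> fi; have mf := measurable_int _ fi.
rewrite {1}/Rintegral -(integral21_prod_meas1 fi) /Rintegral; congr fine.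
apply: ae_eq_integral => //.
- exact: (measurable_fubini_G fi).
- apply/measurable_EFinP; apply: (measurableT_comp (fine_measurable measurableT)) => //.
  exact: (measurable_fubini_G fi).
have := ae_integrable2 fi; apply: filterS => x ix _.
by rewrite fineK//; exact: integrable_fin_num.
Qed.

Lemma cint_prod1 (f : T1 * T2 -> R[i]) : cintegrable (m1 \x m2)%E f ->
  cint (m1 \x m2)%E f = cint m1 (fun x => cint m2 (fun y => f (x, y))).
Proof.
by move=> [f1 f2]; congr (_ +i* _) => /=; rewrite (Rintegral_prod1 (f := _ \o f)).
Qed.

Lemma cint_prod2 (f : T1 * T2 -> R[i]) : cintegrable (m1 \x m2)%E f ->
  cint (m1 \x m2)%E f = cint m2 (fun y => cint m1 (fun x => f (x, y))).
Proof.
by move=> [f1 f2]; congr (_ +i* _) => /=; rewrite (Rintegral_prod2 (f := _ \o f)).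
Qed.

Lemma integrable_prod (g : T1 * T2 -> R) : measurable_fun setT g ->
  (forall z, 0 <= g z) ->
  (\int[m1]_x \int[m2]_y (g (x, y))%:E < +oo)%E ->
  (m1 \x m2)%E.-integrable setT (EFin \o g).
Proof.
move=> mg g0 fin; apply/integrableP; split; first exact/measurable_EFinP.
under eq_integral do rewrite /= ger0_norm//.
rewrite fubini_tonelli1//; first exact/measurable_EFinP.
Qed.

End ComplexFubini.

(** * Jordan decomposition of Radon measures *)

Section SetFunctionIntegral.
Context d (T : measurableType d) (R : realType).

(** Stated for a mere set function, since [variation_measure] enters the integral in [slow_growing]
    without being known to be a measure. The condition [mu set0 = 0] makes the negative part of the
    integrand contribute 0. *)
Lemma integral_setfun (mu : set T -> \bar R) (f : T -> \bar R) :
  mu set0 = 0%E -> (forall x, (0 <= f x)%E) ->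
  (\int[mu]_x f x = ereal_sup [set sintegral mu h |
    h in [set h : {nnsfun T >-> R} | forall x, ((h x)%:E <= f x)%E]])%E.
Proof.
move=> mu0 f0; rewrite /integral patch_setT.
have -> : (f^\+)%E = f by apply/funext => x; rewrite (@ge0_funeposE _ _ setT) ?inE.
have -> : (f^\-)%E = (fun=> 0%E).
  by apply/funext => x; rewrite (@ge0_funenegE _ _ setT) ?inE.
rewrite [X in (_ - X)%E](_ : _ = 0%E) ?sube0//.
have s0 : sintegral mu (cst (0 : R)) = 0%E.
  rewrite /sintegral; apply: fsbig1 => r _.
  by case: (eqVneq r 0) => [->|r0]; rewrite ?mul0e// preimage_cst ifF ?mu0 ?mule0//;
    apply/negbTE; rewrite notin_setE => /= /esym/eqP; rewrite (negbTE r0).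
apply/eqP; rewrite eq_le; apply/andP; split; last first.
  by apply/ereal_sup_ubound; exists nnsfun0.
apply/ge_ereal_sup => /= x [h /= h0 <-].
rewrite (eq_sintegral (cst 0)) ?s0// => y.
by apply/eqP; rewrite eq_le -2!lee_fin h0 //= lee_fin//.
Qed.

(** Meant for two comparisons: Jordan parts against the variation, and the variation against a
    measure. The terms of a simple integral compare level set by level set, hence so do the
    suprema. *)
Lemma le_integral_setfun (mu1 mu2 : set T -> \bar R) (f : T -> \bar R) :
  mu1 set0 = 0%E -> mu2 set0 = 0%E -> (forall x, (0 <= f x)%E) ->
  (forall A, measurable A -> (0 <= mu1 A)%E) ->
  (forall A, measurable A -> (mu1 A <= mu2 A)%E) ->
  (\int[mu1]_x f x <= \int[mu2]_x f x)%E.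
Proof.
move=> mu10 mu20 f0 mu1_ge0 mu12; rewrite !integral_setfun//.
have sE (mu : set T -> \bar R) (h : {nnsfun T >-> R}) : mu set0 = 0%E ->
    sintegral mu h = (\sum_(x \in range h) (x%:E * mu (h @^-1` [set x])))%E.
  move=> mu0; rewrite /sintegral (fsbig_widen (range h) setT)//= => x [_ Nfx] /=.
  by rewrite preimage10// mu0 mule0.
apply: ge_ereal_sup => _ [h hf <-].
apply: (@le_trans _ _ (sintegral mu2 h)); last first.
  by apply: ereal_sup_ubound; exists h.
rewrite !sE// lee_fsum// => r [t _ <-].
by rewrite lee_pmul ?lee_fin ?mu12 ?mu1_ge0.
Qed.

(** The sets where [f > 1/(n+1)] exhaust the space and have finite measure by Markov's inequality.
    Sigma-finiteness is wanted for Fubini's theorem. *)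
Lemma sigma_finite_integrable (m : {measure set T -> \bar R}) (f : T -> R) :
  (forall x, 0 < f x) -> m.-integrable setT (EFin \o f) -> sigma_finite setT m.
Proof.
move=> f0 fi; have mf : measurable_fun setT f.
  by apply/measurable_EFinP; exact: measurable_int fi.
pose F n := f @^-1` `](n.+1%:R^-1 : R), +oo[%classic.
have mF n : measurable (F n) by rewrite -[F n]setTI; exact: mf.
exists F.
  apply/seteqP; split=> // x _; have [n _ fn] := near_infty_natSinv_lt (PosNum (f0 x)).
  by exists n => //; rewrite /F /= in_itv /= andbT; have := fn n (leqnn n).
move=> n; split; first exact: mF.
have : (\int[m]_x (n.+1%:R^-1 * \1_(F n) x)%:E < +oo)%E.
  apply: (@le_lt_trans _ _ (\int[m]_x `|(f x)%:E|)%E); last first.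
    by move/integrableP : fi => [].
  apply: ge0_le_integral => //.
  - by apply/measurable_EFinP; apply: measurable_funM => //; exact: measurable_indic.
  - by apply: measurableT_comp => //; exact/measurable_EFinP.
  - move=> x _; rewrite lee_fin (ger0_norm (ltW (f0 x))) indicE.
    case: (boolP (x \in F n)) => [|_]; last by rewrite mulr0 ltW.
    by rewrite inE mulr1 /F /= in_itv /= andbT => /ltW.
under eq_integral do rewrite EFinM.
rewrite ge0_integralZl//; last by apply/measurable_EFinP; exact: measurable_indic.
rewrite integral_indic// setIT.
case: (m (F n)) (measure_ge0 m (F n)) => [r _ _|_|//].
  by rewrite ltry.
by rewrite gt0_muley.
Qed.

End SetFunctionIntegral.

Section BoundedSets.
Context (R : realType) (V : normedModType R).
Implicit Types A B : set V.

Lemma bounded_setP A : bounded_set A <-> exists M, forall z, A z -> `|z| <= M.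
Proof.
split=> [[M [_ h]]|[M h]].
  by exists (M + 1) => z Az; apply: h => //; rewrite ltrDl.
by exists M; split; [exact: num_real|move=> x Mx z /h /le_trans; apply; exact: ltW].
Qed.

Lemma bounded_subset A B : A `<=` B -> bounded_set B -> bounded_set A.
Proof. by move=> AB /bounded_setP[M h]; apply/bounded_setP; exists M => z /AB/h. Qed.

Lemma bounded_setU A B : bounded_set A -> bounded_set B -> bounded_set (A `|` B).
Proof.
move=> /bounded_setP[M h] /bounded_setP[N k]; apply/bounded_setP.
exists (Num.max M N) => z [/h zM|/k zN].
  by rewrite le_max zM.
by rewrite le_max zN orbT.
Qed.

Lemma bounded_set_set0 : bounded_set (set0 : set V).
Proof. by apply/bounded_setP; exists 0. Qed.

End BoundedSets.

Section PositivePart.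
Context (R : realType) (d : nat).
Local Notation E := (spacetime R d).
Implicit Types (nu : set E -> R) (A B : set E).

Lemma bounded_borel0 : bounded_borel (set0 : set E).
Proof. by split; [exact: measurable0|exact: bounded_set_set0]. Qed.

Lemma bounded_borelU A B : bounded_borel A -> bounded_borel B ->
  bounded_borel (A `|` B).
Proof.
by move=> [mA bA] [mB bB]; split; [exact: measurableU|exact: bounded_setU].
Qed.

Lemma bounded_borelI A B : bounded_borel A -> measurable (B : set (borel E)) ->
  bounded_borel (A `&` B).
Proof.
move=> [mA bA] mB; split; first exact: measurableI.
by apply: bounded_subset bA; exact: subIsetl.
Qed.

Lemma bounded_borelD A B : bounded_borel A -> bounded_borel B ->
  bounded_borel (A `\` B).
Proof.
move=> [mA bA] [mB bB]; split; first exact: measurableD.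
by apply: bounded_subset bA; exact: subDsetl.
Qed.

Definition real_radon nu := forall F : nat -> set E,
  (forall n, bounded_borel (F n)) -> trivIset setT F ->
  bounded_set (\bigcup_n F n) ->
  (fun n => \sum_(i < n) nu (F i)) @ \oo --> nu (\bigcup_n F n).

Lemma real_radonN nu : real_radon nu -> real_radon (\- nu).
Proof.
move=> rnu F bF tF bU; under eq_fun do rewrite sumrN.
by apply: cvgN; exact: rnu.
Qed.

Lemma radon_Re (mu : set E -> R[i]) : radon mu -> real_radon (cRe \o mu).
Proof.
move=> rmu F bF tF bU; have /cvg_cRe := rmu F bF tF bU.
rewrite (_ : (cRe \o _) = fun n => \sum_(i < n) (cRe \o mu) (F i))//.
by apply/funext => n /=; rewrite (big_morph (cRe : R[i] -> R) (@cReD R) erefl).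
Qed.

Lemma radon_Im (mu : set E -> R[i]) : radon mu -> real_radon (cIm \o mu).
Proof.
move=> rmu F bF tF bU; have /cvg_cIm := rmu F bF tF bU.
rewrite (_ : (cIm \o _) = fun n => \sum_(i < n) (cIm \o mu) (F i))//.
by apply/funext => n /=; rewrite (big_morph (cIm : R[i] -> R) (@cImD R) erefl).
Qed.

Context (nu : set E -> R) (rnu : real_radon nu).

(** Additivity for the constant sequence [set0]: the partial sums converge and their increments are
    all equal to [nu set0], which is therefore 0. *)
Lemma real_radon0 : nu set0 = 0.
Proof.
have := rnu (F := fun=> set0) (fun=> bounded_borel0).
rewrite bigcup0// => /(_ _ (bounded_set_set0 _)) h.
have {}h : (fun n => \sum_(i < n) nu set0) @ \oo --> nu set0.
  by apply: h; apply/trivIsetP => i j _ _ _; rewrite setI0.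
have h1 : (fun n => \sum_(i < n.+1) nu set0 - \sum_(i < n) nu set0) @ \oo
    --> nu set0 - nu set0.
  by apply: cvgB => //; rewrite -(cvg_shiftS (fun n => \sum_(i < n) nu set0)) in h.
move: h1; rewrite subrr.
under eq_fun do rewrite big_ord_recr /= addrAC subrr add0r.
have h2 : nu set0 @[_ --> \oo] --> nu set0 by exact: cvg_cst.
by move=> h3; exact: (cvg_unique _ h2 h3).
Qed.

Lemma real_radonU A B : bounded_borel A -> bounded_borel B -> A `&` B = set0 ->
  nu (A `|` B) = nu A + nu B.
Proof.
move=> bA bB AB0; have := rnu (F := bigcup2 A B).
rewrite bigcup2E -trivIset_bigcup2 => h.
have {h} : (fun n => \sum_(i < n) nu (bigcup2 A B i)) @ \oo --> nu (A `|` B).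
  apply: h => //; last exact: (bounded_borelU bA bB).2.
  by move=> [|[|n]] //=; exact: bounded_borel0.
rewrite -(cvg_shiftn 2) => h; apply: (cvg_unique _ h) => //.
apply: cvg_near_cst; apply: nearW => n /=.
rewrite addn2 !big_ord_recl /= big1 ?addr0// => i _.
by rewrite real_radon0.
Qed.

Lemma positive_part_ge0 A : (0 <= positive_part nu A)%E.
Proof.
apply: ereal_sup_ubound; exists set0; last by rewrite real_radon0.
by split; [exact: bounded_borel0|exact: sub0set].
Qed.

Lemma le_positive_part A B : A `<=` B -> (positive_part nu A <= positive_part nu B)%E.
Proof.
move=> AB; apply: le_ereal_sup => _ [C [bC CA] <-].
by exists C => //; split => //; exact: subset_trans AB.
Qed.

Lemma positive_part_ub A B : bounded_borel B -> B `<=` A ->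
  ((nu B)%:E <= positive_part nu A)%E.
Proof. by move=> bB BA; apply: ereal_sup_ubound; exists B. Qed.

(** If the right-hand side is infinite there is nothing to show. Otherwise it bounds every sum
    [nu C + nu D], and the two suprema can be taken one after the other with finite quantities
    only. *)
Lemma positive_part_superadditive A B : A `&` B = set0 ->
  (positive_part nu A + positive_part nu B <= positive_part nu (A `|` B))%E.
Proof.
move=> AB0; set L := positive_part nu (A `|` B).
have [Ly|Loo] := eqVneq L +oo%E; first by rewrite Ly leey.
have Lfin : L \is a fin_num.
  by rewrite ge0_fin_numE ?positive_part_ge0// lt_neqAle Loo leey.
have addL C D : bounded_borel C -> C `<=` A -> bounded_borel D -> D `<=` B ->
    ((nu C)%:E + (nu D)%:E <= L)%E.
  move=> bC CA bD DB; rewrite -EFinD -real_radonU//.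
    by apply: positive_part_ub; [exact: bounded_borelU|exact: setUSS].
  by apply/seteqP; split=> // x [/CA Ax /DB Bx]; rewrite -AB0.
have PB D : bounded_borel D -> D `<=` B -> (positive_part nu A <= L - (nu D)%:E)%E.
  move=> bD DB; apply: ge_ereal_sup => _ [C [bC CA] <-].
  by rewrite leeBrDr//; exact: addL.
have PAfin : positive_part nu A \is a fin_num.
  rewrite ge0_fin_numE ?positive_part_ge0//.
  apply: le_lt_trans (PB set0 bounded_borel0 (@sub0set _ _)) _.
  by rewrite real_radon0 sube0 ltey_eq Lfin.
rewrite -leeBrDl//; apply: ge_ereal_sup => _ [D [bD DB] <-].
by rewrite leeBrDr// -leeBrDl//; exact: PB.
Qed.

(** Upper bound: a bounded Borel set is cut along the [F i], and its value is the limit of the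
    partial sums over the pieces. Lower bound: superadditivity over finite unions, then
    monotonicity. *)
Lemma positive_part_sigma_additive :
  semi_sigma_additive (positive_part nu : set (borel E) -> \bar R).
Proof.
move=> F mF tF mUF; set S := (\sum_(0 <= i <oo) positive_part nu (F i))%E.
suff -> : positive_part nu (\bigcup_n F n) = S.
  by apply: is_cvg_ereal_nneg_natsum => n _; exact: positive_part_ge0.
apply/eqP; rewrite eq_le; apply/andP; split.
  apply: ge_ereal_sup => _ [B [bB BF] <-].
  have /= h := rnu (F := fun i => B `&` F i).
  have {h} : (fun n => \sum_(i < n) nu (B `&` F i)) @ \oo --> nu B.
    rewrite -[X in _ --> nu X](setIidl BF) setI_bigcupr; apply: h.
    - by move=> n; exact: bounded_borelI.
    - exact: trivIset_setIl.
    - by rewrite -setI_bigcupr; apply: bounded_subset bB.2; exact: subIsetl.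
  move=> h; have [Sy|Soo] := eqVneq S +oo%E; first by rewrite Sy leey.
  have S0 : (0 <= S)%E by apply: nneseries_ge0 => n _ _; exact: positive_part_ge0.
  have Sfin : S \is a fin_num by rewrite ge0_fin_numE// lt_neqAle Soo leey.
  rewrite -(fineK Sfin) lee_fin -(cvg_lim _ h)//; apply: limr_le.
    exact: cvgP h.
  apply: nearW => n; rewrite -lee_fin fineK//.
  rewrite -sumEFin; apply: (@le_trans _ _ (\sum_(i < n) positive_part nu (F i))%E).
    by apply: lee_sum => i _; apply: positive_part_ub; [exact: bounded_borelI|exact: subIsetr].
  rewrite -(big_mkord xpredT (fun i => positive_part nu (F i))).
  by apply: nneseries_lim_ge => i _ _; exact: positive_part_ge0.
apply: lime_le.
  by apply: is_cvg_ereal_nneg_natsum => n _; exact: positive_part_ge0.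
apply: nearW => n; rewrite big_mkord.
apply: (@le_trans _ _ (positive_part nu (\big[setU/set0]_(i < n) F i))); last first.
  by apply: le_positive_part; exact: bigsetU_bigcup.
elim: n => [|n ih]; first by rewrite !big_ord0 positive_part_ge0.
rewrite !big_ord_recr /=; apply: le_trans (positive_part_superadditive _).
  by rewrite leeD2r.
apply/seteqP; split=> // x []; rewrite -bigcup_mkord => -[i /= ltin Fi] Fn.
have := tF i n I I; move=> /(_ (ex_intro _ x (conj Fi Fn))) ein.
by rewrite ein ltnn in ltin.
Qed.

Lemma positive_part0 : positive_part nu set0 = 0%E.
Proof.
apply/eqP; rewrite eq_le positive_part_ge0 andbT.
by apply: ge_ereal_sup => _ [B [_]] + <-; rewrite subset0 => ->; rewrite real_radon0.
Qed.

Lemma positive_part_measure :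
  exists P : {measure set (borel E) -> \bar R}, forall A, P A = positive_part nu A.
Proof.
pose P : {measure set (borel E) -> \bar R} :=
  HB.pack (positive_part nu : set (borel E) -> \bar R)
  (isMeasure.Build _ _ _ (positive_part nu : set (borel E) -> \bar R)
    positive_part0 positive_part_ge0 positive_part_sigma_additive).
by exists P.
Qed.

End PositivePart.

Section JordanDecomposition.
Context (R : realType) (d : nat).
Local Notation E := (spacetime R d).
Context (nu : set E -> R) (rnu : real_radon nu).

Lemma real_radonD A B : bounded_borel A -> bounded_borel B -> B `<=` A ->
  nu (A `\` B) = nu A - nu B.
Proof.
move=> bA bB BA; rewrite -{2}(setDUK BA) (real_radonU rnu)//.
- by rewrite addrAC subrr add0r.
- exact: bounded_borelD.
- by rewrite setDE setICA setICr setI0.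
Qed.

(** Pass to the complement in [A]: [nu B = nu A - nu (A \ B)], and take suprema over [B]. The
    additive form avoids differences of values that may be infinite. *)
Lemma positive_part_Jordan A : bounded_borel A ->
  positive_part nu A = ((nu A)%:E + positive_part (\- nu)%R A)%E.
Proof.
move=> bA; apply/eqP; rewrite eq_le; apply/andP; split.
  apply: ge_ereal_sup => _ [B [bB BA] <-].
  rewrite -leeBlDl//; apply: le_trans (positive_part_ub _ (bounded_borelD bA bB) (@subDsetl _ _ _)).
  by rewrite /= real_radonD// opprB EFinB.
rewrite addeC -leeBrDr//; apply: ge_ereal_sup => _ [B [bB BA] <-].
rewrite leeBrDr// addeC -EFinD /= -real_radonD//.
by apply: positive_part_ub; [exact: bounded_borelD|exact: subDsetl].
Qed.

End JordanDecomposition.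

(** * Weights *)

Section Weights.
Context (R : realType) (d : nat).
Local Notation E := (spacetime R d).
Implicit Types z : E.

Lemma sqnorm_space_ge0 (x : 'rV[R]_d) : 0 <= sqnorm_space x.
Proof. by apply: sumr_ge0 => i _; exact: sqr_ge0. Qed.

Lemma sqnorm_ge0 z : 0 <= sqnorm z.
Proof. by rewrite addr_ge0 ?sqr_ge0 ?sqnorm_space_ge0. Qed.

Lemma sqnorm1_gt0 z : 0 < 1 + sqnorm z.
Proof. by rewrite ltr_pwDl ?sqnorm_ge0. Qed.

Lemma sqnorm1_ge1 z : 1 <= 1 + sqnorm z.
Proof. by rewrite lerDl sqnorm_ge0. Qed.

Definition wgt (N : nat) z : R := (1 + sqnorm z) ^- N.

Lemma wgt_gt0 N z : 0 < wgt N z.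
Proof. by rewrite invr_gt0 exprn_gt0 ?sqnorm1_gt0. Qed.

Lemma wgt_ge0 N z : 0 <= wgt N z.
Proof. exact/ltW/wgt_gt0. Qed.

Lemma le_wgt M N z : (M <= N)%N -> wgt N z <= wgt M z.
Proof.
move=> MN; rewrite lef_pV2 ?posrE ?exprn_gt0 ?sqnorm1_gt0//.
by rewrite ler_weXn2l ?sqnorm1_ge1.
Qed.

Lemma measurable_sqnorm : measurable_fun setT (@sqnorm R d : borel E -> R).
Proof.
apply: measurable_funD; last by apply: measurable_funX; exact: measurable_time.
by apply: measurable_sum => i; apply: measurable_funX; exact: measurable_fst_coord.
Qed.

Lemma measurable_wgt N : measurable_fun setT (wgt N : borel E -> R).
Proof.
(* Inversion is made continuous on the whole line by truncating below at 1; the powers of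
   [1 + sqnorm z] are at least 1. *)
have cV : measurable_fun setT (fun r : R => (Num.max r 1)^-1).
  apply: continuous_measurable_fun => r; apply: cvgV.
    by rewrite gt_eqF// lt_max ltr01 orbT.
  by apply: continuous_max; [exact: cvg_id|exact: cvg_cst].
rewrite (_ : wgt N = (fun r : R => (Num.max r 1)^-1) \o (fun z => (1 + sqnorm z) ^+ N)).
  apply: measurableT_comp cV _; apply: measurable_funX.
  by apply: measurable_funD; [exact: measurable_cst|exact: measurable_sqnorm].
by apply/funext => z; rewrite /= max_l// exprn_ege1// sqnorm1_ge1.
Qed.

Lemma ler_coord_norm z i : `|z.1 0 i| <= `|z|.
Proof.
rewrite prod_normE le_max; apply/orP; left.
rewrite {2}/Num.norm /= mx_normrE.
exact: (le_bigmax _ (fun ij => `|z.1 ij.1 ij.2|) (0, i)).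
Qed.

Lemma ler_time_norm z : `|z.2| <= `|z|.
Proof. by rewrite prod_normE le_max lexx orbT. Qed.

Lemma sqr_coord_le_sqnorm z i : z.1 0 i ^+ 2 <= sqnorm z.
Proof.
rewrite /sqnorm /sqnorm_space (bigD1 i)//= -addrA lerDl addr_ge0 ?sqr_ge0//.
by apply: sumr_ge0 => j _; exact: sqr_ge0.
Qed.

Lemma sqr_time_le_sqnorm z : z.2 ^+ 2 <= sqnorm z.
Proof. by rewrite lerDr sqnorm_space_ge0. Qed.

Lemma bounded_sqnorm (A : set E) : bounded_set A ->
  exists2 M, 0 <= M & forall z, A z -> sqnorm z <= M.
Proof.
move=> /bounded_setP[M AM]; exists (M ^+ 2 *+ d + M ^+ 2).
  by rewrite addr_ge0 ?mulrn_wge0 ?sqr_ge0.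
move=> z Az; apply: lerD.
  rewrite -[X in _ *+ X]card_ord -sumr_const; apply: ler_sum => i _.
  rewrite -real_normK ?num_real// lerXn2r ?nnegrE//.
    exact: le_trans (AM _ Az).
  exact: le_trans (ler_coord_norm _ _) (AM _ Az).
rewrite -real_normK ?num_real// lerXn2r ?nnegrE//.
  exact: le_trans (AM _ Az).
exact: le_trans (ler_time_norm _) (AM _ Az).
Qed.

Lemma sqnorm_bounded (M : R) : bounded_set [set z : E | sqnorm z <= M].
Proof.
apply/bounded_setP; exists (`|M| + 1) => z /= zM.
have sqb (a : R) : a ^+ 2 <= M -> `|a| <= `|M| + 1.
  move=> aM; have [a1|a1] := lerP `|a| 1; first by rewrite (le_trans a1)// lerDr.
  apply: (@le_trans _ _ (`|a| ^+ 2)); first by rewrite ler_eXnr// ltW.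
  by rewrite real_normK ?num_real// (le_trans aM)// (le_trans (ler_norm _))// lerDl.
rewrite prod_normE ge_max; apply/andP; split; last first.
  by apply: sqb; apply: le_trans zM; exact: sqr_time_le_sqnorm.
rewrite {1}/Num.norm /= mx_normrE; apply: bigmax_le; first by rewrite addr_ge0.
move=> [i j] _ /=; rewrite ord1.
by apply: sqb; apply: le_trans zM; exact: sqr_coord_le_sqnorm.
Qed.

(** Makes the indicator of a bounded set a function dominated by any [wgt N], so that the weighted
    estimates reach bounded Borel sets. *)
Lemma bounded_le_wgt N (A : set E) : bounded_set A ->
  exists2 c, 0 <= c & forall z, A z -> 1 <= c * wgt N z.
Proof.
move=> /bounded_sqnorm[M M0 AM]; exists ((1 + M) ^+ N).
  by rewrite exprn_ge0// addr_ge0.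
move=> z Az; rewrite /wgt ler_pdivlMr ?exprn_gt0 ?sqnorm1_gt0// mul1r.
have s0 := sqnorm_ge0 z; have sM := AM z Az.
by apply: lerXn2r; rewrite ?nnegrE; lra.
Qed.

End Weights.

Lemma exists_density_pushforward d1 d2 (T : measurableType d1) (Y : measurableType d2)
    (R : realType) (m : {measure set T -> \bar R}) (k : T -> R) (p : T -> Y) :
  (forall x, 0 <= k x) -> measurable_fun setT k -> measurable_fun setT p ->
  exists K : {measure set Y -> \bar R},
    (forall A, measurable A -> K A = \int[m]_x (k x * \1_A (p x))%:E)%E /\
    forall f : Y -> \bar R, (forall y, (0 <= f y)%E) -> measurable_fun setT f ->
      (\int[K]_y f y = \int[m]_x (f (p x) * (k x)%:E))%E.
Proof.
move=> k0 mk mp; have [nu [nuE nuint]] := exists_density m k0 mk.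
pose p' : {mfun T >-> Y} := HB.pack p (isMeasurableFun.Build _ _ _ _ p mp).
exists (pushforward nu p').
have intE f : (forall y, (0 <= f y)%E) -> measurable_fun setT f ->
    (\int[pushforward nu p']_y f y = \int[m]_x (f (p x) * (k x)%:E))%E.
  move=> f0 mf; rewrite (ge0_integral_pushforward mp)// preimage_setT nuint//.
    by move=> x; exact: f0.
  by apply: measurableT_comp mf _.
split; last exact: intE.
move=> A mA; transitivity (\int[pushforward nu p']_y (\1_A y)%:E)%E.
  by rewrite integral_indic// setIT.
rewrite intE.
- by apply: eq_integral => x _; rewrite muleC.
- by move=> y; rewrite lee_fin.
- exact/measurable_EFinP/measurable_indic.
Unshelve. all: exact: mp.
Qed.

Section SignedRepresentation.
Context (R : realType) (d : nat).
Local Notation E := (spacetime R d).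
Context d' (T : measurableType d') (m : {measure set T -> \bar R}).
Context (p : T -> borel E) (mp : measurable_fun setT p) (N : nat).

Lemma integrable_weighted (k : T -> R) (f : E -> R) (C : R) :
  measurable_fun setT k ->
  m.-integrable setT (EFin \o (fun x => `|k x| * wgt N (p x))) ->
  measurable_fun setT (f : borel E -> R) -> (forall z, `|f z| <= C * wgt N z) ->
  m.-integrable setT (EFin \o (fun x => k x * f (p x))).
Proof.
move=> mk ik mf fC.
apply: (@integrable_le _ _ _ _ _ (fun x => C * (`|k x| * wgt N (p x)))).
- by apply: measurable_funM => //; exact: measurableT_comp.
- by rewrite /comp; under eq_fun do rewrite EFinM; exact: integrableZl.
- by move=> x; rewrite normrM mulrCA ler_wpM2l.
Qed.

Lemma cintegrable_weighted (h : T -> R[i]) (f : E -> R[i]) (C : R) :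
  cmeasurable h ->
  m.-integrable setT (EFin \o (fun x => normc (h x) * wgt N (p x))) ->
  @cmeasurable _ (borel E) _ f -> (forall z, normc (f z) <= C * wgt N z) ->
  cintegrable m (fun x => h x * f (p x)).
Proof.
move=> mh ih mf fC.
apply: (@cintegrable_le _ _ _ _ _ (fun x => C * (normc (h x) * wgt N (p x)))).
- by apply: cmeasurableM => //; exact: (cmeasurable_comp mp mf).
- by rewrite /comp; under eq_fun do rewrite EFinM; exact: integrableZl.
- by move=> x; rewrite normcM mulrCA ler_wpM2l// normc_ge0.
Qed.

Lemma indic_le_wgt (A : set E) : bounded_set A ->
  exists c, forall z, `|\1_A z : R| <= c * wgt N z.
Proof.
move=> /(bounded_le_wgt N)[c c0 Ac]; exists c => z; rewrite indicE.
case: (boolP (z \in A)) => [|_]; first by rewrite inE normr1 => /Ac.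
by rewrite normr0 mulr_ge0// wgt_ge0.
Qed.

Context (k : T -> R) (mk : measurable_fun setT k).
Context (ik : m.-integrable setT (EFin \o (fun x => `|k x| * wgt N (p x)))).
Context (nu : set E -> R) (rnu : real_radon nu).
Context (nuE : forall A, bounded_borel A -> nu A = \int[m]_x (k x * \1_A (p x))).

(** The images [Kp] and [Kn] of the positive and negative parts of [k m] need not be mutually
    singular, since [p] may identify points, and so they may differ from the Jordan parts [P] and
    [P'] of [nu]. But [P <= Kp], [P' <= Kn] and [P + Kn = P' + Kp], which gives integrability and
    equal differences of integrals. *)
Lemma signed_integral_rep (f : E -> R) (C : R) :
  measurable_fun setT (f : borel E -> R) -> (forall z, `|f z| <= C * wgt N z) ->
  signed_integral nu setT f = \int[m]_x (k x * f (p x)).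
Proof.
move=> mf fC; have rnu' := real_radonN rnu.
have [P PE] := positive_part_measure rnu.
have [P' P'E] := positive_part_measure rnu'.
pose kp x := Num.max (k x) 0; pose kn x := Num.max (- k x) 0.
have kE x : k x = kp x - kn x by exact: max0_subN.
have kp0 x : 0 <= kp x by rewrite le_max lexx orbT.
have kn0 x : 0 <= kn x by rewrite le_max lexx orbT.
have kpk x : `|kp x| <= `|k x|.
  by rewrite ger0_norm// ge_max ler_norm normr_ge0.
have knk x : `|kn x| <= `|k x|.
  by rewrite ger0_norm// ge_max normr_ge0 -normrN ler_norm.
have mkp : measurable_fun setT kp by apply: measurable_maxr => //; exact: measurable_cst.
have mkn : measurable_fun setT kn.
  by apply: measurable_maxr; [exact: measurableT_comp|exact: measurable_cst].
have iw (l : T -> R) : measurable_fun setT l -> (forall x, `|l x| <= `|k x|) ->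
    m.-integrable setT (EFin \o (fun x => `|l x| * wgt N (p x))).
  move=> ml lk; apply: (integrable_le _ ik).
    by apply: measurable_funM; [exact: measurableT_comp|exact: measurableT_comp (measurable_wgt N) mp].
  by move=> x; rewrite normrM normr_id ger0_norm ?wgt_ge0// ler_wpM2r// wgt_ge0.
have ikp := iw _ mkp kpk; have ikn := iw _ mkn knk.
have [Kp [KpE Kpint]] := exists_density_pushforward m kp0 mkp mp.
have [Kn [KnE Knint]] := exists_density_pushforward m kn0 mkn mp.
have mI A : measurable (A : set (borel E)) ->
    measurable_fun setT (\1_A : borel E -> R) by move=> mA; exact: measurable_indic.
have bA A : bounded_borel A -> [/\ Kp A \is a fin_num, Kn A \is a fin_num &
    nu A = fine (Kp A) - fine (Kn A)].
  move=> bA; have [c cA] := indic_le_wgt bA.2.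
  have ip := integrable_weighted mkp ikp (mI _ bA.1) cA.
  have in_ := integrable_weighted mkn ikn (mI _ bA.1) cA.
  split.
  - by rewrite KpE ?bA.1//; [exact: integrable_fin_num ip|exact: bA.1].
  - by rewrite KnE ?bA.1//; [exact: integrable_fin_num in_|exact: bA.1].
  rewrite KpE; last exact: bA.1.
  rewrite KnE; last exact: bA.1.
  rewrite nuE// -RintegralB//.
  by apply: eq_Rintegral => x _; rewrite kE mulrBl.
have le_Kp A : measurable A -> (P A <= Kp A)%E.
  move=> mA; rewrite PE; apply: ge_ereal_sup => _ [B [bB BA] <-].
  apply: (@le_trans _ _ (Kp B)); last by apply: le_measure; rewrite ?inE//; exact: bB.1.
  have [fp fn ->] := bA B bB; rewrite EFinB !fineK// leeBlDr// leeDl//.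
have le_Kn A : measurable A -> (P' A <= Kn A)%E.
  move=> mA; rewrite P'E; apply: ge_ereal_sup => _ [B [bB BA] <-].
  apply: (@le_trans _ _ (Kn B)); last by apply: le_measure; rewrite ?inE//; exact: bB.1.
  have [fp fn /= ->] := bA B bB.
  by rewrite opprB EFinB !fineK// leeBlDr// leeDl//.
have PK_bounded A : bounded_borel A -> (P A + Kn A = P' A + Kp A)%E.
  move=> bA'; have [fp fn nuA] := bA A bA'.
  rewrite PE (positive_part_Jordan rnu bA') -P'E.
  rewrite nuA EFinB !fineK// addeAC addeC; congr (_ + _)%E.
  by rewrite subeK.
have PK A : measurable A -> (measure_add P Kn A = measure_add P' Kp A)%E.
  (* On unbounded sets the terms may be infinite; the identity spreads from the bounded pieces [F n]
     by continuity from below. *)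
  move=> mA; pose F n := A `&` [set z : borel E | sqnorm z <= n%:R].
  have mB n : measurable [set z : borel E | sqnorm z <= n%:R].
    rewrite [X in measurable X](_ : _ = (@sqnorm R d : borel E -> R) @^-1` `]-oo, n%:R]%classic).
      by rewrite -[X in measurable X]setTI; exact: measurable_sqnorm.
    by apply/seteqP; split=> z /=; rewrite in_itv.
  have mF n : measurable (F n) by exact: measurableI.
  have FA : \bigcup_n F n = A.
    apply/seteqP; split=> [z [n _ []]//|z Az].
    exists (Num.truncn (sqnorm z)).+1 => //; split => //=.
    by rewrite ltW// truncnS_gt.
  have ndF : {homo F : n m / (n <= m)%N >-> (n <= m)%O}.
    move=> a b ab; apply/subsetPset => z [Az zn]; split => //=.
    by rewrite (le_trans zn)// ler_nat.
  have mUF : measurable (\bigcup_n F n) by rewrite FA.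
  have h1 := nondecreasing_cvg_mu (mu := measure_add P Kn) mF mUF ndF.
  have h2 := nondecreasing_cvg_mu (mu := measure_add P' Kp) mF mUF ndF.
  rewrite FA in h1 h2; apply: (cvg_unique _ h1) => //.
  suff -> : measure_add P Kn \o F = measure_add P' Kp \o F by [].
  apply/funext => n /=; rewrite !measure_addE PK_bounded//.
  split; first exact: mF.
  apply: (@bounded_subset _ _ _ [set z : E | sqnorm z <= n%:R]) => [z []//|].
  exact: sqnorm_bounded.
have PKint (g : E -> R) : measurable_fun setT (g : borel E -> R) ->
    (forall z, 0 <= g z) -> (forall z, `|g z| <= C * wgt N z) ->
    [/\ P.-integrable setT (EFin \o (g : borel E -> R)),
        P'.-integrable setT (EFin \o (g : borel E -> R)) &
        \int[P]_z g z - \int[P']_z g z = \int[m]_x (k x * g (p x))].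
  move=> mg g0 gC.
  have mgE : measurable_fun setT (EFin \o (g : borel E -> R)) by exact/measurable_EFinP.
  have g0E z : (0 <= (EFin \o (g : borel E -> R)) z)%E by rewrite lee_fin.
  have ip := integrable_weighted mkp ikp mg gC.
  have in_ := integrable_weighted mkn ikn mg gC.
  have KpI : (\int[Kp]_z (g z)%:E)%E = (\int[m]_x (kp x * g (p x)))%:E.
    rewrite Kpint// fineK; last exact: integrable_fin_num.
    by apply: eq_integral => x _; rewrite /= -EFinM mulrC.
  have KnI : (\int[Kn]_z (g z)%:E)%E = (\int[m]_x (kn x * g (p x)))%:E.
    rewrite Knint// fineK; last exact: integrable_fin_num.
    by apply: eq_integral => x _; rewrite /= -EFinM mulrC.
  have leP : (\int[P]_z (g z)%:E <= \int[Kp]_z (g z)%:E)%E.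
    by apply: ge0_le_measure_integral => //.
  have leP' : (\int[P']_z (g z)%:E <= \int[Kn]_z (g z)%:E)%E.
    by apply: ge0_le_measure_integral => //.
  have iP : P.-integrable setT (EFin \o (g : borel E -> R)).
    apply/integrableP; split => //; under eq_integral do rewrite gee0_abs//.
    by apply: le_lt_trans leP _; rewrite KpI ltry.
  have iP' : P'.-integrable setT (EFin \o (g : borel E -> R)).
    apply/integrableP; split => //; under eq_integral do rewrite gee0_abs//.
    by apply: le_lt_trans leP' _; rewrite KnI ltry.
  split => //.
  have : (\int[P]_z (g z)%:E + \int[Kn]_z (g z)%:E =
          \int[P']_z (g z)%:E + \int[Kp]_z (g z)%:E)%E.
    rewrite -!ge0_integral_measure_add//; do ?by move=> z _; rewrite lee_fin.
    by apply: eq_measure_integral => A mA _; exact: PK.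
  rewrite KpI KnI => h.
  have {}h : \int[P]_z g z + \int[m]_x (kn x * g (p x)) =
             \int[P']_z g z + \int[m]_x (kp x * g (p x)).
    apply: EFin_inj; rewrite !EFinD /Rintegral (fineK (integrable_fin_num _ iP))//.
    by rewrite (fineK (integrable_fin_num _ iP'))//.
  transitivity (\int[m]_x (kp x * g (p x)) - \int[m]_x (kn x * g (p x))).
    by apply/eqP; rewrite subr_eq addrAC eq_sym subr_eq eq_sym h addrC.
  rewrite -RintegralB//.
  by apply: eq_Rintegral => x _; rewrite [in RHS]kE mulrBl.
pose fp z := Num.max (f z) 0; pose fn z := Num.max (- f z) 0.
have fE z : f z = fp z - fn z by exact: max0_subN.
have fpC z : `|fp z| <= C * wgt N z.
  rewrite (le_trans _ (fC z))// ger0_norm; last by rewrite le_max lexx orbT.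
  by rewrite ge_max ler_norm normr_ge0.
have fnC z : `|fn z| <= C * wgt N z.
  rewrite (le_trans _ (fC z))// ger0_norm; last by rewrite le_max lexx orbT.
  by rewrite ge_max normr_ge0 -normrN ler_norm.
have mfp : measurable_fun setT (fp : borel E -> R).
  by apply: measurable_maxr => //; exact: measurable_cst.
have mfn : measurable_fun setT (fn : borel E -> R).
  by apply: measurable_maxr; [exact: measurableT_comp|exact: measurable_cst].
have [|fpP fpP' fpI] := PKint _ mfp _ fpC; first by move=> z; rewrite le_max lexx orbT.
have [|fnP fnP' fnI] := PKint _ mfn _ fnC; first by move=> z; rewrite le_max lexx orbT.
have ifp := integrable_weighted mk ik mfp fpC.
have ifn := integrable_weighted mk ik mfn fnC.
transitivity (\int[P]_z f z - \int[P']_z f z).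
  rewrite /signed_integral /Rintegral.
  have -> : (positive_part nu : set (borel E) -> \bar R) = P.
    by apply/funext => A; rewrite PE.
  have -> : (positive_part (\- nu) : set (borel E) -> \bar R) = P'.
    by apply/funext => A; rewrite P'E.
  by [].
have -> : f = fun z => fp z - fn z by apply/funext.
rewrite !RintegralB//.
transitivity (\int[m]_x (k x * fp (p x)) - \int[m]_x (k x * fn (p x))).
  by rewrite -fpI -fnI !opprB addrACA [in RHS]addrACA; congr (_ + _); exact: addrC.
by rewrite -RintegralB//; apply: eq_Rintegral => x _; rewrite mulrBr.
Qed.

End SignedRepresentation.

Section ComplexRepresentation.
Context (R : realType) (d : nat).
Local Notation E := (spacetime R d).
Context d' (T : measurableType d') (m : {measure set T -> \bar R}).
Context (p : T -> borel E) (h : T -> R[i]).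

(** Slow growth of order [N] for the image of [h m] under [p], said by an integral over [T] and
    without the variation. *)
Definition weighted_density (N : nat) :=
  [/\ measurable_fun setT p, cmeasurable h &
      m.-integrable setT (EFin \o (fun x => normc (h x) * wgt N (p x)))].

Definition density_rep (mu : set E -> R[i]) :=
  forall A, bounded_borel A -> mu A = cint m (fun x => h x * (\1_A (p x))%:C).

Context (N : nat) (wd : weighted_density N).

Lemma weighted_Re :
  m.-integrable setT (EFin \o (fun x => `|complex.Re (h x)| * wgt N (p x))).
Proof.
have [mp mh ih] := wd; apply: (integrable_le _ ih).
  apply: measurable_funM; first exact: measurableT_comp mh.1.
  exact: measurableT_comp (measurable_wgt N) mp.
move=> x; rewrite normrM normr_id ger0_norm ?wgt_ge0// ler_wpM2r ?wgt_ge0//.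
exact: ler_norm_cRe.
Qed.

Lemma weighted_Im :
  m.-integrable setT (EFin \o (fun x => `|complex.Im (h x)| * wgt N (p x))).
Proof.
have [mp mh ih] := wd; apply: (integrable_le _ ih).
  apply: measurable_funM; first exact: measurableT_comp mh.2.
  exact: measurableT_comp (measurable_wgt N) mp.
move=> x; rewrite normrM normr_id ger0_norm ?wgt_ge0// ler_wpM2r ?wgt_ge0//.
exact: ler_norm_cIm.
Qed.

Lemma cintegrable_rep (f : E -> R[i]) (C : R) :
  @cmeasurable _ (borel E) _ f -> (forall z, normc (f z) <= C * wgt N z) ->
  cintegrable m (fun x => h x * f (p x)).
Proof. by have [mp mh ih] := wd; move=> mf fC; exact: (cintegrable_weighted mp mh ih mf fC). Qed.

Lemma cmeasurable_indic (A : set E) : measurable (A : set (borel E)) ->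
  @cmeasurable _ (borel E) _ (fun z => (\1_A z : R)%:C).
Proof. by move=> mA; apply: cmeasurable_real; exact: measurable_indic. Qed.

Lemma cintegrable_indic (A : set E) : bounded_borel A ->
  cintegrable m (fun x => h x * (\1_A (p x))%:C).
Proof.
move=> bA; have [c cA] := indic_le_wgt N bA.2.
apply: (@cintegrable_rep (fun z => (\1_A z : R)%:C) c).
  by apply: cmeasurable_indic; exact: bA.1.
by move=> z; rewrite normcR.
Qed.

Context (mu : set E -> R[i]) (dr : density_rep mu).

Let G (F : nat -> set E) n := \big[setU/set0]_(i < n) F i.

Let GI (F : nat -> set E) n z : trivIset setT F ->
  \1_(G F n.+1) z = \1_(G F n) z + \1_(F n) z :> R.
Proof.
move=> tF; rewrite !indicE /G big_ord_recr /= in_setU.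
case: (boolP (z \in F n)) => zn; last by rewrite orbF addr0.
case: (boolP (z \in _)) => zG; last by rewrite add0r.
move: zG; rewrite inE -bigcup_mkord => -[i /= ltin Fi]; move: zn; rewrite inE => zn.
by have := tF i n I I (ex_intro _ z (conj Fi zn)) => ein; rewrite ein ltnn in ltin.
Qed.

Let bG (F : nat -> set E) n : (forall n, bounded_borel (F n)) -> bounded_borel (G F n).
Proof.
move=> bF; elim: n => [|n ih]; rewrite /G ?big_ord0; first exact: bounded_borel0.
by rewrite big_ord_recr /=; exact: bounded_borelU.
Qed.

Lemma density_rep0 : mu set0 = 0.
Proof.
rewrite dr; last exact: bounded_borel0.
rewrite -(mul0r (cint m (fun x => h x * (\1_set0 (p x))%:C))) -cintZ.
  by congr (cint m _); apply/funext => x; rewrite indic0 mulr0 mul0r.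
by apply: cintegrable_indic; exact: bounded_borel0.
Qed.

(** The partial sums are integrals over the finite unions [G F n], whose indicators converge to that
    of the whole union and are dominated by it. *)
Lemma density_rep_radon : radon mu.
Proof.
have [mp mh ih] := wd.
move=> F bF tF bU; have mU : measurable (\bigcup_n F n : set (borel E)).
  by apply: bigcupT_measurable => i; exact: (bF i).1.
have bbU : bounded_borel (\bigcup_n F n) by [].
have sE n : \sum_(i < n) mu (F i) = cint m (fun x => h x * (\1_(G F n) (p x))%:C).
  elim: n => [|n ih'].
    by rewrite big_ord0 -dr ?/G ?big_ord0 ?density_rep0//; exact: bounded_borel0.
  rewrite big_ord_recr /= ih' dr// -cintD; [|exact: cintegrable_indic (bG _ bF)|exact: cintegrable_indic].
  by congr (cint m _); apply/funext => x; rewrite GI// rmorphD mulrDr.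
rewrite (_ : (fun n => _) = fun n => cint m (fun x => h x * (\1_(G F n) (p x))%:C)); last exact/funext.
rewrite (dr bbU).
apply: (@cvg_cint _ _ _ _ _ _ (fun x => normc (h x * (\1_(\bigcup_n F n) (p x))%:C))).
- by move=> n; apply: cintegrable_measurable; exact: cintegrable_indic (bG _ bF).
- move=> x; apply: cvg_near_cst.
  have [[j _ Fj]|nU] := pselect ((\bigcup_n F n) (p x)).
    exists j.+1 => // n /= jn; congr (_ * (_)%:C); rewrite !indicE !mem_set//.
      by exists j.
    by rewrite /G -bigcup_mkord; exists j.
  apply: nearW => n; congr (_ * (_)%:C); rewrite !indicE !memNset//.
  by rewrite /G -bigcup_mkord => -[j _ Fj]; apply: nU; exists j.
- exact: (integrable_normc (cintegrable_indic bbU)).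
- move=> n x; rewrite !normcM ler_wpM2l ?normc_ge0// !normcR !ger0_norm// !indicE.
  case: (boolP (p x \in G F n)) => // /set_mem; rewrite /G -bigcup_mkord => -[j _ Fj].
  by rewrite mem_set//; exists j.
Qed.

Lemma density_rep_variation : exists K : {measure set (borel E) -> \bar R},
  (forall A, measurable A -> (variation_measure mu A <= K A)%E) /\
  (\int[K]_z (wgt N z)%:E < +oo)%E.
Proof.
have [mp mh ih] := wd.
(* The image of [2 |h| m] bounds the variation; the 2 is that of [normc_cint_le]. *)
have k0 x : 0 <= 2 * normc (h x) by rewrite mulr_ge0 ?normc_ge0.
have mk : measurable_fun setT (fun x => 2 * normc (h x)).
  by apply: measurable_funM; [exact: measurable_cst|exact: measurable_normc].
have [K [KE Kint]] := exists_density_pushforward m k0 mk mp.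
exists K; split; last first.
  rewrite Kint//; last 2 first.
  - by move=> z; rewrite lee_fin wgt_ge0.
  - by apply/measurable_EFinP; exact: measurable_wgt.
  under eq_integral => x _ do rewrite -EFinM mulrC -mulrA EFinM.
  rewrite integralZl//; have := integrable_fin_num measurableT ih.
  by move=> /fineK <-; rewrite -EFinM ltry.
move=> A mA; apply: ge_ereal_sup => _ [n [F [bF tF ->]]].
apply: (@le_trans _ _ (K (G F n))); last first.
  apply: le_measure; rewrite ?inE//.
    by have [] := bG n (fun i => (bF i).1).
  by rewrite /G -bigcup_mkord => z [j _ /(bF j).2].
elim: n => [|n ihn]; first by rewrite big_ord0 measure_ge0.
have bFn i : bounded_borel (F i) := (bF i).1.
rewrite big_ord_recr /= EFinD (_ : K _ = K (G F n) + K (F n))%E; last first.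
  rewrite /G big_ord_recr /= measureU//.
  - by have [] := bG n bFn.
  - exact: (bFn n).1.
  - apply/seteqP; split=> // x []; rewrite -bigcup_mkord => -[i /= ltin Fi] Fn.
    by have := tF i n I I (ex_intro _ x (conj Fi Fn)) => ein; rewrite ein ltnn in ltin.
apply: leeD => //; rewrite dr// KE; last exact: (bFn n).1.
have ci := cintegrable_indic (bFn n); have ni := integrable_normc ci.
rewrite (_ : (\int[m]_x _)%E = (2 * \int[m]_x normc (h x * (\1_(F n) (p x))%:C))%:E); last first.
  rewrite EFinM fineK; last exact: (integrable_fin_num measurableT ni).
  rewrite -integralZl//; apply: eq_integral => x _ /=.
  by rewrite -EFinM normcM normcR ger0_norm// mulrA.
by rewrite lee_fin; apply: (normc_cint_le ci ni).
Qed.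

Lemma variation_measure_ge0 A : (0 <= variation_measure mu A)%E.
Proof.
apply: ereal_sup_ubound; exists 0%N, (fun=> set0).
split; [|by apply/trivIsetP => i j _ _ _; rewrite setI0|by rewrite big_ord0].
by move=> i; split; [exact: bounded_borel0|exact: sub0set].
Qed.

Lemma density_rep_slow_growing : slow_growing mu.
Proof.
split; first exact: density_rep_radon.
exists N; have [K [varK Kfin]] := density_rep_variation.
apply: le_lt_trans Kfin; apply: le_integral_setfun => //.
- apply/eqP; rewrite eq_le variation_measure_ge0 andbT.
  by apply: (le_trans (varK _ measurable0)); rewrite measure0.
- by move=> z; rewrite lee_fin wgt_ge0.
- by move=> A _; exact: variation_measure_ge0.
Qed.

(** The open half-space [t < 0] has variation zero, since [p] avoids it; none of its points is in
    the support. *)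
Lemma density_rep_slow_growing_pos :
  (forall x, 0 <= (p x).2) -> slow_growing_pos mu.
Proof.
move=> p0; split; first exact: density_rep_slow_growing.
move=> z /= supp; rewrite leNgt; apply/negP => z0.
have oU : open [set y : E | y.2 < 0].
  have -> : [set y : E | y.2 < 0] = snd @^-1` [set t : R | t < 0] by [].
  by apply: open_comp; [move=> y _; exact: cvg_snd|exact: open_lt].
have := supp _ oU z0; rewrite ltNge => /negP; apply.
apply: ge_ereal_sup => _ [n [F [bF tF ->]]]; rewrite big1// => i _.
have [bFi Fi0] := bF i; rewrite dr//.
rewrite (_ : (fun x => _) = (fun x => h x * (\1_(set0 : set E) (p x))%:C)).
  by rewrite -dr ?density_rep0 ?Normc.normc0//; exact: bounded_borel0.
apply/funext => x; congr (_ * (_)%:C); rewrite !indicE in_set0 memNset//.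
by move=> /Fi0 /=; rewrite ltNge p0.
Qed.

Lemma radon_integral_rep (f : E -> R[i]) (C : R) :
  @cmeasurable _ (borel E) _ f -> (forall z, normc (f z) <= C * wgt N z) ->
  radon_integral mu setT f = cint m (fun x => h x * f (p x)).
Proof.
move=> [mf1 mf2] fC; have [mp mh ih] := wd.
have rmu := density_rep_radon.
have fC1 z : `|complex.Re (f z)| <= C * wgt N z.
  exact: le_trans (ler_norm_cRe _) (fC z).
have fC2 z : `|complex.Im (f z)| <= C * wgt N z.
  exact: le_trans (ler_norm_cIm _) (fC z).
have nuE1 A : bounded_borel A -> (cRe \o mu) A = \int[m]_x (complex.Re (h x) * \1_A (p x)).
  move=> bA; rewrite /= dr//=; apply: eq_Rintegral => x _.
  by rewrite cReM /= mulr0 subr0.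
have nuE2 A : bounded_borel A -> (cIm \o mu) A = \int[m]_x (complex.Im (h x) * \1_A (p x)).
  move=> bA; rewrite /= dr//=; apply: eq_Rintegral => x _.
  by rewrite cImM /= mulr0 add0r.
have S11 := signed_integral_rep mp mh.1 weighted_Re (radon_Re rmu) nuE1 mf1 fC1.
have S12 := signed_integral_rep mp mh.1 weighted_Re (radon_Re rmu) nuE1 mf2 fC2.
have S21 := signed_integral_rep mp mh.2 weighted_Im (radon_Im rmu) nuE2 mf1 fC1.
have S22 := signed_integral_rep mp mh.2 weighted_Im (radon_Im rmu) nuE2 mf2 fC2.
have I11 := integrable_weighted mp mh.1 weighted_Re mf1 fC1.
have I12 := integrable_weighted mp mh.1 weighted_Re mf2 fC2.
have I21 := integrable_weighted mp mh.2 weighted_Im mf1 fC1.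
have I22 := integrable_weighted mp mh.2 weighted_Im mf2 fC2.
rewrite /radon_integral S11 S12 S21 S22; apply: complex_eqP => /=.
  by rewrite -RintegralB//; apply: eq_Rintegral => x _; rewrite cReM.
by rewrite -RintegralD//; apply: eq_Rintegral => x _; rewrite cImM.
Qed.

End ComplexRepresentation.

(** [mul_measure] integrates over [A]; moving [A] into the integrand brings it under the
    representations, which speak of integrals over the whole space. *)
Lemma radon_integral_restrict (R : realType) d (mu : set (spacetime R d) -> R[i])
    (A : set (spacetime R d)) (f : spacetime R d -> R[i]) :
  radon_integral mu A f = radon_integral mu setT (fun z => f z * (\1_A z)%:C).
Proof.
have S (nu : set (spacetime R d) -> R) (u : spacetime R d -> R) :
    signed_integral nu A u = signed_integral nu setT (fun z => u z * \1_A z).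
  have e : (fun z : borel (spacetime R d) => (u z)%:E) \_ A = fun z => (u z * \1_A z)%:E.
    apply/funext => z; rewrite patchE indicE; case: ifPn => _; by rewrite ?mulr1 ?mulr0.
  by rewrite /signed_integral /integral e patch_setT.
have e1 : cRe \o (fun z => f z * (\1_A z)%:C) = fun z => complex.Re (f z) * \1_A z.
  by apply/funext => z; rewrite /= cReM /= mulr0 subr0.
have e2 : cIm \o (fun z => f z * (\1_A z)%:C) = fun z => complex.Im (f z) * \1_A z.
  by apply/funext => z; rewrite /= cImM /= mulr0 add0r.
by rewrite /radon_integral e1 e2 !S.
Qed.

(** * Slow-growing measures *)

Section SigmaFiniteCopy.
Context d (T : measurableType d) (R : realType).
Context (K : {measure set T -> \bar R}) (sf : sigma_finite setT K).

(** An alias of [K] that takes the proof of sigma-finiteness as an argument, so that a structure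
    built from this proof can be attached to it. *)
Definition sigma_finite_copy of sigma_finite setT K : set T -> \bar R := K.

HB.instance Definition _ := isMeasure.Build d T R (sigma_finite_copy sf)
  (measure0 K) (measure_ge0 K) (@measure_semi_sigma_additive _ _ _ K).

HB.instance Definition _ := Measure_isSigmaFinite.Build d T R (sigma_finite_copy sf) sf.

Lemma exists_sigma_finite :
  exists m : {sigma_finite_measure set T -> \bar R}, (m : set T -> \bar R) = K.
Proof. by exists (sigma_finite_copy sf). Qed.

End SigmaFiniteCopy.

Section SumPushforward.
Context d1 d2 (X : measurableType d1) (Y : measurableType d2) (R : realType).
Context (n : nat) (P : nat -> {measure set X -> \bar R}) (j : nat -> X -> Y).
Context (mj : forall i, measurable_fun setT (j i)).

(** Used with four measures sent to four disjoint copies of one space. *)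
Definition sum_pushforward (A : set Y) : \bar R := (\sum_(i < n) P i (j i @^-1` A))%E.

Let pushforwards : exists M : nat -> {measure set Y -> \bar R},
  (forall i, (M i : set Y -> \bar R) = pushforward (P i) (j i)).
Proof.
have /choice[M hM] : forall i, exists M : {measure set Y -> \bar R},
    (M : set Y -> \bar R) = pushforward (P i) (j i); last by exists M.
move=> i; pose j' : {mfun X >-> Y} := HB.pack (j i) (isMeasurableFun.Build _ _ _ _ (j i) (mj i)).
by unshelve eexists (pushforward (P i) j') => //; exact: mj.
Qed.

Lemma exists_sum_pushforward : exists K : {measure set Y -> \bar R},
  (K : set Y -> \bar R) = sum_pushforward.
Proof.
have [M ME] := pushforwards; exists (msum M n); apply/funext => A.
by rewrite /msum /=; apply: eq_bigr => i _; rewrite ME.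
Qed.

Lemma Rintegral_sum_pushforward (K : {measure set Y -> \bar R}) (f : Y -> R) :
  (K : set Y -> \bar R) = sum_pushforward -> measurable_fun setT f ->
  (forall i : 'I_n, (P i).-integrable setT (EFin \o (fun x => f (j i x)))) ->
  K.-integrable setT (EFin \o f) /\
  \int[K]_y f y = \sum_(i < n) \int[P i]_x f (j i x).
Proof.
move=> KE; have [M ME] := pushforwards.
have KM : (K : set Y -> \bar R) = msum M n.
  by rewrite KE; apply/funext => A; rewrite /msum /=; apply: eq_bigr => i _; rewrite ME.
move: f.
have ge0 (f : Y -> \bar R) : (forall y, (0 <= f y)%E) -> measurable_fun setT f ->
    (\int[K]_y f y = \sum_(i < n) \int[P i]_x f (j i x))%E.
  move=> f0 mf; rewrite KM ge0_integral_measure_sum//; apply: eq_bigr => i _.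
  by rewrite ME (ge0_integral_pushforward (mj i))// preimage_setT.
have intn (f : Y -> R) : measurable_fun setT f ->
    (forall i : 'I_n, (P i).-integrable setT (EFin \o (fun x => f (j i x)))) ->
    K.-integrable setT (EFin \o f).
  move=> mf fi; apply/integrableP; split; first exact/measurable_EFinP.
  rewrite ge0//; last by apply: measurableT_comp => //; exact/measurable_EFinP.
  by apply: lte_sum_pinfty => i _; have /integrableP[] := fi i.
have ge0R (f : Y -> R) : measurable_fun setT f -> (forall y, 0 <= f y) ->
    (forall i : 'I_n, (P i).-integrable setT (EFin \o (fun x => f (j i x)))) ->
    \int[K]_y f y = \sum_(i < n) \int[P i]_x f (j i x).
  move=> mf f0 fi; rewrite /Rintegral ge0//; last exact/measurable_EFinP.
  by rewrite sum_fine// => i _; exact: (integrable_fin_num _ (fi i)).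
move=> f mf fi; split; first exact: intn.
pose fp z := Num.max (f z) 0; pose fn z := Num.max (- f z) 0.
have fE z : f z = fp z - fn z by exact: max0_subN.
have fp0 z : 0 <= fp z by rewrite le_max lexx orbT.
have fn0 z : 0 <= fn z by rewrite le_max lexx orbT.
have mfp : measurable_fun setT fp.
  by apply: measurable_maxr => //; exact: measurable_cst.
have mfn : measurable_fun setT fn.
  by apply: measurable_maxr; [exact: measurableT_comp|exact: measurable_cst].
have ifp (i : 'I_n) : (P i).-integrable setT (EFin \o (fun x => fp (j i x))).
  apply: (integrable_le _ (integrable_norm (fi i))) => [|x].
    exact: measurableT_comp mfp (mj i).
  by rewrite ger0_norm// ge_max ler_norm normr_ge0.
have ifn (i : 'I_n) : (P i).-integrable setT (EFin \o (fun x => fn (j i x))).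
  apply: (integrable_le _ (integrable_norm (fi i))) => [|x].
    exact: measurableT_comp mfn (mj i).
  by rewrite ger0_norm//= ge_max normr_ge0 -normrN ler_norm.
transitivity (\int[K]_y (fp y - fn y)).
  by apply: eq_Rintegral => y _; exact: fE.
rewrite RintegralB//; [|exact: intn|exact: intn].
rewrite !ge0R// -sumrB; apply: eq_bigr => i _.
by rewrite -RintegralB//; apply: eq_Rintegral => x _; rewrite fE.
Qed.

End SumPushforward.

Section NullSets.
Context (R : realType) (d : nat).
Local Notation E := (spacetime R d).

Lemma measurable_ratbox2 (q : 'rV[rat]_d * rat * rat) :
  measurable (ratbox2 q : set (borel E)).
Proof.
rewrite (_ : ratbox2 q = (\bigcap_(i in [set: 'I_d])
   ((fun z : borel E => z.1 0 i : R) @^-1` [set y | `|ratr (q.1.1 0 i) - y| < ratr q.1.2]))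
   `&` ((fun z : borel E => z.2 : R) @^-1` [set t : R | `|ratr q.2 - t| < ratr q.1.2])).
  apply: measurableI.
    apply: fin_bigcap_measurable => // i _; rewrite -[X in measurable X]setTI.
    by apply: measurable_fst_coord => //; apply: open_measurable; exact: open_dist_lt.
  rewrite -[X in measurable X]setTI.
  by apply: measurable_time => //; apply: open_measurable; exact: open_dist_lt.
by apply/seteqP; split=> [z [h1 h2]|z [h1 h2]]; split => // i; [move=> _; exact: h1|exact: h1].
Qed.

(** Every point of [A] lies in a rational box inside its null neighbourhood, and there are only
    countably many such boxes. *)
Lemma locally_null (P : {measure set (borel E) -> \bar R}) (A : set (borel E)) :
  measurable A -> (forall z, A z -> exists U : set E, [/\ open U, U z & P U = 0%E]) ->
  P A = 0%E.
Proof.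
move=> mA loc; apply/eqP; rewrite -measure_le0.
pose F k := if unpickle k is Some q then
  if pselect (P (ratbox2 q) = 0%E) then ratbox2 q else set0 else (set0 : set (borel E)).
have nF k : P.-negligible (F k).
  rewrite /F; case: unpickle => [q|]; last exact: negligible_set0.
  case: pselect => h; last exact: negligible_set0.
  by exists (ratbox2 q); split => //; exact: measurable_ratbox2.
have [B [mB PB sB]] := negligible_bigcup nF.
rewrite -[leRHS]PB; apply: le_measure; rewrite ?inE// => z Az; apply: sB.
have [U [oU Uz PU]] := loc z Az; have [q qz qU] := ratbox2_basis oU Uz.
exists (pickle q); first by [].
rewrite /F pickleK; case: pselect => [//|[]].
apply/eqP; rewrite -measure_le0 -PU; apply: le_measure; rewrite ?inE//.
  exact: measurable_ratbox2.
exact: sub_sigma_algebra.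
Qed.

End NullSets.

Lemma cint_null d (T : measurableType d) (R : realType)
    (m : {measure set T -> \bar R}) (f g : T -> R[i]) (N : set T) :
  measurable N -> m N = 0%E -> cmeasurable f -> cmeasurable g ->
  (forall x, ~ N x -> f x = g x) -> cint m f = cint m g.
Proof.
move=> mN N0 [f1 f2] [g1 g2] fg.
have S (u v : T -> R) : measurable_fun setT u -> measurable_fun setT v ->
    (forall x, ~ N x -> u x = v x) -> \int[m]_x u x = \int[m]_x v x.
  move=> mu mv uv; rewrite /Rintegral; congr fine; apply: ae_eq_integral => //.
  - exact/measurable_EFinP.
  - exact/measurable_EFinP.
  exists N; split => // x /= nx; apply: contrapT => nN; apply: nx => _.
  by rewrite uv.
by congr (_ +i* _); apply: S => // x /fg ->.
Qed.

Section SlowGrowingRepresentation.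
Context (R : realType) (d : nat).
Local Notation E := (spacetime R d).
Local Notation T := (borel E * bool * bool)%type.

Lemma cmeasurable_bool (f : bool -> R[i]) : cmeasurable f.
Proof. by split=> _ Y _. Qed.

(** Two booleans tell apart four disjoint copies of space-time. They carry the positive and negative
    parts of the real and imaginary parts of [mu]; on each copy the density [h] is one of the
    constants [1], [i], [-1], [-i]. *)
Lemma slow_growing_rep (mu : set E -> R[i]) : slow_growing mu ->
  exists (m : {sigma_finite_measure set T -> \bar R}) (h : T -> R[i]) (N : nat),
    [/\ weighted_density m (fun x : T => x.1.1) h N,
        forall (f : E -> R[i]) C, @cmeasurable _ (borel E) _ f ->
          (forall z, normc (f z) <= C * wgt N z) ->
          radon_integral mu setT f = cint m (fun x => h x * f x.1.1) &
        msupport mu `<=` [set z | 0 <= z.2] ->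
        m [set x : T | x.1.1.2 < 0] = 0%E].
Proof.
move=> [rmu [N fin]].
(* Numbering: [P 0] and [P 2] are the positive and negative parts of [Re mu], [P 1] and [P 3] those
   of [Im mu]. The parity selects the component, [1 < n] the sign. *)
pose nu n : set E -> R := (if (1 < n)%N then (fun A => - (if odd n then cIm (mu A) else cRe (mu A)))
  else (fun A => if odd n then cIm (mu A) else cRe (mu A))).
have rnu n : real_radon (nu n).
  have h : real_radon (fun A => if odd n then cIm (mu A) else cRe (mu A)).
    by case: (odd n); [exact: radon_Im|exact: radon_Re].
  by rewrite /nu; case: ifPn => // _; exact: real_radonN h.
have /choice[P PE] : forall n, exists P : {measure set (borel E) -> \bar R},
    forall A, P A = positive_part (nu n) A by move=> n; exact: positive_part_measure.
have nu_normc n A : nu n A <= normc (mu A).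
  rewrite /nu; case: ifP => _; case: ifP => _; apply: le_trans (ler_norm _) _;
  by rewrite ?normrN ?ler_norm_cRe ?ler_norm_cIm.
have mu0 : mu set0 = 0.
  by apply: complex_eqP; [exact: real_radon0 (radon_Re rmu)|exact: real_radon0 (radon_Im rmu)].
have var_ge0 A : (0 <= variation_measure mu A)%E.
  apply: ereal_sup_ubound; exists 0%N, (fun=> set0).
  split; [|by apply/trivIsetP => i j _ _ _; rewrite setI0|by rewrite big_ord0].
  by move=> i; split; [exact: bounded_borel0|exact: sub0set].
have var0 : variation_measure mu set0 = 0%E.
  apply/eqP; rewrite eq_le var_ge0 andbT; apply: ge_ereal_sup => _ [n [F [bF tF ->]]].
  rewrite big1// => i _; have [_] := bF i; rewrite subset0 => ->.
  by rewrite mu0 Normc.normc0.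
have Pvar n A : (P n A <= variation_measure mu A)%E.
  rewrite PE; apply: ge_ereal_sup => _ [B [bB BA] <-].
  apply: (@le_trans _ _ (normc (mu B))%:E); first by rewrite lee_fin.
  (* The one-term family [B], padded with empty sets, competes in the supremum that defines the
     variation. *)
  apply: ereal_sup_ubound; exists 1%N, (bigcup2 B set0); split.
  - move=> [|[|i]]; split => //; do ?exact: bounded_borel0; exact: sub0set.
  - by rewrite -trivIset_bigcup2 setI0.
  - by rewrite big_ord_recl big_ord0 addr0.
have iP n : (P n).-integrable setT (EFin \o (wgt N : borel E -> R)).
  apply/integrableP; split.
    by apply/measurable_EFinP; exact: measurable_wgt.
  under eq_integral do rewrite gee0_abs ?lee_fin ?wgt_ge0//.
  apply: le_lt_trans fin; apply: le_integral_setfun => //.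
  by move=> z; rewrite lee_fin wgt_ge0.
pose j n (x : borel E) : T := (x, odd n, (1 < n)%N).
have mj n : measurable_fun setT (j n).
  by apply: measurable_fun_pair; [apply: measurable_fun_pair|]; exact: measurable_cst || exact: measurable_id.
have [K0 K0E] := exists_sum_pushforward 4 P mj.
pose p := (fun x : T => x.1.1 : borel E).
have mp : measurable_fun setT p by exact: measurableT_comp.
have mw : measurable_fun setT (fun x => wgt N (p x)).
  exact: measurableT_comp (measurable_wgt N) mp.
have [iw0 _] := Rintegral_sum_pushforward mj K0E mw (fun i => iP i).
(* [wgt N] is positive everywhere and integrable over each of the four copies. *)
have sf : sigma_finite setT K0.
  by apply: sigma_finite_integrable iw0 => x; exact: wgt_gt0.
have [m mE] := exists_sigma_finite sf; rewrite K0E in mE.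
have Kint f := @Rintegral_sum_pushforward _ _ _ _ _ _ _ _ mj m f mE.
have [iw _] := Kint _ mw (fun i => iP i).
pose h (x : T) : R[i] := (if x.2 then -1 else 1) * (if x.1.2 then 'i%C else 1).
have mh : cmeasurable h.
  apply: cmeasurableM.
    exact: (cmeasurable_comp (p := snd) _ (cmeasurable_bool (fun b => if b then -1 else 1))).
  apply: (cmeasurable_comp (p := fun x : T => x.1.2) _ (cmeasurable_bool (fun b => if b then 'i%C else 1))).
  exact: measurableT_comp.
have h1 x : normc (h x) = 1.
  rewrite /h normcM; case: x.2; case: x.1.2; rewrite ?normcN ?Normc.normc1 ?mul1r//;
  by rewrite normcE /= expr0n expr1n add0r sqrtr1.
exists m, h, N; split.
- split => //; rewrite (_ : EFin \o _ = EFin \o (fun x => wgt N (p x)))//.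
  by apply/funext => x; rewrite /= h1 mul1r.
- move=> f C [mf1 mf2] fC.
  have if1 n : (P n).-integrable setT (EFin \o (cRe \o (f : borel E -> _))).
    apply: (@integrable_le _ (borel E) _ (P n) _ (fun z => C * wgt N z)) => //.
      by rewrite /comp; under eq_fun do rewrite EFinM; exact: integrableZl.
    by move=> z; exact: le_trans (ler_norm_cRe _) (fC z).
  have if2 n : (P n).-integrable setT (EFin \o (cIm \o (f : borel E -> _))).
    apply: (@integrable_le _ (borel E) _ (P n) _ (fun z => C * wgt N z)) => //.
      by rewrite /comp; under eq_fun do rewrite EFinM; exact: integrableZl.
    by move=> z; exact: le_trans (ler_norm_cIm _) (fC z).
  have mhf : cmeasurable (fun x => h x * f x.1.1).
    by apply: cmeasurableM => //; apply: (cmeasurable_comp mp).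
  have iN n (u : borel E -> R) : (P n).-integrable setT (EFin \o u) ->
     (P n).-integrable setT (EFin \o (fun x => - u x)).
    by move=> iu; rewrite /comp; under eq_fun do rewrite EFinN; exact: integrableN.
  have NE n (u : borel E -> R) : (P n).-integrable setT (EFin \o u) ->
     \int[P n]_x (- u x) = - \int[P n]_x u x.
    move=> iu; rewrite -mulN1r -RintegralZl//.
    by apply: eq_Rintegral => x _; rewrite mulN1r.
  have hfE (i : nat) (x : borel E) : h (j i x) * f (j i x).1.1 =
      (if (1 < i)%N then -1 else 1) * (if odd i then 'i%C else 1) * f x by [].
  have [] := Kint (fun x => cRe (h x * f x.1.1)) mhf.1.
    move=> [[|[|[|[|i]]]] //= lti].
    - by apply: eq_integrable (if1 0%N) => // x _; rewrite /= hfE !mul1r.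
    - by apply: eq_integrable (iN _ _ (if2 1%N)) => // x _; rewrite /= hfE mul1r cReM /= mul0r mul1r add0r.
    - by apply: eq_integrable (iN _ _ (if1 2%N)) => // x _; rewrite /= hfE mulr1 mulN1r cReN.
    - by apply: eq_integrable (if2 3%N) => // x _; rewrite /= hfE mulN1r mulNr cReN cReM /= mul0r mul1r add0r opprK.
  move=> _ IRe.
  have [] := Kint (fun x => cIm (h x * f x.1.1)) mhf.2.
    move=> [[|[|[|[|i]]]] //= lti].
    - by apply: eq_integrable (if2 0%N) => // x _; rewrite /= hfE !mul1r.
    - by apply: eq_integrable (if1 1%N) => // x _; rewrite /= hfE mul1r cImM /= mul0r mul1r add0r.
    - by apply: eq_integrable (iN _ _ (if2 2%N)) => // x _; rewrite /= hfE mulr1 mulN1r cImN.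
    - by apply: eq_integrable (iN _ _ (if1 3%N)) => // x _; rewrite /= hfE mulN1r mulNr cImN cImM /= mul0r mul1r add0r.
  move=> _ IIm.
  have PR n u : (\int[positive_part (nu n)]_(z in (setT : set (borel E))) (u z)%:E = \int[P n]_z (u z)%:E)%E.
    by congr (integral _ _ _); apply/funext => A; rewrite PE.
  have S0 u : signed_integral (cRe \o mu) setT u = \int[P 0%N]_z u z - \int[P 2%N]_z u z.
    by rewrite /signed_integral /Rintegral -(PR 0%N) -(PR 2%N).
  have S1 u : signed_integral (cIm \o mu) setT u = \int[P 1%N]_z u z - \int[P 3%N]_z u z.
    by rewrite /signed_integral /Rintegral -(PR 1%N) -(PR 3%N).
  have e i (q : R[i] -> R) : \int[P i]_x q (h (j i x) * f (j i x).1.1) =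
      \int[P i]_x q ((if (1 < i)%N then -1 else 1) * (if odd i then 'i%C else 1) * f x).
    by apply: eq_Rintegral => x _; rewrite hfE.
  have S4 (F : nat -> R) : \sum_(i < 4) F i = F 0%N + F 1%N + F 2%N + F 3%N.
    by rewrite !big_ord_recr big_ord0 /= add0r.
  rewrite /radon_integral !S0 !S1; apply: complex_eqP.
    transitivity (\int[m]_y cRe (h y * f y.1.1)); last by [].
    rewrite IRe (S4 (fun i => \int[P i]_x cRe (h (j i x) * f (j i x).1.1))) !e /=.
    have -> : (fun x => cRe (1 * 1 * f x)) = (fun x => cRe (f x)).
      by apply/funext => x; rewrite !mul1r.
    have -> : (fun x => cRe (1 * 'i%C * f x)) = (fun x => - cIm (f x)).
      by apply/funext => x; rewrite mul1r cReM /= mul0r mul1r add0r.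
    have -> : (fun x => cRe (-1 * 1 * f x)) = (fun x => - cRe (f x)).
      by apply/funext => x; rewrite mulr1 mulN1r cReN.
    have -> : (fun x => cRe (-1 * 'i%C * f x)) = (fun x => cIm (f x)).
      by apply/funext => x; rewrite mulN1r mulNr cReN cReM /= mul0r mul1r add0r opprK.
    by rewrite !NE//; ring.
  transitivity (\int[m]_y cIm (h y * f y.1.1)); last by [].
  rewrite IIm (S4 (fun i => \int[P i]_x cIm (h (j i x) * f (j i x).1.1))) !e /=.
  have -> : (fun x => cIm (1 * 1 * f x)) = (fun x => cIm (f x)).
    by apply/funext => x; rewrite !mul1r.
  have -> : (fun x => cIm (1 * 'i%C * f x)) = (fun x => cRe (f x)).
    by apply/funext => x; rewrite mul1r cImM /= mul0r mul1r add0r.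
  have -> : (fun x => cIm (-1 * 1 * f x)) = (fun x => - cIm (f x)).
    by apply/funext => x; rewrite mulr1 mulN1r cImN.
  have -> : (fun x => cIm (-1 * 'i%C * f x)) = (fun x => - cRe (f x)).
    by apply/funext => x; rewrite mulN1r mulNr cImN cImM /= mul0r mul1r add0r.
  by rewrite !NE//; ring.
move=> supp; rewrite mE /sum_pushforward big1// => i _.
(* A point with [t < 0] is outside the support, hence has a neighbourhood of variation zero, and the
   variation bounds each [P i]. *)
apply: locally_null.
  rewrite -[X in measurable X]setTI.
  rewrite (_ : _ @^-1` _ = (fun z : borel E => z.2 : R) @^-1` [set t | t < 0])//.
  by apply: measurable_time => //; apply: open_measurable; exact: open_lt.
move=> z /= z0; have : ~ msupport mu z by move=> /supp /=; rewrite leNgt z0.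
move=> /existsNP[U /not_implyP[oU /not_implyP[Uz /negP]]]; rewrite -leNgt => vU.
exists U; split => //; apply/eqP; rewrite eq_le measure_ge0 andbT.
exact: le_trans (Pvar i U) vU.
Qed.

(** Replacing the time [t] by [|t|] changes the map on a null set only and makes it take values in
    [t >= 0] everywhere rather than almost everywhere; the weight depends on [t^2] and stays the
    same. *)
Lemma slow_growing_pos_rep (mu : set E -> R[i]) : slow_growing_pos mu ->
  exists (m : {sigma_finite_measure set T -> \bar R}) (p : T -> borel E)
      (h : T -> R[i]) (N : nat),
    [/\ weighted_density m p h N, forall x, 0 <= (p x).2 &
        forall (f : E -> R[i]) C, @cmeasurable _ (borel E) _ f ->
          (forall z, normc (f z) <= C * wgt N z) ->
          radon_integral mu setT f = cint m (fun x => h x * f (p x))].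
Proof.
move=> [sg supp]; have [m [h [N [[mp mh ih] rep /(_ supp) null]]]] := slow_growing_rep sg.
have mp1 : measurable_fun setT (fun x : T => (x.1.1.1, `|x.1.1.2|) : borel E).
  apply: measurable_fun_spacetime => [i|] /=.
    exact: measurableT_comp (measurable_fst_coord i) mp.
  by apply: measurableT_comp => //; exact: measurableT_comp (@measurable_time _ _) mp.
exists m, (fun x => (x.1.1.1, `|x.1.1.2|)), h, N; split; [|by move=> x /=|].
  split => //; rewrite (_ : EFin \o _ = EFin \o (fun x : T => normc (h x) * wgt N x.1.1))//.
  apply/funext => x /=; congr (_ * _)%:E.
  by rewrite /wgt /sqnorm /= real_normK ?num_real.
move=> f C mf fC; rewrite (rep f C)//.
apply: (cint_null _ null).
- rewrite -[X in measurable X]setTI.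
  have /(_ measurableT [set t : R | t < 0]) := measurableT_comp (@measurable_time R d) mp.
  by apply; apply: open_measurable; exact: open_lt.
- by apply: cmeasurableM => //; exact: (cmeasurable_comp mp mf).
- by apply: cmeasurableM => //; exact: (cmeasurable_comp mp1 mf).
- move=> x /= /negP; rewrite -leNgt => x0; rewrite ger0_norm//.
  by case: x x0 => -[[]].
Qed.

End SlowGrowingRepresentation.

(** * Lebesgue measure on R^n *)

Section Affine1.
Context (R : realType).
Local Notation mu := (@lebesgue_measure R).

Lemma integralT_oneDsqrV : (\int[mu]_s ((1 + s ^+ 2)^-1)%:E = pi%:E)%E.
Proof.
have h : (\int[mu]_(x in [set x | (0 <= x)%R]) ((1 + x ^+ 2)^-1)%:E = (pi / 2)%:E)%E.
  rewrite -integral0y_oneDsqr; congr (integral _ _ _).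
  by apply/seteqP; split=> x /=; rewrite in_itv /= andbT.
rewrite ge0_symfun_integralT ?h.
- by rewrite -EFinM mulrC divfK.
- by move=> x; rewrite invr_ge0 addr_ge0 ?sqr_ge0.
- by move=> x; exact: continuous_oneDsqrV.
- by move=> x /=; rewrite sqrrN.
Qed.

Lemma ge0_integral_affine1 (c a : R) (f : R -> \bar R) : 0 < c ->
  (forall s, (0 <= f s)%E) -> measurable_fun setT f ->
  (\int[mu]_s f s = \int[mu]_s (f (c * s + a)%R * c%:E))%E.
Proof.
move=> c0 f0 mf.
have mphi : measurable_fun setT (fun s : R => c * s + a).
  by apply: measurable_funD => //; exact: measurable_funM.
have [K [KE Kint]] := @exists_density_pushforward _ _ _ (measurableTypeR R) _ mu (fun=> c) _
  (fun=> ltW c0) (measurable_cst _) mphi.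
transitivity (\int[K]_y f y)%E; last exact: Kint.
suff KmuE A : measurable A -> mu A = K A.
  by apply: eq_measure_integral => A mA _; exact: KmuE.
move: A; apply: lebesgue_measure_unique => _ [[u v] _ <-].
rewrite KE//= [X in X = _]lebesgue_measure_itv /=.
under eq_integral do rewrite EFinM.
rewrite ge0_integralZl//; last 2 first.
- apply/measurable_EFinP; apply: measurableT_comp mphi.
  exact: measurable_indic.
- by rewrite lee_fin ltW.
rewrite (_ : (fun x : R => _) = fun x => (\1_(`](u - a) / c, (v - a) / c]%classic) x)%:E); last first.
  apply/funext => x; rewrite !indicE; congr (_%:R)%:E.
  by rewrite !mem_setE !in_itv /= ltr_pdivrMr// ler_pdivlMr// (mulrC x) ltrBlDr lerBrDr.
rewrite integral_indic// setIT [X in (_ * X)%E]lebesgue_measure_itv /= !lte_fin.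
rewrite ltr_pM2r ?invr_gt0// ltrD2r; case: ifP => _; last by rewrite mule0.
by rewrite -EFinD -EFinM -mulrBl mulrCA divff ?gt_eqF// mulr1 opprB addrA subrK.
Qed.

End Affine1.

Section LebesgueSpace.
Context (R : realType).
Local Notation mu := (@lebesgue_measure R).

Definition consv n (s : R) (x : 'rV[R]_n) : 'rV[R]_n.+1 := row_mx (s%:M : 'rV_1) x.

Lemma consv0 n (s : R) (x : 'rV[R]_n) : consv s x 0 0 = s.
Proof. by rewrite /consv mxE; case: splitP => // j _; rewrite ord1 mxE eqxx mulr1n. Qed.

Lemma consvS n (s : R) (x : 'rV[R]_n) (i : 'I_n) : consv s x 0 (lift ord0 i) = x 0 i.
Proof.
rewrite /consv mxE; case: splitP => [[[|j]]//|j /=].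
by rewrite /bump /= !add1n => -[ij]; congr (x _ _); exact/val_inj.
Qed.

Lemma measurable_consv n : measurable_fun setT
  ((fun z => consv z.1 z.2) : measurableTypeR R * borel 'rV[R]_n -> borel 'rV[R]_n.+1).
Proof.
apply: measurable_fun_rV => i; case: (unliftP ord0 i) => [j ->|->].
  under eq_fun do rewrite consvS.
  exact: measurableT_comp (measurable_coord j) measurable_snd.
by under eq_fun do rewrite consv0; exact: measurable_fst.
Qed.

(** A positive weight in product form, so that Tonelli's theorem gives its integral [pi^n]. It
    yields sigma-finiteness of Lebesgue measure and is the integrable majorant for space slices of
    Schwartz functions. *)
Definition spw n (x : 'rV[R]_n) : R := \prod_(i < n) (1 + x 0 i ^+ 2)^-1.

Lemma spw_gt0 n (x : 'rV[R]_n) : 0 < spw x.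
Proof.
by apply: prodr_gt0 => i _; rewrite invr_gt0 ltr_pwDl ?sqr_ge0.
Qed.

Lemma measurable_spw n : measurable_fun setT (@spw n : borel 'rV[R]_n -> R).
Proof.
apply: measurable_prod => i _.
have mV : measurable_fun setT (fun r : R => (1 + r ^+ 2)^-1).
  by apply: continuous_measurable_fun => x; exact: continuous_oneDsqrV.
exact: measurableT_comp mV (measurable_coord i).
Qed.

Lemma spwS n s (x : 'rV[R]_n) : spw (consv s x) = (1 + s ^+ 2)^-1 * spw x.
Proof.
rewrite /spw big_ord_recl consv0; congr (_ * _).
by apply: eq_bigr => i _; rewrite consvS.
Qed.

(** The integral of [spw] is carried along the induction: its finiteness gives sigma-finiteness in
    dimension [n+1], which the next product measure requires. *)
Lemma lebesgue_rV_measure n :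
  exists m : {sigma_finite_measure set (borel 'rV[R]_n) -> \bar R},
    (m : set (borel 'rV[R]_n) -> \bar R) = @lebesgue_rV R n /\
    (\int[m]_x (spw x)%:E = (pi ^+ n)%:E)%E.
Proof.
elim: n => [|n [m [mE mint]]].
  exists (\d_ (0 : borel 'rV[R]_0)); split; first by [].
  rewrite integral_dirac//; first by rewrite diracT mul1e /spw big_ord0.
  by apply/measurable_EFinP; exact: measurable_spw.
pose phi : {mfun (measurableTypeR R * borel 'rV[R]_n)%type >-> borel 'rV[R]_n.+1} :=
  HB.pack ((fun z => consv z.1 z.2) : measurableTypeR R * borel 'rV[R]_n -> borel 'rV[R]_n.+1)
    (isMeasurableFun.Build _ _ _ _ _ (@measurable_consv n)).
have [K KE] : exists K : {measure set (borel 'rV[R]_n.+1) -> \bar R},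
    (K : set _ -> \bar R) = pushforward (mu \x m)%E
      ((fun z => consv z.1 z.2) : measurableTypeR R * borel 'rV[R]_n -> borel 'rV[R]_n.+1).
  by unshelve eexists (pushforward (mu \x m)%E phi) => //; exact: measurable_consv.
have Kint : (\int[K]_x (spw x)%:E = (pi ^+ n.+1)%:E)%E.
  rewrite KE (ge0_integral_pushforward (@measurable_consv n))//; last 2 first.
  - by apply/measurable_EFinP; exact: measurable_spw.
  - by move=> x _; rewrite lee_fin ltW// spw_gt0.
  rewrite preimage_setT fubini_tonelli1//; last 2 first.
  - apply: measurableT_comp (@measurable_consv n).
    by apply/measurable_EFinP; exact: measurable_spw.
  - by move=> x; rewrite lee_fin ltW// spw_gt0.
  transitivity (\int[mu]_s (((1 + s ^+ 2)^-1)%:E * (pi ^+ n)%:E))%E; last first.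
    rewrite ge0_integralZr//.
    - by rewrite integralT_oneDsqrV -EFinM exprS.
    - apply/measurable_EFinP; apply: continuous_measurable_fun => s.
      exact: continuous_oneDsqrV.
    - by move=> s _; rewrite lee_fin invr_ge0 addr_ge0 ?sqr_ge0.
    - by rewrite lee_fin exprn_ge0// pi_ge0.
  apply: eq_integral => s _; rewrite /fubini_F -mint -ge0_integralZl//.
  - by apply: eq_integral => x _; rewrite /= spwS EFinM.
  - by apply/measurable_EFinP; exact: measurable_spw.
  - by move=> x _; rewrite lee_fin ltW// spw_gt0.
  - by rewrite lee_fin invr_ge0 addr_ge0 ?sqr_ge0.
have Ki : K.-integrable setT (EFin \o (@spw n.+1 : borel _ -> R)).
  apply/integrableP; split; first by apply/measurable_EFinP; exact: measurable_spw.
  under eq_integral => x _ do rewrite gee0_abs ?lee_fin ?(ltW (spw_gt0 x))//.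
  by rewrite Kint ltry.
have [M ME] := exists_sigma_finite (@sigma_finite_integrable _ (borel 'rV[R]_n.+1) _ K (@spw n.+1) (@spw_gt0 n.+1) Ki).
exists M; split; last by rewrite ME.
rewrite ME KE; apply/funext => A; rewrite /pushforward /= /product_measure1.
apply: eq_integral => s _ /=; rewrite mE; congr lebesgue_rV.
by apply/seteqP; split=> x; rewrite /xsection /= inE.
Qed.

Definition leb n : {sigma_finite_measure set (borel 'rV[R]_n) -> \bar R} :=
  projT1 (cid (lebesgue_rV_measure n)).

Lemma lebE n : (leb n : set (borel 'rV[R]_n) -> \bar R) = @lebesgue_rV R n.
Proof. by rewrite /leb; case: cid => m []. Qed.

Lemma integral_spw n : (\int[leb n]_x (spw x)%:E = (pi ^+ n)%:E)%E.
Proof. by rewrite /leb; case: cid => m []. Qed.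

Lemma integrable_spw n : (leb n).-integrable setT (EFin \o (@spw n : borel _ -> R)).
Proof.
apply/integrableP; split; first by apply/measurable_EFinP; exact: measurable_spw.
under eq_integral => x _ do rewrite gee0_abs ?lee_fin ?(ltW (spw_gt0 x))//.
by rewrite integral_spw ltry.
Qed.

Lemma space_integralE n (f : 'rV[R]_n -> R[i]) :
  space_integral f = cint (leb n) (f : borel 'rV[R]_n -> R[i]).
Proof. by rewrite /space_integral -lebE. Qed.

Lemma ge0_integral_lebS n (f : borel 'rV[R]_n.+1 -> \bar R) :
  (forall x, (0 <= f x)%E) -> measurable_fun setT f ->
  (\int[leb n.+1]_x f x = \int[mu]_s \int[leb n]_x f (consv s x))%E.
Proof.
move=> f0 mf; transitivity (\int[(mu \x leb n)%E]_z f (consv z.1 z.2))%E; last first.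
  by rewrite fubini_tonelli1//; exact: measurableT_comp mf (@measurable_consv n).
transitivity (\int[pushforward (mu \x leb n)%E ((fun z => consv z.1 z.2) : measurableTypeR R * borel 'rV[R]_n -> borel 'rV[R]_n.+1)]_x f x)%E.
  congr (integral _ _ _); rewrite lebE; apply/funext => A.
  rewrite /pushforward /= /product_measure1.
  apply: eq_integral => s _ /=; rewrite lebE; congr lebesgue_rV.
  by apply/seteqP; split=> x; rewrite /xsection /= inE.
by rewrite (ge0_integral_pushforward (@measurable_consv n))// preimage_setT.
Qed.

(** Induction on the dimension: the one-dimensional substitution in the first coordinate, the
    induction hypothesis in the others. *)
Lemma ge0_integral_leb_affine n (c : R) (a : 'rV[R]_n) (f : borel 'rV[R]_n -> \bar R) :
  0 < c -> (forall x, (0 <= f x)%E) -> measurable_fun setT f ->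
  (\int[leb n]_x f x = \int[leb n]_x (f (c *: x + a)%R * (c ^+ n)%:E))%E.
Proof.
move=> c0; elim: n a f => [|n ih] a f f0 mf.
  by apply: eq_integral => x _; rewrite expr0 mule1; congr f; apply/rowP => -[].
have mS s : measurable_fun setT (fun x : borel 'rV[R]_n => f (consv s x)).
  exact: measurableT_comp mf (measurableT_comp (@measurable_consv n) (measurable_pair1 s)).
have maff : measurable_fun setT (fun x : borel 'rV[R]_n.+1 => (c *: x + a : borel 'rV[R]_n.+1)).
  apply: measurable_fun_rV => i; under eq_fun do rewrite !mxE.
  by apply: measurable_funD => //; apply: measurable_funM => //; exact: measurable_coord.
pose h (x : borel 'rV[R]_n.+1) := (f (c *: x + a)%R * (c ^+ n.+1)%:E)%E.
have h0 x : (0 <= h x)%E by rewrite mule_ge0// lee_fin exprn_ge0// ltW.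
have mh : measurable_fun setT h.
  by apply: emeasurable_funM => //; exact: measurableT_comp mf maff.
rewrite (ge0_integral_lebS f0 mf) [RHS](ge0_integral_lebS h0 mh) {h0 mh}/h.
pose a0 := a 0 0; pose a' : 'rV[R]_n := \row_i a 0 (lift ord0 i).
pose F s := (\int[leb n]_x f (consv s x))%E.
have F0 s : (0 <= F s)%E by apply: integral_ge0.
have mF : measurable_fun setT F.
  apply: (@measurable_fun_fubini_tonelli_F _ _ _ _ _ (leb n) (fun z : measurableTypeR R * borel 'rV[R]_n => f (consv z.1 z.2))) => //.
  exact: measurableT_comp mf (@measurable_consv n).
rewrite -/F (ge0_integral_affine1 a0 c0 F0 mF); apply: eq_integral => s _.
rewrite /F (ih a')//; last exact: mS.
rewrite -ge0_integralZr//; last 3 first.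
- apply: emeasurable_funM => //.
  have maff' : measurable_fun setT (fun x : borel 'rV[R]_n => (c *: x + a' : borel 'rV[R]_n)).
    apply: measurable_fun_rV => i; under eq_fun do rewrite !mxE.
    by apply: measurable_funD => //; apply: measurable_funM => //; exact: measurable_coord.
  exact: measurableT_comp (mS (c * s + a0)) maff'.
- by move=> x _; rewrite mule_ge0// lee_fin exprn_ge0// ltW.
- by rewrite lee_fin ltW.
apply: eq_integral => x _; rewrite -muleA -EFinM -exprSr; congr (f _ * _)%E.
apply/rowP => i; case: (unliftP ord0 i) => [j ->|->].
  by rewrite consvS [RHS]mxE [X in _ = X + _]mxE consvS !mxE.
by rewrite consv0 [RHS]mxE [X in _ = X + _]mxE consv0.
Qed.

End LebesgueSpace.

Section AffineIntegral.
Context (R : realType) (n : nat) (c : R) (a : 'rV[R]_n) (c0 : 0 < c).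

Lemma measurable_affine :
  measurable_fun setT (fun x : borel 'rV[R]_n => (c *: x + a : borel 'rV[R]_n)).
Proof.
apply: measurable_fun_rV => i; under eq_fun do rewrite !mxE.
by apply: measurable_funD => //; apply: measurable_funM => //; exact: measurable_coord.
Qed.

Lemma integrable_affine (f : borel 'rV[R]_n -> R) :
  (leb R n).-integrable setT (EFin \o f) ->
  (leb R n).-integrable setT (EFin \o (fun x => f (c *: x + a))).
Proof.
move=> fi; have mf : measurable_fun setT f by apply/measurable_EFinP; exact: measurable_int fi.
have mfa : measurable_fun setT (fun x : borel 'rV[R]_n => f (c *: x + a)).
  exact: measurableT_comp mf measurable_affine.
apply/integrableP; split; first exact/measurable_EFinP.
have /integrableP[_] := fi; rewrite (ge0_integral_leb_affine a c0)//; last first.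
  by apply: measurableT_comp => //; exact/measurable_EFinP.
rewrite ge0_integralZr//; last 2 first.
- by apply: measurableT_comp => //; exact/measurable_EFinP.
- by rewrite lee_fin exprn_ge0// ltW.
rewrite /=; case: (\int[_]_x _)%E (integral_ge0 (leb R n) (fun x (_ : setT x) => abse_ge0 (f (c *: x + a))%:E)) => [r _ _| |]//.
  by rewrite ltry.
by rewrite gt0_mulye// lte_fin exprn_gt0.
Qed.

Lemma Rintegral_affine (f : borel 'rV[R]_n -> R) :
  (leb R n).-integrable setT (EFin \o f) ->
  \int[leb R n]_x f x = c ^+ n * \int[leb R n]_x f (c *: x + a).
Proof.
move=> fi; have mf : measurable_fun setT f by apply/measurable_EFinP; exact: measurable_int fi.
have fai := integrable_affine fi.
have ge0 (g : borel 'rV[R]_n -> R) : (leb R n).-integrable setT (EFin \o g) ->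
    (forall x, 0 <= g x) ->
    \int[leb R n]_x g x = c ^+ n * \int[leb R n]_x g (c *: x + a).
  move=> gi g0; have mg : measurable_fun setT g by apply/measurable_EFinP; exact: measurable_int gi.
  rewrite -RintegralZl//; last exact: integrable_affine.
  rewrite /Rintegral (ge0_integral_leb_affine a c0 (f := EFin \o g))//.
  - by congr fine; apply: eq_integral => x _; rewrite /= -EFinM mulrC.
  - exact/measurable_EFinP.
pose fp z := Num.max (f z) 0; pose fn z := Num.max (- f z) 0.
have fE z : f z = fp z - fn z by exact: max0_subN.
have fp0 z : 0 <= fp z by rewrite le_max lexx orbT.
have fn0 z : 0 <= fn z by rewrite le_max lexx orbT.
have mfp : measurable_fun setT fp.
  by apply: measurable_maxr => //; exact: measurable_cst.
have mfn : measurable_fun setT fn.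
  by apply: measurable_maxr; [exact: measurableT_comp|exact: measurable_cst].
have ifp : (leb R n).-integrable setT (EFin \o fp).
  apply: (integrable_le _ (integrable_norm fi)) => // x.
  by rewrite ger0_norm//= ge_max ler_norm normr_ge0.
have ifn : (leb R n).-integrable setT (EFin \o fn).
  apply: (integrable_le _ (integrable_norm fi)) => // x.
  by rewrite ger0_norm//= ge_max normr_ge0 -normrN ler_norm.
transitivity (\int[leb R n]_x fp x - \int[leb R n]_x fn x).
  by rewrite -RintegralB//; apply: eq_Rintegral => x _; exact: fE.
rewrite (ge0 fp ifp fp0) (ge0 fn ifn fn0) -mulrBr; congr (_ * _).
have iap := integrable_affine ifp; have ian := integrable_affine ifn.
transitivity (\int[leb R n]_x (fp (c *: x + a) - fn (c *: x + a))).
  by rewrite RintegralB.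
by apply: eq_Rintegral => x _; rewrite [in RHS]fE.
Qed.

Lemma cintegrable_affine (f : borel 'rV[R]_n -> R[i]) : cintegrable (leb R n) f ->
  cintegrable (leb R n) (fun x => f (c *: x + a)).
Proof. by move=> [f1 f2]; split; [exact: (integrable_affine f1)|exact: (integrable_affine f2)]. Qed.

Lemma cint_affine (f : borel 'rV[R]_n -> R[i]) : cintegrable (leb R n) f ->
  cint (leb R n) f = (c ^+ n)%:C * cint (leb R n) (fun x => f (c *: x + a)).
Proof.
move=> [f1 f2]; apply: complex_eqP; rewrite ?cReM ?cImM /= ?mul0r ?subr0 ?addr0.
  exact: (Rintegral_affine f1).
exact: (Rintegral_affine f2).
Qed.

End AffineIntegral.

(** * Schwartz functions *)

Section CurveDerivative.
Context (R : realType).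

Definition cder (phi : R -> R[i]) (a : R) (c : R[i]) :=
  is_derive a (1 : R) (cRe \o phi) (complex.Re c) /\
  is_derive a (1 : R) (cIm \o phi) (complex.Im c).

Lemma is_derive_eqv (V : normedModType R) (f : V -> R) (x v : V) (a b : R) :
  is_derive x v f a -> a = b -> is_derive x v f b.
Proof. by move=> h <-. Qed.

Lemma cderD phi psi a c e : cder phi a c -> cder psi a e ->
  cder (fun h => phi h + psi h) a (c + e).
Proof.
move=> [p1 p2] [q1 q2]; split; rewrite ?cReD ?cImD.
  rewrite (_ : _ \o _ = (cRe \o phi) + (cRe \o psi)); first exact: is_deriveD.
  by apply/funext => h /=; rewrite cReD.
rewrite (_ : _ \o _ = (cIm \o phi) + (cIm \o psi)); first exact: is_deriveD.
by apply/funext => h /=; rewrite cImD.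
Qed.

Lemma cderM phi psi a c e : cder phi a c -> cder psi a e ->
  cder (fun h => phi h * psi h) a (c * psi a + phi a * e).
Proof.
move=> [p1 p2] [q1 q2]; split.
  rewrite (_ : _ \o _ = (cRe \o phi) * (cRe \o psi) - (cIm \o phi) * (cIm \o psi)).
    pose proof (is_deriveB (is_deriveM p1 q1) (is_deriveM p2 q2)) as h.
    by apply: (is_derive_eqv h); rewrite /= cReD !cReM /GRing.scale /=; ring.
  by apply/funext => h /=; rewrite cReM.
rewrite (_ : _ \o _ = (cRe \o phi) * (cIm \o psi) + (cIm \o phi) * (cRe \o psi)).
  pose proof (is_deriveD (is_deriveM p1 q2) (is_deriveM p2 q1)) as h.
  by apply: (is_derive_eqv h); rewrite /= cImD !cImM /GRing.scale /=; ring.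
by apply/funext => h /=; rewrite cImM.
Qed.

Lemma cder_cst (k : R[i]) a : cder (fun=> k) a 0.
Proof.
split; first exact: (is_derive_cst (complex.Re k) a (1 : R)).
exact: (is_derive_cst (complex.Im k) a (1 : R)).
Qed.

Lemma cderZ phi a c k : cder phi a c -> cder (fun h => k * phi h) a (k * c).
Proof.
move=> p; have := cderM (cder_cst k a) p; by rewrite mul0r add0r.
Qed.

Lemma cder_real (f : R -> R) a (c : R) : is_derive a (1 : R) f c ->
  cder (fun h => (f h)%:C) a c%:C.
Proof.
move=> fc; split; first by rewrite (_ : _ \o _ = f).
exact: (is_derive_cst (0 : R) a (1 : R)).
Qed.

Lemma is_derive_affine (k b a : R) : is_derive a (1 : R) (fun h : R => h * k + b) k.
Proof.
pose proof (is_deriveD (is_deriveM (is_derive_id a (1 : R)) (is_derive_cst (k : R) a (1 : R)))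
  (is_derive_cst (b : R) a (1 : R))) as h.
by apply: (is_derive_eqv h); rewrite /GRing.scale /= mulr0 add0r mulr1 addr0.
Qed.

Lemma is_derive_chain (f g : R -> R) (a c e : R) :
  is_derive (f a) (1 : R) g e -> is_derive a (1 : R) f c ->
  is_derive a (1 : R) (fun h => g (f h)) (e * c).
Proof. by move=> q p; pose proof (is_derive1_comp q p) as h; exact: h. Qed.

Lemma is_derive_translate (b a : R) : is_derive a (1 : R) (fun h : R => h + b) 1.
Proof. by have := is_derive_affine 1 b a; under eq_fun do rewrite mulr1. Qed.

Lemma is_derive_shift (f : R -> R) (a b e : R) :
  is_derive (a + b) (1 : R) f e -> is_derive a (1 : R) (fun h : R => f (h + b)) e.
Proof.
move=> fe; pose proof (@is_derive_chain (fun h => h + b) f a 1 e fe (is_derive_translate b a)) as h.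
by rewrite mulr1 in h.
Qed.

Lemma cder_expi (k b a : R) :
  cder (fun h => expi (h * k + b)) a (0 +i* k * expi (a * k + b)).
Proof.
have da := is_derive_affine k b a; split.
  apply: (is_derive_eqv (is_derive_chain (is_derive_cos _) da)).
  by rewrite cReM /=; ring.
apply: (is_derive_eqv (is_derive_chain (is_derive_sin _) da)).
by rewrite cImM /=; ring.
Qed.

Lemma cder_shift phi a b c : cder phi (a + b) c -> cder (fun h => phi (h + b)) a c.
Proof.
by move=> [p1 p2]; split; [exact: (is_derive_shift p1)|exact: (is_derive_shift p2)].
Qed.

End CurveDerivative.

Section SliceDerivative.
Context (R : realType) (V : normedModType R).

Lemma is_derive_slice (f : V -> R) (z v : V) (c : R) :
  is_derive (0 : R) (1 : R) (fun h : R => f (h *: v + z)) c <-> is_derive z v f c.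
Proof.
have e : (fun h : R => h^-1 *: (((fun h => f (h *: v + z)) \o shift 0) (h *: (1 : R)) -
     (fun h => f (h *: v + z)) 0)) = (fun h => h^-1 *: ((f \o shift z) (h *: v) - f z)).
  apply/funext => h /=; congr (_ *: (f _ - f _)).
    by rewrite addr0 /GRing.scale /= mulr1.
  by rewrite scale0r add0r.
split=> -[d1 d2]; split.
- by move: d1; rewrite /derivable e.
- by move: d2; rewrite /derive e.
- by rewrite /derivable e.
- by rewrite /derive e.
Qed.

End SliceDerivative.

Section SchwartzClass.
Context (R : realType) (d : nat).
Local Notation E := (spacetime R d).
Implicit Types (psi f g : E -> R[i]) (k : R[i]) (j : option 'I_d).

(** A relation rather than the total operator [pderiv], so that it carries differentiability along.
    It is phrased on the one-variable slice through [z], which reduces product and chain rules to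
    curves. *)
Definition pd j psi psi' := forall z,
  cder (fun h : R => psi (h *: direction R j + z)) 0 (psi' z).

Lemma pdP j psi psi' z : pd j psi psi' ->
  is_derive z (direction R j) (cRe \o psi) (complex.Re (psi' z)) /\
  is_derive z (direction R j) (cIm \o psi) (complex.Im (psi' z)).
Proof.
move=> /(_ z)[h1 h2]; split.
  exact: (iffLR (@is_derive_slice _ _ (cRe \o psi) z _ _)).
exact: (iffLR (@is_derive_slice _ _ (cIm \o psi) z _ _)).
Qed.

Lemma pd_pderiv j psi psi' : pd j psi psi' -> pderiv j psi = psi'.
Proof.
move=> p; apply/funext => z; have [h1 h2] := pdP z p.
by apply: complex_eqP => /=; [exact: (@derive_val _ _ _ _ _ _ _ h1)|exact: (@derive_val _ _ _ _ _ _ _ h2)].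
Qed.

(** [pd] speaks of the parameter 0 only; moving the base point along the line gives the derivative
    at every parameter. *)
Lemma pd_curve j psi psi' z a : pd j psi psi' ->
  cder (fun h : R => psi (h *: direction R j + z)) a (psi' (a *: direction R j + z)).
Proof.
move=> p; have := p (a *: direction R j + z).
rewrite -[X in cder _ X](subrr a) => /(cder_shift (b := - a)).
by congr cder; apply/funext => h; rewrite addrA -scalerDl subrK.
Qed.

Lemma pdD j f f' g g' : pd j f f' -> pd j g g' ->
  pd j (fun z => f z + g z) (fun z => f' z + g' z).
Proof. by move=> pf pg z; exact: cderD. Qed.

Lemma pdZ j f f' k : pd j f f' -> pd j (fun z => k * f z) (fun z => k * f' z).
Proof. by move=> pf z; exact: cderZ. Qed.

Lemma pdM j f f' g g' : pd j f f' -> pd j g g' ->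
  pd j (fun z => f z * g z) (fun z => f' z * g z + f z * g' z).
Proof.
move=> pf pg z; have := cderM (pf z) (pg z).
by rewrite scale0r add0r.
Qed.

Lemma direction_coord j i (h : R) (z : E) :
  (h *: direction R j + z).1 0 i = h * (j == Some i)%:R + z.1 0 i.
Proof.
case: j => [j|] /=; rewrite !mxE; last by rewrite mulr0.
by rewrite eqxx /= (inj_eq Some_inj) eq_sym.
Qed.

Lemma direction_time j (h : R) (z : E) :
  (h *: direction R j + z).2 = h * (j == None)%:R + z.2.
Proof. by case: j => [j|] /=; rewrite ?mulr0 ?mulr1 // /GRing.scale /= ?mulr0 ?mulr1. Qed.

Lemma pd_coord j i : pd j (fun z => (z.1 0 i)%:C) (fun=> ((j == Some i)%:R)%:C).
Proof.
move=> z; under [X in cder X]eq_fun do rewrite direction_coord.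
by apply: cder_real; exact: is_derive_affine.
Qed.

Lemma line_lipschitz j (f : E -> R) (f' : E -> R) (M : R) :
  (forall z, is_derive z (direction R j) f (f' z)) -> (forall z, `|f' z| <= M) ->
  forall h z, `|f (h *: direction R j + z) - f z| <= M * `|h|.
Proof.
move=> df fM h z; pose phi (s : R) := f (s *: direction R j + z).
have dphi s : is_derive s (1 : R) phi (f' (s *: direction R j + z)).
  have /is_derive_slice := df (s *: direction R j + z).
  rewrite -[X in is_derive X](subrr s) => dd.
  rewrite (_ : phi = (fun h => f ((h - s) *: direction R j + (s *: direction R j + z)))).
    exact: (is_derive_shift dd).
  by apply/funext => u; rewrite /phi /= addrA -scalerDl subrK.
have cphi : continuous phi.
  by move=> s; apply: differentiable_continuous; apply/derivable1_diffP; have [] := dphi s.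
have -> : f z = phi 0 by rewrite /phi scale0r add0r.
rewrite -/(phi h); have [h0|h0|->] := ltgtP h 0; last by rewrite subrr !normr0 mulr0.
  have [c _ e] := MVT h0 (fun s _ => dphi s) (continuous_subspaceT cphi).
  by rewrite distrC e normrM sub0r normrN ler_wpM2r.
have [c _ e] := MVT h0 (fun s _ => dphi s) (continuous_subspaceT cphi).
by rewrite e normrM subr0 ler_wpM2r.
Qed.

(** Only partial derivatives are available, hence a path from [z] to [w] parallel to the axes:
    [d + 1] segments, each no longer than the sup norm of [w - z]. *)
Lemma bounded_partials_lipschitz (f : E -> R) (f' : option 'I_d -> E -> R) (M : R) :
  (forall j z, is_derive z (direction R j) f (f' j z)) ->
  (forall j z, `|f' j z| <= M) ->
  forall z w, `|f w - f z| <= M * (1 + d%:R) * `|w - z|.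
Proof.
move=> df fM.
have M0 : 0 <= M by apply: le_trans (fM None 0).
have path (s : seq (R * option 'I_d)) z :
    `|f (\sum_(p <- s) p.1 *: direction R p.2 + z) - f z| <= M * \sum_(p <- s) `|p.1|.
  elim: s => [|p s ih]; first by rewrite !big_nil add0r subrr normr0 mulr0.
  rewrite !big_cons -addrA mulrDr.
  apply: le_trans (ler_distD (f (\sum_(p <- s) p.1 *: direction R p.2 + z)) _ _) _.
  by apply: lerD => //; apply: (line_lipschitz (df p.2)).
have decomp (u : E) : u = \sum_(p <- (u.2, None) :: [seq (u.1 0 i, Some i) | i <- enum 'I_d])
    p.1 *: direction R p.2.
  rewrite big_cons big_map big_enum /=; case: u => u t /=.
  rewrite [X in _ = _ + X](_ : _ = (u, 0)); last first.
    rewrite [in RHS](row_sum_delta u); elim/big_rec2: _ => [//|i x y _ ->].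
    by congr pair => /=; rewrite /GRing.scale /= mulr0 add0r.
  by congr pair => /=; rewrite ?scaler0 ?add0r// addr0 /GRing.scale /= mulr1.
move=> z w.
have := path ((((w - z).2, None) :: [seq ((w - z).1 0 i, Some i) | i <- enum 'I_d])) z.
rewrite -decomp subrK => /le_trans; apply; rewrite -mulrA ler_wpM2l//.
rewrite big_cons big_map big_enum /= mulrDl mul1r; apply: lerD.
  exact: (ler_time_norm (w - z)).
rewrite -[X in X%:R]card_ord -sumr_const mulr_suml; apply: ler_sum => i _.
by rewrite mul1r; exact: (ler_coord_norm (w - z)).
Qed.

Lemma continuous_bounded_partials (f : E -> R) (f' : option 'I_d -> E -> R) (M : R) :
  (forall j z, is_derive z (direction R j) f (f' j z)) ->
  (forall j z, `|f' j z| <= M) -> continuous f.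
Proof.
move=> df fM; have lip := bounded_partials_lipschitz df fM.
have M0 : 0 <= M by apply: le_trans (fM None 0).
move=> z; apply/(@cvgrPdist_lt _ _ _ _ (nbhs_filter z)) => e e0.
have C0 : 0 < M * (1 + d%:R) + 1 by rewrite ltr_wpDl ?mulr_ge0 ?addr_ge0.
have e1 : 0 < e / (M * (1 + d%:R) + 1) by rewrite divr_gt0.
apply: filterS (nbhsx_ballx z _ e1) => w; rewrite ball_prod_normE /ball_ /= => zw.
rewrite distrC; apply: le_lt_trans (lip z w) _.
apply: (@le_lt_trans _ _ ((M * (1 + d%:R) + 1) * `|w - z|)).
  by rewrite ler_wpM2r// lerDl.
by rewrite mulrC -ltr_pdivlMr// distrC.
Qed.

Definition decay psi := forall N, exists M, forall z,
  (1 + sqnorm z) ^+ N * normc (psi z) <= M.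

(** Continuity comes for free: the partial derivatives of a member are bounded because they are
    members again, and bounded partial derivatives make a function Lipschitz. The principle spares
    the computation of iterated derivatives: one exhibits a class closed under a single
    derivative. *)
Lemma schwartz_coinduction (Q : (E -> R[i]) -> Prop) :
  (forall psi, Q psi -> decay psi /\ forall j, exists2 psi', Q psi' & pd j psi psi') ->
  forall psi, Q psi -> schwartz psi.
Proof.
move=> QP psi Qpsi.
have Qm s : Q (mderiv s psi).
  elim: s => [//|j s ih] /=; have [_ /(_ j)[psi' Qpsi' p]] := QP _ ih.
  by rewrite (pd_pderiv p).
have bnd f : Q f -> exists M, forall z, normc (f z) <= M.
  by move=> /QP[/(_ 0%N)[M fM] _]; exists M => z; have := fM z; rewrite expr0 mul1r.
split; last by move=> s N; have [] := QP _ (Qm s).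
move=> s; have [_ /choice[f' f'P]] : decay (mderiv s psi) /\
    forall j, exists psi', Q psi' /\ pd j (mderiv s psi) psi'.
  by have [h1 h2] := QP _ (Qm s); split => // j; have [psi' q1 q2] := h2 j; exists psi'.
split; last first.
  move=> j z; have [[h1 _] [h2 _]] := pdP z (f'P j).2; by split.
have /choice[M fM] : forall j, exists M, forall z, normc (f' j z) <= M.
  by move=> j; apply: bnd; exact: (f'P j).1.
pose K := \sum_j `|M j|.
have MK j : M j <= K.
  rewrite /K (bigD1 j)//= (le_trans (ler_norm _))// lerDl.
  by apply: sumr_ge0.
move=> z; apply: cvg_complex.
  apply: (@continuous_bounded_partials _ (fun j z => complex.Re (f' j z)) K) => j y.
    exact: (pdP y (f'P j).2).1.
  exact: le_trans (ler_norm_cRe _) (le_trans (fM j y) (MK j)).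
apply: (@continuous_bounded_partials _ (fun j z => complex.Im (f' j z)) K) => j y.
  exact: (pdP y (f'P j).2).2.
exact: le_trans (ler_norm_cIm _) (le_trans (fM j y) (MK j)).
Qed.

Lemma schwartz_decay psi : schwartz psi -> decay psi.
Proof. by move=> [_ h] N; exact: (h [::] N). Qed.

Lemma schwartz_pd j psi : schwartz psi -> pd j psi (pderiv j psi).
Proof.
move=> [/(_ [::])[_ /(_ j) h] _] z; have [h1 h2] := h z.
split.
  exact: (iffRL (@is_derive_slice _ _ (cRe \o psi) z _ _) (DeriveDef h1 erefl)).
exact: (iffRL (@is_derive_slice _ _ (cIm \o psi) z _ _) (DeriveDef h2 erefl)).
Qed.

Lemma schwartz_pderiv j psi : schwartz psi -> schwartz (pderiv j psi).
Proof.
have e s : mderiv s (pderiv j psi) = mderiv (rcons s j) psi.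
  by rewrite /mderiv foldr_rcons.
by move=> [sm dec]; split=> [s|s N]; rewrite e; [exact: sm|exact: dec].
Qed.

Lemma schwartz_mderiv s psi : schwartz psi -> schwartz (mderiv s psi).
Proof. by move=> h; elim: s => [//|j s ih] /=; exact: schwartz_pderiv. Qed.

Lemma schwartz_continuous psi : schwartz psi -> continuous psi.
Proof. by move=> [/(_ [::])[]]. Qed.

(** A class for [schwartz_coinduction]. The derivative of [x_i f] is a multiple of [f] plus [x_i]
    times a derivative of [f], so that sums, multiples and products with coordinates have to be
    closed off together. *)
Inductive schwartz_span : (E -> R[i]) -> Prop :=
| span_base psi : schwartz psi -> schwartz_span psi
| span_add f g : schwartz_span f -> schwartz_span g -> schwartz_span (fun z => f z + g z)
| span_scale k f : schwartz_span f -> schwartz_span (fun z => k * f z)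
| span_coord i f : schwartz_span f -> schwartz_span (fun z => (z.1 0 i)%:C * f z).

Lemma ler_coord_sqnorm1 (z : E) i : `|z.1 0 i| <= 1 + sqnorm z.
Proof.
have := sqr_coord_le_sqnorm z i; rewrite -real_normK ?num_real// => h.
have := sqnorm_ge0 z; have := normr_ge0 (z.1 0 i); nra.
Qed.

Lemma schwartz_spanP psi : schwartz_span psi -> schwartz psi.
Proof.
move: psi; apply: schwartz_coinduction => psi; elim=> {psi}.
- move=> psi s; split; first exact: schwartz_decay.
  by move=> j; exists (pderiv j psi); [exact/span_base/schwartz_pderiv|exact: schwartz_pd].
- move=> f g _ [df pf] _ [dg pg]; split.
    move=> N; have [A fA] := df N; have [B gB] := dg N; exists (A + B) => z.
    apply: le_trans (lerD (fA z) (gB z)); rewrite -mulrDr ler_wpM2l//.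
      by rewrite exprn_ge0// ltW// sqnorm1_gt0.
    exact: normcD.
  move=> j; have [f' Qf pf'] := pf j; have [g' Qg pg'] := pg j.
  by exists (fun z => f' z + g' z); [exact: span_add|exact: pdD].
- move=> k f _ [df pf]; split.
    move=> N; have [A fA] := df N; exists (normc k * A) => z.
    by rewrite normcM mulrCA ler_wpM2l ?normc_ge0.
  move=> j; have [f' Qf pf'] := pf j.
  by exists (fun z => k * f' z); [exact: span_scale|exact: pdZ].
- move=> i f sf [df pf]; split.
    move=> N; have [A fA] := df N.+1; exists A => z.
    apply: le_trans (fA z); rewrite normcM normcR exprSr -mulrA ler_wpM2l//.
      by rewrite exprn_ge0// ltW// sqnorm1_gt0.
    by rewrite ler_wpM2r ?normc_ge0// ler_coord_sqnorm1.
  move=> j; have [f' Qf pf'] := pf j.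
  exists (fun z => ((j == Some i)%:R)%:C * f z + (z.1 0 i)%:C * f' z).
    by apply: span_add; [exact: span_scale|exact: span_coord].
  by apply: pdM => //; exact: pd_coord.
Qed.

Lemma schwartzD f g : schwartz f -> schwartz g -> schwartz (fun z => f z + g z).
Proof. by move=> /span_base sf /span_base sg; apply: schwartz_spanP; exact: span_add. Qed.

Lemma schwartzZ k f : schwartz f -> schwartz (fun z => k * f z).
Proof. by move=> /span_base sf; apply: schwartz_spanP; exact: span_scale. Qed.

Lemma schwartzB f g : schwartz f -> schwartz g -> schwartz (fun z => f z - g z).
Proof.
move=> sf sg; rewrite (_ : (fun z => _) = (fun z => f z + -1 * g z)).
  by apply: schwartzD => //; exact: schwartzZ.
by apply/funext => z; rewrite mulN1r.
Qed.

Lemma schwartz_coord i f : schwartz f -> schwartz (fun z => (z.1 0 i)%:C * f z).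
Proof. by move=> /span_base sf; apply: schwartz_spanP; exact: span_coord. Qed.

Lemma decay_wgt psi N : decay psi -> exists M, forall z, normc (psi z) <= M * wgt N z.
Proof.
move=> /(_ N)[M psiM]; exists M => z.
by rewrite /wgt ler_pdivlMr ?exprn_gt0 ?sqnorm1_gt0// mulrC.
Qed.

Lemma schwartz_measurable psi : schwartz psi -> @cmeasurable _ (borel E) _ psi.
Proof.
move=> /schwartz_continuous c; split; apply: continuous_measurable_spacetime => z.
  exact: cvg_cRe (c z).
exact: cvg_cIm (c z).
Qed.

End SchwartzClass.

(** * The spatial Fourier transform *)

Section DerivativeUnderIntegral.
Context d (T : measurableType d) (R : realType) (m : {measure set T -> \bar R}).

Lemma is_derive_Rintegral (f f' : R -> T -> R) (g : T -> R) :
  (forall h : R, h \in `]-1, 1[ -> m.-integrable setT (EFin \o f h)) ->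
  (forall (h : R) x, h \in `]-1, 1[ -> is_derive h (1 : R) (f ^~ x) (f' h x)) ->
  m.-integrable setT (EFin \o g) ->
  (forall (h : R) x, h \in `]-1, 1[ -> `|f' h x| <= g x) ->
  is_derive (0 : R) (1 : R) (fun h => \int[m]_x f h x) (\int[m]_x f' 0 x).
Proof.
move=> fi df gi f'g.
have I0 : `]-1, 1[%classic (0 : R) by rewrite /= in_itv /= oppr_lt0 ltr01.
have dE h x : h \in `]-1, 1[ -> partial1of2 f h x = f' h x.
  by move=> hI; rewrite /partial1of2 derive1E; apply: (@derive_val _ _ _ _ _ _ _ (df h x hI)).
have g0 x : 0 <= g x by apply: le_trans (f'g 0 x I0).
have H1 h x : `]-1, 1[%classic h -> [set: T] x -> derivable (f ^~ x) h 1.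
  by move=> hI _; have [] := df h x hI.
have H2 h x : `]-1, 1[%classic h -> [set: T] x -> `|partial1of2 f h x| <= g x.
  by move=> hI _; rewrite dE//; exact: f'g.
apply: DeriveDef.
  exact: (derivable_under_integral measurableT I0 (fun h hI => fi h hI) H1 g0 gi H2).
rewrite -derive1E (differentiation_under_integral measurableT I0 (fun h hI => fi h hI) H1 g0 gi H2).
by apply: eq_Rintegral => x _; exact: dE.
Qed.

Lemma cder_cint (G G' : R -> T -> R[i]) (g : T -> R) :
  (forall h, h \in `]-1, 1[ -> cintegrable m (G h)) ->
  (forall h x, h \in `]-1, 1[ -> cder (G ^~ x) h (G' h x)) ->
  m.-integrable setT (EFin \o g) ->
  (forall h x, h \in `]-1, 1[ -> normc (G' h x) <= g x) ->
  cder (fun h => cint m (G h)) 0 (cint m (G' 0)).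
Proof.
move=> iG dG gi Gg; split.
  apply: (@is_derive_Rintegral (fun h x => complex.Re (G h x)) (fun h x => complex.Re (G' h x)) g) => //.
  - by move=> h /iG[].
  - by move=> h x /(dG _ x)[].
  - by move=> h x /(Gg _ x); exact: le_trans (ler_norm_cRe _).
apply: (@is_derive_Rintegral (fun h x => complex.Im (G h x)) (fun h x => complex.Im (G' h x)) g) => //.
- by move=> h /iG[].
- by move=> h x /(dG _ x)[].
- by move=> h x /(Gg _ x); exact: le_trans (ler_norm_cIm _).
Qed.

End DerivativeUnderIntegral.

Lemma cder_unique (R : realType) (phi : R -> R[i]) a c e :
  cder phi a c -> cder phi a e -> c = e.
Proof.
move=> [p1 p2] [q1 q2]; apply: complex_eqP.
  by rewrite -(@derive_val _ _ _ _ _ _ _ p1) (@derive_val _ _ _ _ _ _ _ q1).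
by rewrite -(@derive_val _ _ _ _ _ _ _ p2) (@derive_val _ _ _ _ _ _ _ q2).
Qed.

Lemma normcX (R : realType) (z : R[i]) n : normc (z ^+ n) = normc z ^+ n.
Proof.
by elim: n => [|n ih]; rewrite ?expr0 ?Normc.normc1// !exprS normcM ih.
Qed.

Section FourierSchwartz.
Context (R : realType) (d : nat).
Local Notation E := (spacetime R d).
Local Notation L := (leb R d).
Implicit Types (psi f g : E -> R[i]) (k : R[i]) (xi x : 'rV[R]_d) (t : R).

Definition Cd : R[i] := ((2 * pi) `^ (- (d%:R / 2)))%:C.

Lemma fourier_spaceE psi z :
  fourier_space psi z = Cd * cint L (fun x => expi (- dotp z.1 x) * psi (x, z.2)).
Proof. by rewrite /fourier_space space_integralE. Qed.

Lemma measurable_slice t : measurable_fun setT (fun x : borel 'rV[R]_d => ((x, t) : borel E)).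
Proof.
apply: measurable_fun_spacetime => [i|] /=; first exact: measurable_coord.
exact: measurable_cst.
Qed.

Lemma measurable_dotp xi : measurable_fun setT (fun x : borel 'rV[R]_d => dotp xi x).
Proof.
by apply: measurable_sum => i; apply: measurable_funM => //; exact: measurable_coord.
Qed.

Lemma cmeasurable_kernel xi :
  @cmeasurable _ (borel 'rV[R]_d) _ (fun x => expi (- dotp xi x)).
Proof. by apply: cmeasurable_expi; apply: measurableT_comp => //; exact: measurable_dotp. Qed.

(** Each factor [1 + x_i^2] is at most [1 + |z|^2], so that [d] powers of the weight pay for
    integrability in space, and the other [N] are kept as decay in time. *)
Lemma wgt_le_spw N x t : wgt (N + d) (x, t) <= (1 + t ^+ 2) ^- N * spw x.
Proof.
rewrite /wgt exprD invfM; apply: ler_pM; rewrite ?invr_ge0 ?exprn_ge0 ?(ltW (sqnorm1_gt0 _))//.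
  have t0 : 0 < 1 + t ^+ 2 by rewrite ltr_pwDl ?sqr_ge0.
  rewrite lef_pV2 ?posrE ?exprn_gt0 ?sqnorm1_gt0//.
  apply: lerXn2r; rewrite ?nnegrE ?(ltW t0) ?(ltW (sqnorm1_gt0 _))//.
  by rewrite lerD2l; exact: (sqr_time_le_sqnorm (x, t)).
rewrite /spw prodfV lef_pV2 ?posrE ?exprn_gt0 ?sqnorm1_gt0//; last first.
  by apply: prodr_gt0 => i _; rewrite ltr_pwDl ?sqr_ge0.
rewrite -[X in _ ^+ X]card_ord -prodr_const; apply: ler_prod => i _.
by rewrite addr_ge0 ?sqr_ge0//= lerD2l; exact: (sqr_coord_le_sqnorm (x, t)).
Qed.

Lemma integrable_cspw (c : R) : L.-integrable setT (EFin \o (fun x => c * spw x)).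
Proof.
by rewrite /comp; under eq_fun do rewrite EFinM; apply: integrableZl => //; exact: integrable_spw.
Qed.

Lemma slice_bound psi N M : (forall z, normc (psi z) <= M * wgt (N + d) z) ->
  forall t x, normc (psi (x, t)) <= M * (1 + t ^+ 2) ^- N * spw x.
Proof.
move=> psiM t x; have M0 : 0 <= M.
  by have := le_trans (normc_ge0 _) (psiM 0); rewrite pmulr_lge0 ?wgt_gt0.
by apply: le_trans (psiM (x, t)) _; rewrite -mulrA ler_wpM2l ?wgt_le_spw.
Qed.

Lemma schwartz_slice_bound psi : schwartz psi ->
  exists M, forall x t, normc (psi (x, t)) <= M * spw x.
Proof.
move=> /schwartz_decay/(decay_wgt d)[M psiM]; exists M => x t.
by have := slice_bound (N := 0) psiM t x; rewrite expr0 invr1 mulr1.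
Qed.

Lemma cintegrable_fourier psi xi t : schwartz psi ->
  cintegrable L (fun x => expi (- dotp xi x) * psi (x, t)).
Proof.
move=> sp; have [M psiM] := schwartz_slice_bound sp.
apply: (cintegrable_le _ (integrable_cspw M)).
  apply: cmeasurableM; first exact: cmeasurable_kernel.
  exact: (cmeasurable_comp (measurable_slice t) (schwartz_measurable sp)).
by move=> x; rewrite normcM normc_expi mul1r.
Qed.

Lemma fourier_space_bound psi N M : schwartz psi ->
  (forall z, normc (psi z) <= M * wgt (N + d) z) ->
  forall z, normc (fourier_space psi z) <=
    normc Cd * (2 * pi ^+ d) * M * (1 + z.2 ^+ 2) ^- N.
Proof.
move=> sp psiM z; rewrite fourier_spaceE normcM -!mulrA ler_wpM2l ?normc_ge0//.
apply: (le_trans (normc_cint_le (cintegrable_fourier z.1 z.2 sp)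
  (integrable_cspw (M * (1 + z.2 ^+ 2) ^- N)) _)).
  by move=> x; rewrite normcM normc_expi mul1r; exact: slice_bound.
rewrite ler_wpM2l// RintegralZl//; last exact: integrable_spw.
by rewrite {1}/Rintegral integral_spw /= mulrC.
Qed.

Lemma fourier_spaceD f g : schwartz f -> schwartz g ->
  fourier_space (fun z => f z + g z) = (fun z => fourier_space f z + fourier_space g z).
Proof.
move=> sf sg; apply/funext => z; rewrite !fourier_spaceE -mulrDr; congr (_ * _).
rewrite -cintD; [|exact: cintegrable_fourier|exact: cintegrable_fourier].
by congr (cint _ _); apply/funext => x; rewrite mulrDr.
Qed.

Lemma fourier_spaceZ k f : schwartz f ->
  fourier_space (fun z => k * f z) = (fun z => k * fourier_space f z).
Proof.
move=> sf; apply/funext => z; rewrite !fourier_spaceE mulrCA; congr (_ * _).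
rewrite -cintZ; last exact: cintegrable_fourier.
by congr (cint _ _); apply/funext => x; rewrite mulrCA.
Qed.

Lemma direction_None (h : R) x t : h *: direction R (@None 'I_d) + (x, t) = (x, h + t).
Proof.
by congr pair => /=; rewrite ?scaler0 ?add0r// /GRing.scale /= mulr1.
Qed.

Lemma direction_Some (h : R) j x t :
  h *: direction R (Some j) + (x, t) = (h *: delta_mx 0 j + x, t).
Proof. by congr pair => /=; rewrite /GRing.scale /= mulr0 add0r. Qed.

Lemma pd_fourier_time psi : schwartz psi ->
  pd None (fourier_space psi) (fourier_space (pderiv None psi)).
Proof.
move=> sp [xi t].
rewrite fourier_spaceE; under [X in cder X]eq_fun do rewrite direction_None fourier_spaceE.
apply: cderZ => /=; have [M psiM] := schwartz_slice_bound (schwartz_pderiv None sp).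
pose G' h x := expi (- dotp xi x) * pderiv None psi (x, h + t).
rewrite (_ : (fun x => _ * pderiv None psi (x, t)) = G' 0); last first.
  by apply/funext => x; rewrite /G' add0r.
apply: (@cder_cint _ _ _ L (fun h x => expi (- dotp xi x) * psi (x, h + t)) G' _ _ _ (integrable_cspw M)).
- by move=> h _; exact: cintegrable_fourier.
- move=> h x _; apply: cderZ.
  have := pd_curve (x, t) h (schwartz_pd None sp).
  by rewrite direction_None; under [X in cder X]eq_fun do rewrite direction_None.
- by move=> h x _; rewrite normcM normc_expi mul1r.
Qed.

Lemma dotpC x y : dotp x y = dotp y x.
Proof. by apply: eq_bigr => i _; rewrite mulrC. Qed.

Lemma dotp_delta (h : R) j xi x : dotp (h *: delta_mx 0 j + xi) x = h * x 0 j + dotp xi x.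
Proof.
rewrite /dotp (eq_bigr (fun i => h * ((i == j)%:R * x 0 i) + xi 0 i * x 0 i)); last first.
  by move=> i _; rewrite !mxE eqxx /= mulrDl mulrA.
rewrite big_split /= -mulr_sumr; congr (h * _ + _).
rewrite (bigD1 j)//= eqxx mul1r big1 ?addr0// => i /negbTE ->.
by rewrite mul0r.
Qed.

Lemma pd_fourier_space j psi : schwartz psi ->
  pd (Some j) (fourier_space psi)
    (fourier_space (fun z => (0 +i* -1) * ((z.1 0 j)%:C * psi z))).
Proof.
move=> sp [xi t]; have sxp := schwartzZ (0 +i* -1) (schwartz_coord j sp).
rewrite fourier_spaceE; under [X in cder X]eq_fun do rewrite direction_Some fourier_spaceE.
apply: cderZ => /=; have [M psiM] := schwartz_slice_bound sxp.
pose G' h x := expi (- dotp (h *: delta_mx 0 j + xi) x) * ((0 +i* -1) * ((x 0 j)%:C * psi (x, t))).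
rewrite (_ : (fun x => _ * (_ * (_ * psi (x, t)))) = G' 0); last first.
  by apply/funext => x; rewrite /G' scale0r add0r.
apply: (@cder_cint _ _ _ L _ G' _ _ _ (integrable_cspw M)).
- by move=> h _; exact: cintegrable_fourier.
- move=> h x _; rewrite /G'.
  have := cderM (cder_expi (- x 0 j) (- dotp xi x) h) (cder_cst (psi (x, t)) h).
  rewrite mulr0 addr0.
  under [X in cder X]eq_fun do rewrite mulrN -opprD -dotp_delta.
  rewrite mulrN -opprD -dotp_delta; congr cder.
  rewrite (_ : 0 +i* - x 0 j = (0 +i* -1) * (x 0 j)%:C); first by ring.
  by apply: complex_eqP; rewrite ?cReM ?cImM /=; ring.
- by move=> h x _; rewrite normcM normc_expi mul1r; exact: psiM.
Qed.

(** A majorant uniform in [|h| < 1] for translates, as differentiation under the integral asks for.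
    The constant 3 comes from [x^2 <= 2 (x + h)^2 + 2 h^2]. *)
Lemma spw_translate (h : R) j x : h \in `]-1, 1[ -> spw (h *: delta_mx 0 j + x) <= 3 * spw x.
Proof.
rewrite in_itv /= => /andP[h1 h2]; rewrite /spw (bigD1 j)//= [in leRHS](bigD1 j)//= mulrA.
rewrite [X in _ * X <= _](_ : _ = \prod_(i < d | i != j) (1 + x 0 i ^+ 2)^-1); last first.
  by apply: eq_bigr => i ij; rewrite !mxE eqxx /= (negbTE ij) mulr0 add0r.
apply: ler_wpM2r.
  by apply: prodr_ge0 => i _; rewrite invr_ge0 addr_ge0 ?sqr_ge0.
rewrite !mxE !eqxx mulr1.
have a0 : 0 < 1 + (h + x 0 j) ^+ 2 by rewrite ltr_pwDl ?sqr_ge0.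
have b0 : 0 < 1 + x 0 j ^+ 2 by rewrite ltr_pwDl ?sqr_ge0.
rewrite ler_pdivlMr// mulrC ler_pdivrMr//.
have : h ^+ 2 <= 1 by nra.
have := sqr_ge0 (x 0 j + 2 * h); nra.
Qed.

(** By translation invariance the integral of [f(h e_j + x)] does not depend on [h]; its derivative
    at [h = 0], taken under the integral sign, is the integral of [f']. This replaces integration by
    parts. *)
Lemma cint_derivative0 (f f' : 'rV[R]_d -> R[i]) j (M : R) : cintegrable L f ->
  (forall x (h : R), cder (fun s => f (s *: delta_mx 0 j + x)) h (f' (h *: delta_mx 0 j + x))) ->
  (forall x, normc (f' x) <= M * spw x) -> cint L f' = 0.
Proof.
move=> fi df f'M.
have ti h : cintegrable L (fun x => f (h *: delta_mx 0 j + x)).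
  have := cintegrable_affine (h *: delta_mx 0 j) ltr01 fi.
  by congr cintegrable; apply/funext => x; rewrite scale1r addrC.
have c1 : cder (fun h : R => cint L (fun x => f (h *: delta_mx 0 j + x))) 0
    (cint L (fun x => f' ((0 : R) *: delta_mx 0 j + x))).
  apply: (@cder_cint _ _ _ L (fun h x => f (h *: delta_mx 0 j + x))
    (fun h x => f' (h *: delta_mx 0 j + x)) _ _ _ (integrable_cspw (M * 3))) => //.
  move=> h x hI; apply: le_trans (f'M _) _; rewrite -mulrA ler_wpM2l ?spw_translate//.
  by have := le_trans (normc_ge0 _) (f'M x); rewrite pmulr_lge0 ?spw_gt0.
have c2 : cder (fun h : R => cint L (fun x => f (h *: delta_mx 0 j + x))) 0 0.
  rewrite (_ : (fun h => _) = fun=> cint L f); first exact: cder_cst.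
  apply/funext => h; rewrite (cint_affine (h *: delta_mx 0 j) ltr01 fi) expr1n mul1r.
  by congr (cint _ _); apply/funext => x; rewrite scale1r addrC.
rewrite -(cder_unique c1 c2); congr (cint _ _); apply/funext => x.
by rewrite scale0r add0r.
Qed.

(** The derivative of [exp(- i xi.x) psi(x, t)] along [x_j] has integral zero; its two terms give
    the two sides. *)
Lemma fourier_space_pderiv j psi z : schwartz psi ->
  fourier_space (pderiv (Some j) psi) z = (0 +i* z.1 0 j) * fourier_space psi z.
Proof.
move=> sp; case: z => xi t; have sp' := schwartz_pderiv (Some j) sp.
have [M psiM] := schwartz_slice_bound sp; have [M' psiM'] := schwartz_slice_bound sp'.
pose f x := expi (- dotp xi x) * psi (x, t).
pose f' x := (0 +i* - xi 0 j) * (expi (- dotp xi x) * psi (x, t)) +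
  expi (- dotp xi x) * pderiv (Some j) psi (x, t).
have i1 := cintegrable_fourier xi t sp; have i2 := cintegrable_fourier xi t sp'.
have : cint L f' = 0.
  apply: (@cint_derivative0 f f' j (`|xi 0 j| * M + M')) => //.
  - move=> x h; rewrite /f' /f.
    have c1 := cder_expi (- xi 0 j) (- dotp xi x) h.
    have c2 := pd_curve (x, t) h (schwartz_pd (Some j) sp).
    have := cderM c1 c2; rewrite direction_Some.
    have dE (s : R) : s * - xi 0 j + - dotp xi x = - dotp xi (s *: delta_mx 0 j + x).
      by rewrite mulrN -opprD ![dotp xi _]dotpC dotp_delta.
    rewrite dE mulrA; congr cder; apply/funext => s.
    by rewrite direction_Some dE.
  - move=> x; rewrite /f' mulrDl; apply: le_trans (normcD _ _) _; apply: lerD.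
      rewrite !normcM normc_expi mul1r -mulrA; apply: ler_pM; rewrite ?normc_ge0//.
      by rewrite normcE /= expr0n add0r sqrrN sqrtr_sqr.
    by rewrite normcM normc_expi mul1r.
rewrite /f' cintD//; last exact: cintegrableZ.
rewrite cintZ// => /eqP; rewrite addr_eq0 => /eqP h.
rewrite !fourier_spaceE /= mulrCA; congr (_ * _).
rewrite -[LHS]opprK -h -mulNr; congr (_ * _).
by apply: complex_eqP; rewrite ?cReN ?cImN /= ?oppr0 ?opprK.
Qed.

Lemma fourier_space_iter_pderiv j n psi z : schwartz psi ->
  fourier_space (mderiv (nseq n (Some j)) psi) z = (0 +i* z.1 0 j) ^+ n * fourier_space psi z.
Proof.
move=> sp; elim: n => [|n ih] /=; first by rewrite mul1r.
rewrite fourier_space_pderiv; last exact: schwartz_mderiv.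
by rewrite ih exprS mulrA.
Qed.

(** Every term is at most the largest one; [i0] witnesses that a largest one exists. *)
Lemma sum_exp_le (I : finType) (i0 : I) (b : I -> R) N : (forall i, 0 <= b i) ->
  (\sum_i b i) ^+ N <= #|I|%:R ^+ N * \sum_i b i ^+ N.
Proof.
move=> b0; pose k := [arg max_(i > i0) b i]%O.
have bk i : b i <= b k by rewrite /k; case: arg_maxP => // j _; exact.
have : \sum_i b i <= #|I|%:R * b k.
  by rewrite mulr_natl -sumr_const; apply: ler_sum => i _.
move=> /(@lerXn2r _ N) => h; apply: (le_trans (h _ _)); rewrite ?nnegrE ?sumr_ge0 ?mulr_ge0//.
rewrite exprMn ler_wpM2l ?exprn_ge0// (bigD1 k)//= lerDl sumr_ge0// => i _.
by rewrite exprn_ge0.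
Qed.

(* The space weight is absorbed by space derivatives of the test function,
   the time weight by its decay in time. *)
Lemma fourier_space_seminorm N : exists (K : nat) (C : R), 0 <= C /\
  forall psi r, schwartz psi ->
    (forall s, (size s <= K)%N -> forall z,
       (1 + sqnorm z) ^+ K * normc (mderiv s psi z) <= r) ->
    forall z, (1 + sqnorm z) ^+ N * normc (fourier_space psi z) <= C * r.
Proof.
(* [N + N] space derivatives produce the factor [x_j^(2N)]; [N + d] powers of the weight give [N]
   powers of decay in time and integrability in space. [K] exceeds both numbers. *)
pose K := (N + d + (N + N))%N; pose B := normc Cd * (2 * pi ^+ d).
exists K, (d.+1%:R ^+ N * (d.+1%:R * B)).
have B0 : 0 <= B by rewrite mulr_ge0 ?normc_ge0// mulr_ge0// exprn_ge0// pi_ge0.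
split; first by rewrite mulr_ge0 ?exprn_ge0// mulr_ge0.
move=> psi r sp hr z.
have bnd s : (size s <= K)%N -> normc (fourier_space (mderiv s psi) z) <= B * r * (1 + z.2 ^+ 2) ^- N.
  move=> sK; apply: fourier_space_bound; first exact: schwartz_mderiv.
  move=> y; rewrite /wgt ler_pdivlMr ?exprn_gt0 ?sqnorm1_gt0// mulrC.
  apply: le_trans (hr s sK y); rewrite ler_wpM2r ?normc_ge0//.
  by rewrite ler_weXn2l ?sqnorm1_ge1// leq_addr.
(* The terms [1, x_1^2, ..., x_d^2] of [1 + |x|^2]; the power [N] of their sum is estimated term by
   term. *)
pose b (i : 'I_d.+1) := if unlift ord0 i is Some i then z.1 0 i ^+ 2 else 1.
have b0 i : 0 <= b i by rewrite /b; case: unliftP => [j|] _ //; exact: sqr_ge0.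
have sumb : 1 + sqnorm_space z.1 = \sum_i b i.
  rewrite big_ord_recl {1}/b unlift_none; congr (_ + _); apply: eq_bigr => i _.
  by rewrite /b liftK.
have t0 : 0 < 1 + z.2 ^+ 2 by rewrite ltr_pwDl ?sqr_ge0.
have sqle : 1 + sqnorm z <= (1 + z.2 ^+ 2) * (1 + sqnorm_space z.1).
  rewrite /sqnorm; have := sqnorm_space_ge0 z.1; have := sqr_ge0 z.2; nra.
apply: (@le_trans _ _ (((1 + z.2 ^+ 2) * (1 + sqnorm_space z.1)) ^+ N * normc (fourier_space psi z))).
  rewrite ler_wpM2r ?normc_ge0//; apply: lerXn2r => //; rewrite nnegrE.
    exact/ltW/sqnorm1_gt0.
  by rewrite mulr_ge0 ?(ltW t0)// addr_ge0// sqnorm_space_ge0.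
have bF i : b i ^+ N * normc (fourier_space psi z) <= B * r * (1 + z.2 ^+ 2) ^- N.
  rewrite /b; case: unliftP => [j|] _; last by rewrite expr1n mul1r; exact: (bnd [::]).
  have -> : (z.1 0 j ^+ 2) ^+ N * normc (fourier_space psi z) =
      normc (fourier_space (mderiv (nseq (N + N) (Some j)) psi) z).
    rewrite fourier_space_iter_pderiv// normcM normcX; congr (_ * _).
    rewrite normcE /= expr0n add0r sqrtr_sqr addnn -mul2n exprM real_normK ?num_real//.
  by apply: bnd; rewrite size_nseq leq_addl.
rewrite exprMn -mulrA -ler_pdivlMl ?exprn_gt0//.
apply: (@le_trans _ _ (d.+1%:R ^+ N * (\sum_i b i ^+ N) * normc (fourier_space psi z))).
  by rewrite ler_wpM2r ?normc_ge0// sumb; have := sum_exp_le ord0 N b0; rewrite card_ord.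
rewrite -mulrA mulr_suml.
have : \sum_i b i ^+ N * normc (fourier_space psi z) <= d.+1%:R * (B * r * (1 + z.2 ^+ 2) ^- N).
  apply: (@le_trans _ _ (\sum_(i < d.+1) (B * r * (1 + z.2 ^+ 2) ^- N))); first exact: ler_sum.
  by rewrite sumr_const card_ord mulr_natl.
move=> /(ler_wpM2l (exprn_ge0 N (ler0n R d.+1)))/le_trans; apply.
by rewrite le_eqVlt; apply/orP; left; apply/eqP; rewrite !mulrA; ring.
Qed.

Lemma schwartz_seminorm_bound psi N K : schwartz psi ->
  exists M, forall s, (size s <= K)%N -> forall z,
    (1 + sqnorm z) ^+ N * normc (mderiv s psi z) <= M.
Proof.
elim: K psi => [|K ih] psi sp; have [M hM] := schwartz_decay sp N.
  by exists M => s; rewrite leqn0 size_eq0 => /eqP ->.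
have /choice[f fP] := fun j => ih _ (schwartz_pderiv j sp).
exists (`|M| + \sum_j `|f j|) => s; elim/last_ind: s => [_|s j _] z.
  by rewrite (le_trans (hM z))// (le_trans (ler_norm _))// lerDl sumr_ge0.
move: z; rewrite size_rcons ltnS /mderiv foldr_rcons => sK z.
rewrite (le_trans (fP j s sK z))// (le_trans (ler_norm _))// (bigD1 j)//= addrCA lerDl.
by rewrite addr_ge0// sumr_ge0.
Qed.

(** The image of the transform is closed under derivatives: a derivative in [xi_j] is the transform
    of [- i x_j psi], one in time the transform of a time derivative. Decay is the seminorm
    estimate. *)
Lemma fourier_schwartz psi : schwartz psi -> schwartz (fourier_space psi).
Proof.
move=> sp; apply: (@schwartz_coinduction _ _
  (fun f => exists2 psi, schwartz psi & f = fourier_space psi)); last by exists psi.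
move=> _ {sp}[{}psi sp ->]; split.
  move=> N; have [K [C [C0 h]]] := fourier_space_seminorm N.
  have [M hM] : exists M, forall s, (size s <= K)%N -> forall z,
      (1 + sqnorm z) ^+ K * normc (mderiv s psi z) <= M.
    exact: schwartz_seminorm_bound.
  by exists (C * M) => z; exact: h.
case=> [j|].
  exists (fourier_space (fun z => (0 +i* -1) * ((z.1 0 j)%:C * psi z))); last exact: pd_fourier_space.
  by eexists; last reflexivity; exact/schwartzZ/schwartz_coord.
exists (fourier_space (pderiv None psi)); last exact: pd_fourier_time.
by eexists; last reflexivity; exact: schwartz_pderiv.
Qed.

End FourierSchwartz.

(** * Gaussian-type test functions *)

Section PolynomialExponential.
Context (R : realType) (d : nat).
Local Notation E := (spacetime R d).
Implicit Types (f g : E -> R[i]).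

(** Polynomials as a class of functions, so that polynomial growth and stability under derivatives
    are inductions on the construction. *)
Inductive cpoly : (E -> R[i]) -> Prop :=
| cpoly_cst k : cpoly (fun=> k)
| cpoly_coord i : cpoly (fun z => (z.1 0 i)%:C)
| cpoly_time : cpoly (fun z => (z.2)%:C)
| cpoly_add f g : cpoly f -> cpoly g -> cpoly (fun z => f z + g z)
| cpoly_mul f g : cpoly f -> cpoly g -> cpoly (fun z => f z * g z).

Lemma pd_time j : pd j (fun z : E => (z.2)%:C) (fun=> ((j == None)%:R)%:C).
Proof.
move=> z; under [X in cder X]eq_fun do rewrite direction_time.
by apply: cder_real; exact: is_derive_affine.
Qed.

Lemma ler_time_sqnorm1 (z : E) : `|z.2| <= 1 + sqnorm z.
Proof.
have := sqr_time_le_sqnorm z; rewrite -real_normK ?num_real// => h.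
have := sqnorm_ge0 z; have := normr_ge0 z.2; nra.
Qed.

Lemma cpoly_growth f : cpoly f ->
  exists (C : R) N, 0 <= C /\ forall z, normc (f z) <= C * (1 + sqnorm z) ^+ N.
Proof.
elim=> {f}.
- move=> k; exists (normc k), 0%N; split; first exact: normc_ge0.
  by move=> z; rewrite expr0 mulr1.
- move=> i; exists 1, 1%N; split => // z.
  by rewrite normcR mul1r expr1 ler_coord_sqnorm1.
- exists 1, 1%N; split => // z.
  by rewrite normcR mul1r expr1 ler_time_sqnorm1.
- move=> f g _ [A [N [A0 fA]]] _ [B [M [B0 gB]]]; exists (A + B), (N + M)%N.
  split; first exact: addr_ge0.
  move=> z; apply: le_trans (normcD _ _) _; rewrite mulrDl; apply: lerD.
    by apply: le_trans (fA z) _; rewrite ler_wpM2l// ler_weXn2l ?sqnorm1_ge1// leq_addr.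
  by apply: le_trans (gB z) _; rewrite ler_wpM2l// ler_weXn2l ?sqnorm1_ge1// leq_addl.
- move=> f g _ [A [N [A0 fA]]] _ [B [M [B0 gB]]]; exists (A * B), (N + M)%N.
  split; first exact: mulr_ge0.
  move=> z; rewrite normcM exprD mulrACA; apply: ler_pM; rewrite ?normc_ge0//.
Qed.

Lemma cpoly_pd j f : cpoly f -> exists2 f', cpoly f' & pd j f f'.
Proof.
elim=> {f}.
- by move=> k; exists (fun=> 0); [exact: cpoly_cst|move=> z; exact: cder_cst].
- by move=> i; exists (fun=> ((j == Some i)%:R)%:C); [exact: cpoly_cst|exact: pd_coord].
- by exists (fun=> ((j == None)%:R)%:C); [exact: cpoly_cst|exact: pd_time].
- move=> f g _ [f' pf df] _ [g' pg dg]; exists (fun z => f' z + g' z).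
    exact: cpoly_add.
  exact: pdD.
- move=> f g cf [f' pf df] cg [g' pg dg]; exists (fun z => f' z * g z + f z * g' z).
    by apply: cpoly_add; exact: cpoly_mul.
  exact: pdM.
Qed.

Lemma cpoly_sum (I : Type) (s : seq I) (F : I -> E -> R[i]) :
  (forall i, cpoly (F i)) -> cpoly (fun z => \sum_(i <- s) F i z).
Proof.
move=> cF; elim: s => [|i s ih].
  by under eq_fun do rewrite big_nil; exact: cpoly_cst.
by under eq_fun do rewrite big_cons; exact: cpoly_add.
Qed.

Lemma cpolyX f n : cpoly f -> cpoly (fun z => f z ^+ n).
Proof.
move=> cf; elim: n => [|n ih].
  by under eq_fun do rewrite expr0; exact: cpoly_cst.
by under eq_fun do rewrite exprS; exact: cpoly_mul.
Qed.

Definition rpoly (Q : E -> R) := cpoly (fun z => (Q z)%:C).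

Lemma rpoly_cst a : rpoly (fun=> a). Proof. exact: cpoly_cst. Qed.

Lemma rpoly_coord i : rpoly (fun z => z.1 0 i). Proof. exact: cpoly_coord. Qed.

Lemma rpoly_time : rpoly (fun z => z.2). Proof. exact: cpoly_time. Qed.

Lemma rpolyD Q Q' : rpoly Q -> rpoly Q' -> rpoly (fun z => Q z + Q' z).
Proof.
by move=> h h'; rewrite /rpoly; under eq_fun do rewrite rmorphD; exact: cpoly_add.
Qed.

Lemma rpolyM Q Q' : rpoly Q -> rpoly Q' -> rpoly (fun z => Q z * Q' z).
Proof.
by move=> h h'; rewrite /rpoly; under eq_fun do rewrite rmorphM; exact: cpoly_mul.
Qed.

Lemma rpolyX Q n : rpoly Q -> rpoly (fun z => Q z ^+ n).
Proof.
by move=> h; rewrite /rpoly; under eq_fun do rewrite rmorphXn; exact: cpolyX.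
Qed.

Lemma rpoly_sum (I : Type) (s : seq I) (F : I -> E -> R) :
  (forall i, rpoly (F i)) -> rpoly (fun z => \sum_(i <- s) F i z).
Proof.
by move=> h; rewrite /rpoly; under eq_fun do rewrite rmorph_sum; exact: cpoly_sum.
Qed.

Lemma rpoly_sqnorm : rpoly (@sqnorm R d).
Proof.
rewrite /sqnorm /sqnorm_space; apply: rpolyD; last by apply: rpolyX; exact: rpoly_time.
by apply: rpoly_sum => i; apply: rpolyX; exact: rpoly_coord.
Qed.

Lemma pd_exp j (Q : E -> R) Q' : pd j (fun z => (Q z)%:C) Q' ->
  pd j (fun z => (expR (- Q z))%:C) (fun z => - Q' z * (expR (- Q z))%:C).
Proof.
move=> pQ z; have [h1 h2] := pQ z.
have Q'0 : complex.Im (Q' z) = 0.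
  rewrite -(@derive_val _ _ _ _ _ _ _ h2).
  by rewrite (_ : _ \o _ = cst 0)// derive_cst.
have hN := is_deriveN h1.
pose proof (is_derive_chain (is_derive_expR _) hN) as h.
have := cder_real h; congr cder; last first.
  apply: complex_eqP; rewrite ?cReM ?cImM ?cReN ?cImN /= Q'0 ?oppr0 ?mul0r ?mulr0 ?subr0 ?addr0.
    change (expR (- Q (0 *: direction R j + z)) * - complex.Re (Q' z) = - complex.Re (Q' z) * expR (- Q z)).
    by rewrite scale0r add0r mulrC.
  by [].
Qed.

Lemma exp_le_invX (c : R) n : 0 < c -> exists M : R, forall x, 0 <= x -> x ^+ n * expR (- (c * x)) <= M.
Proof.
(* The summand 1 serves [x <= 1]; for [x > 1] one passes from [x^n] to [x^(n+1)], which is bounded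
   by a term of the exponential series. *)
move=> c0; exists ((n.+1)`!%:R / c ^+ n.+1 + 1) => x x0.
have h := expR_ge1Dxn n (mulr_ge0 (ltW c0) x0).
have f0 : 0 < (n.+1)`!%:R :> R by rewrite ltr0n fact_gt0.
have c1 : 0 < c ^+ n.+1 by rewrite exprn_gt0.
rewrite expRN ler_pdivrMr ?expR_gt0//.
have [x1|x1] := leP x 1.
  apply: (@le_trans _ _ 1); first by rewrite exprn_ile1.
  rewrite -[leLHS]mulr1; apply: ler_pM => //.
    by rewrite lerDr divr_ge0// ltW.
  by rewrite -expR0 ler_expR mulr_ge0// ltW.
apply: (@le_trans _ _ (x ^+ n.+1)); first by rewrite exprS ler_peMl ?exprn_ge0// ltW.
apply: (@le_trans _ _ ((n.+1)`!%:R / c ^+ n.+1 * expR (c * x))); last first.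
  by rewrite ler_wpM2r ?expR_ge0// lerDl.
rewrite mulrAC ler_pdivlMr// mulrC -exprMn -ler_pdivrMl// mulrC.
by apply: le_trans h; rewrite lerDr.
Qed.

(** Polynomial multiples of [exp(- Q)] are closed under derivatives, the new factor being
    [f' - f Q']; coercivity of [Q] gives their decay. *)
Lemma schwartz_poly_exp f Q (c C : R) : cpoly f -> rpoly Q -> 0 < c ->
  (forall z, c * sqnorm z - C <= Q z) ->
  schwartz (fun z => f z * (expR (- Q z))%:C).
Proof.
move=> cf rQ c0 Qge; apply: (@schwartz_coinduction _ _
  (fun psi => exists2 f, cpoly f & psi = fun z => f z * (expR (- Q z))%:C)); last by exists f.
move=> _ {cf}[{}f cf ->]; split.
  move=> N; have [K [M [K0 fK]]] := cpoly_growth cf.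
  have [B hB] := exp_le_invX (N + M) c0.
  exists (K * (B * expR (c + C))) => z.
  rewrite normcM normcR ger0_norm ?expR_ge0//.
  have s0 := ltW (sqnorm1_gt0 z).
  apply: (@le_trans _ _ ((1 + sqnorm z) ^+ N * (K * (1 + sqnorm z) ^+ M * (expR (- (c * (1 + sqnorm z))) * expR (c + C))))).
    rewrite ler_wpM2l ?exprn_ge0//; apply: ler_pM; rewrite ?normc_ge0 ?expR_ge0//.
    by rewrite -expRD ler_expR; have := Qge z; lra.
  have := ler_wpM2l K0 (ler_wpM2r (expR_ge0 (c + C)) (hB _ s0)).
  by apply: le_trans; rewrite exprD le_eqVlt; apply/orP; left; apply/eqP; ring.
move=> j; have [f' cf' pf] := cpoly_pd j cf; have [Q' cQ' pQ] := cpoly_pd j rQ.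
exists (fun z => f' z * (expR (- Q z))%:C + f z * (- Q' z * (expR (- Q z))%:C)).
  exists (fun z => f' z + (-1 * f z) * Q' z).
    by apply: cpoly_add => //; apply: cpoly_mul => //; apply: cpoly_mul => //; exact: cpoly_cst.
  by apply/funext => z; ring.
by apply: pdM => //; exact: pd_exp.
Qed.

Lemma schwartz_exp Q (c C : R) : rpoly Q -> 0 < c ->
  (forall z, c * sqnorm z - C <= Q z) -> schwartz (fun z => (expR (- Q z))%:C).
Proof.
move=> rQ c0 Qge; have := schwartz_poly_exp (cpoly_cst 1) rQ c0 Qge.
by congr schwartz; apply/funext => z; rewrite mul1r.
Qed.

End PolynomialExponential.

(** * Fourier inversion *)

Lemma cvg_complex_unique (R : realType) (u : nat -> R[i]) (a b : R[i]) :
  u n @[n --> \oo] --> a -> u n @[n --> \oo] --> b -> a = b.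
Proof.
move=> ua ub; apply: complex_eqP.
  have h1 : complex.Re (u n) @[n --> \oo] --> complex.Re a by exact: cvg_cRe ua.
  have h2 : complex.Re (u n) @[n --> \oo] --> complex.Re b by exact: cvg_cRe ub.
  by rewrite -(cvg_lim (@Rhausdorff R) h1) (cvg_lim (@Rhausdorff R) h2).
have h1 : complex.Im (u n) @[n --> \oo] --> complex.Im a by exact: cvg_cIm ua.
have h2 : complex.Im (u n) @[n --> \oo] --> complex.Im b by exact: cvg_cIm ub.
by rewrite -(cvg_lim (@Rhausdorff R) h1) (cvg_lim (@Rhausdorff R) h2).
Qed.

Section Gaussian.
Context (R : realType).

Definition gauss_space n (x : 'rV[R]_n) : R := expR (- (sqnorm_space x / 2)).

Lemma gauss_space_ge0 n (x : 'rV[R]_n) : 0 <= gauss_space x.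
Proof. exact: expR_ge0. Qed.

Lemma gauss_space_le1 n (x : 'rV[R]_n) : gauss_space x <= 1.
Proof. by rewrite -expR0 ler_expR oppr_le0 divr_ge0 ?sqnorm_space_ge0. Qed.

Lemma sqnorm_space_cons n s (x : 'rV[R]_n) : sqnorm_space (consv s x) = s ^+ 2 + sqnorm_space x.
Proof.
by rewrite /sqnorm_space big_ord_recl consv0; congr (_ + _); apply: eq_bigr => i _; rewrite consvS.
Qed.

Lemma measurable_gauss_space n : measurable_fun setT (@gauss_space n : borel 'rV[R]_n -> R).
Proof.
apply: measurableT_comp; first exact: measurable_expR.
apply: measurableT_comp => //; apply: measurable_funM => //.
by apply: measurable_sum => i; apply: measurable_funX; exact: measurable_coord.
Qed.

Lemma integral_gauss_line :
  (\int[@lebesgue_measure R]_s (expR (- (s ^+ 2 / 2)))%:E = (Num.sqrt (2 * pi))%:E)%E.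
Proof.
have p0 : 0 < 2 * pi :> R by rewrite mulr_gt0 ?pi_gt0.
have q0 : Num.sqrt (2 * pi) != 0 :> R by rewrite gt_eqF ?sqrtr_gt0.
have := @integral_normal_pdf R 0 1.
under eq_integral do rewrite normal_pdfE ?oner_neq0// /normal_peak /normal_fun expr1n mul1r subr0 mulNr.
rewrite -[pi *+ 2]mulr_natl; under eq_integral do rewrite EFinM.
have mf : measurable_fun setT (fun x : R => (expR (- (x ^+ 2 / 2)))%:E).
  apply/measurable_EFinP; apply: measurableT_comp; first exact: measurable_expR.
  by apply: measurableT_comp => //; apply: measurable_funM => //; exact: measurable_funX.
rewrite ge0_integralZl//.
by move=> h; rewrite -[RHS]mule1 -h muleA -EFinM divff// mul1e.
Qed.

Lemma integral_gauss_space n :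
  (\int[leb R n]_x (gauss_space x)%:E = (Num.sqrt (2 * pi) ^+ n)%:E)%E.
Proof.
elim: n => [|n ih].
  transitivity (\int[\d_(0%R : borel 'rV[R]_0)]_x (gauss_space x)%:E)%E.
    by congr (integral _ _ _); rewrite lebE.
  rewrite integral_dirac//; last by apply/measurable_EFinP; exact: measurable_gauss_space.
  by rewrite diracT mul1e /gauss_space /sqnorm_space big_ord0 mul0r oppr0 expR0 expr0.
rewrite ge0_integral_lebS; last 2 first.
- by move=> x; rewrite lee_fin gauss_space_ge0.
- by apply/measurable_EFinP; exact: measurable_gauss_space.
under eq_integral do under eq_integral do
  rewrite /gauss_space sqnorm_space_cons mulrDl opprD expRD EFinM.
under eq_integral => s _.
  rewrite ge0_integralZl//; last by apply/measurable_EFinP; exact: measurable_gauss_space.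
  rewrite ih muleC; over.
have mf : measurable_fun setT (fun x : R => (expR (- (x ^+ 2 / 2)))%:E).
  apply/measurable_EFinP; apply: measurableT_comp; first exact: measurable_expR.
  by apply: measurableT_comp => //; apply: measurable_funM => //; exact: measurable_funX.
rewrite ge0_integralZl ?lee_fin ?exprn_ge0 ?sqrtr_ge0//.
by rewrite integral_gauss_line -EFinM -exprSr.
Qed.

Lemma integrable_gauss_space n : (leb R n).-integrable setT (EFin \o (@gauss_space n : borel _ -> R)).
Proof.
apply/integrableP; split; first by apply/measurable_EFinP; exact: measurable_gauss_space.
rewrite (eq_integral (fun x : borel 'rV[R]_n => (gauss_space x)%:E)) ?integral_gauss_space ?ltry//.
by move=> x _; rewrite /= ger0_norm ?gauss_space_ge0.
Qed.

End Gaussian.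

Section FourierInversion.
Context (R : realType) (d : nat).
Local Notation E := (spacetime R d).
Local Notation L := (leb R d).
Local Notation Cd := (Cd R d).

Definition gauss (z : E) : R[i] := (expR (- (sqnorm z / 2)))%:C.

Definition coordinate (j : option 'I_d) (z : E) : R := if j is Some i then z.1 0 i else z.2.

Lemma sqnorm_direction j (h : R) (z : E) :
  sqnorm (h *: direction R j + z) = h * (h + 2 * coordinate j z) + sqnorm z.
Proof.
case: z => x t; case: j => [j|]; rewrite /coordinate ?direction_Some ?direction_None /sqnorm /=; last by ring.
have sE (y : 'rV[R]_d) : sqnorm_space y = dotp y y by [].
rewrite !sE dotp_delta [dotp x (_ + _)]dotpC dotp_delta !mxE !eqxx /=.
ring.
Qed.

Lemma pd_sqnorm j : pd j (fun z : E => (sqnorm z / 2)%:C) (fun z => (coordinate j z)%:C).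
Proof.
move=> z; under [X in cder X]eq_fun do rewrite sqnorm_direction.
apply: cder_real.
pose proof (is_deriveD (is_deriveM (is_derive_id (0:R) (1:R)) (is_derive_affine (2^-1) (coordinate j z) 0))
  (is_derive_cst (sqnorm z / 2) (0:R) (1:R))) as h.
rewrite (_ : (fun h => _) = (id * (fun h : R => h * 2^-1 + coordinate j z)) + cst (sqnorm z / 2)).
  by apply: (is_derive_eqv h); rewrite /GRing.scale /=; ring.
by apply/funext => s; rewrite !fctE /=; field.
Qed.

Lemma schwartz_gauss : schwartz gauss.
Proof.
apply: (@schwartz_exp _ _ (fun z : E => sqnorm z / 2) (2^-1) 0); last by move=> z; rewrite subr0 mulrC.
- by apply: rpolyM; [exact: rpoly_sqnorm|exact: rpoly_cst].
- by [].
Qed.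

Lemma pd_gauss j : pd j gauss (fun z => - (coordinate j z)%:C * gauss z).
Proof. exact: pd_exp (pd_sqnorm j). Qed.

(** The transform exchanges the derivative in [x_j] and multiplication by [x_j], up to factors [i]
    that cancel, and it commutes with both operations in time. So the equation of [gauss] passes to
    its transform. *)
Lemma pd_fourier_gauss j :
  pd j (fourier_space gauss) (fun z => - (coordinate j z)%:C * fourier_space gauss z).
Proof.
have sg := schwartz_gauss.
case: j => [j|].
  have := pd_fourier_space j sg; congr pd; apply/funext => z.
  rewrite (_ : (fun z => _) = (fun z => 'i * pderiv (Some j) gauss z)); last first.
    apply/funext => y; rewrite (pd_pderiv (pd_gauss _)) /=.
    by apply: complex_eqP; rewrite ?cReM ?cImM ?cReN ?cImN /=; ring.
  rewrite fourier_spaceZ; last exact: schwartz_pderiv.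
  rewrite fourier_space_pderiv//.
  by rewrite mulrA; congr (_ * _); apply: complex_eqP; rewrite ?cReM ?cImM ?cReN ?cImN /=; ring.
have := pd_fourier_time sg; congr pd; apply/funext => z.
rewrite (pd_pderiv (pd_gauss _)) !fourier_spaceE /= mulrCA; congr (_ * _).
rewrite -cintZ; last exact: cintegrable_fourier.
by congr (cint _ _); apply/funext => x; rewrite mulrCA.
Qed.

Lemma cint_gauss_space : Cd * cint L (fun x => (gauss_space x)%:C) = 1.
Proof.
have p0 : 0 < 2 * pi :> R by rewrite mulr_gt0 ?pi_gt0.
have -> : cint L (fun x => (gauss_space x)%:C) = (Num.sqrt (2 * pi) ^+ d)%:C.
  apply: complex_eqP => /=; first by rewrite /Rintegral integral_gauss_space.
  by rewrite /Rintegral integral0_eq.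
rewrite -rmorphM /= (_ : _ * _ = 1)// -powR12_sqrt ?ltW// -powR_mulrn ?powR_ge0//.
rewrite -powRrM -powRD; last by apply/implyP => _; rewrite gt_eqF.
by rewrite (_ : _ + _ = 0) ?powRr0//; field.
Qed.

(* Both sides satisfy D_j f = - z_j f. *)
Lemma fourier_gauss : fourier_space gauss = gauss.
Proof.
(* The quotient of the two sides: its partial derivatives vanish, so that it is constant, and at the
   origin it is the normalized Gaussian integral. *)
pose H z := fourier_space gauss z * (expR (sqnorm z / 2))%:C.
have pH j : pd j H (fun=> 0).
  have pN : pd j (fun z : E => (- (sqnorm z / 2))%:C) (fun z => - (coordinate j z)%:C).
    have := pdZ (-1) (pd_sqnorm j); congr pd; apply/funext => z; last by rewrite mulN1r.
    by rewrite mulN1r rmorphN.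
  have := pdM (pd_fourier_gauss j) (pd_exp pN); congr pd; apply/funext => z.
    by rewrite /H opprK.
  by rewrite !opprK; ring.
have Hc z : H z = H 0.
  have cst (f : E -> R) : (forall j z, is_derive z (direction R j) f 0) -> f z = f 0.
    move=> df; have := bounded_partials_lipschitz df (M := 0) _ 0 z.
    rewrite !mul0r => /(_ _)/wrap[]; first by move=> j y; rewrite normr0.
    by rewrite normr_le0 subr_eq0 => /eqP.
  apply: complex_eqP.
    by apply: (cst (cRe \o H)) => j y; have [] := pdP y (pH j).
  by apply: (cst (cIm \o H)) => j y; have [] := pdP y (pH j).
have H0 : H 0 = 1.
  rewrite /H fourier_spaceE /= -[RHS]cint_gauss_space -mulrA; congr (_ * _).
  rewrite (_ : sqnorm (0 : E) = 0); last first.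
    rewrite /sqnorm /sqnorm_space big1 ?expr0n ?addr0// => i _.
    by rewrite mxE expr0n.
  rewrite mul0r expR0 mulr1; congr (cint _ _); apply/funext => x.
  rewrite /dotp big1 => [|i _]; last by rewrite mxE mul0r.
  by rewrite oppr0 expi0 mul1r /gauss /sqnorm /= expr0n addr0.
apply/funext => z; have := Hc z; rewrite H0 /H /gauss expRN => h.
rewrite -[LHS]mulr1 -[X in _ * X](_ : (expR (sqnorm z / 2))%:C * ((expR (sqnorm z / 2))^-1)%:C = 1).
  by rewrite mulrA h mul1r.
by rewrite -rmorphM /= divff ?gt_eqF ?expR_gt0.
Qed.

Lemma sqnorm_spaceZ (a : R) (x : 'rV[R]_d) : sqnorm_space (a *: x) = a ^+ 2 * sqnorm_space x.
Proof. by rewrite /sqnorm_space mulr_sumr; apply: eq_bigr => i _; rewrite mxE exprMn. Qed.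

Lemma gauss_kernel (c : R) (w : 'rV[R]_d) : 0 < c ->
  Cd * cint L (fun x => (gauss_space (c *: x))%:C * expi (- dotp w x)) =
  (c ^- d * gauss_space (c^-1 *: w))%:C.
Proof.
move=> c0; have cn0 : c ^+ d != 0 by rewrite expf_neq0// gt_eqF.
have fi := cintegrable_fourier (c^-1 *: w) 0 schwartz_gauss.
have := congr1 (fun f => f (c^-1 *: w, 0)) fourier_gauss.
rewrite fourier_spaceE /= (cint_affine 0 c0 fi).
rewrite (_ : cint _ _ = cint L (fun x => (gauss_space (c *: x))%:C * expi (- dotp w x))); last first.
  congr (cint _ _); apply/funext => x; rewrite addr0 mulrC; congr (_ * expi _).
    by rewrite /gauss /sqnorm /= expr0n addr0.
  congr (- _); apply: eq_bigr => i _; rewrite !mxE mulrACA mulVf ?mul1r//.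
  by rewrite gt_eqF.
rewrite /gauss /sqnorm /= expr0n addr0 -/(gauss_space _) => h.
have e : (c ^- d)%:C * (c ^+ d)%:C = 1 by rewrite -rmorphM /= mulVf.
by rewrite rmorphM /= -h [Cd * (_ * _)]mulrCA [RHS]mulrA e mul1r.
Qed.

Section InversionAt.
Context (psi : E -> R[i]) (sp : schwartz psi) (x : 'rV[R]_d) (t : R).

Lemma dotpDl (u v w : 'rV[R]_d) : dotp (u + v) w = dotp u w + dotp v w.
Proof. by rewrite /dotp -big_split; apply: eq_bigr => i _; rewrite mxE mulrDl. Qed.

Lemma integrable_gauss_scale (c : R) : 0 < c ->
  L.-integrable setT (EFin \o (fun x => gauss_space (c *: x))).
Proof.
move=> c0; have := integrable_affine 0 c0 (integrable_gauss_space R d).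
by congr (_.-integrable _ _); apply/funext => y /=; rewrite addr0.
Qed.

(** The Gaussian in [xi] makes the double integral absolutely convergent. Fubini's theorem puts the
    integral over [xi] inside, where it is [gauss_kernel], and the substitution [y = c u - x]
    removes the scale from the Gaussian. *)
Lemma regularized_inversion (c : R) : 0 < c ->
  cint L (fun xi => (gauss_space (c *: xi))%:C * (expi (- dotp x xi) * fourier_space psi (xi, t))) =
  cint L (fun u => (gauss_space u)%:C * psi (c *: u - x, t)).
Proof.
move=> c0; have [M psiM] := schwartz_slice_bound sp.
have M0 : 0 <= M by have := le_trans (normc_ge0 _) (psiM 0 0); rewrite pmulr_lge0 ?spw_gt0.
have cd0 : 0 <= c ^- d by rewrite invr_ge0 exprn_ge0// ltW.
have eu (u : 'rV[R]_d) : c^-1 *: (x + (c *: u - x)) = u.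
  by rewrite addrCA subrr addr0 scalerA mulVf ?gt_eqF// scale1r.
have ek (a : R[i]) (b : R) : (c ^+ d)%:C * (a * (c ^- d * b)%:C) = b%:C * a.
  have e : (c ^+ d)%:C * (c ^- d)%:C = 1 by rewrite -rmorphM /= divff ?expf_neq0 ?gt_eqF.
  by rewrite rmorphM /= mulrCA [(c ^+ d)%:C * (_ * _)]mulrA e mul1r mulrC.
have ig := integrable_gauss_scale c0.
have mg : measurable_fun setT (fun y : borel 'rV[R]_d => gauss_space (c *: y)).
  by apply/measurable_EFinP; exact: measurable_int ig.
pose k (z : borel 'rV[R]_d * borel 'rV[R]_d) : R[i] :=
  (gauss_space (c *: z.1))%:C * expi (- dotp (x + z.2) z.1).
pose K (z : borel 'rV[R]_d * borel 'rV[R]_d) : R[i] := Cd * psi (z.2, t) * k z.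
have mk : cmeasurable k.
  apply: cmeasurableM.
    by apply: cmeasurable_real; exact: measurableT_comp mg measurable_fst.
  apply: cmeasurable_expi; apply: measurableT_comp => //.
  apply: measurable_sum => i; apply: measurable_funM.
    under eq_fun do rewrite mxE; apply: measurable_funD => //.
    exact: measurableT_comp (measurable_coord i) measurable_snd.
  exact: measurableT_comp (measurable_coord i) measurable_fst.
have mK : cmeasurable K.
  apply: cmeasurableM => //; apply: cmeasurableM; first exact: cmeasurable_cst.
  have m1 := cmeasurable_comp (measurable_slice t) (schwartz_measurable sp).
  by have := cmeasurable_comp (@measurable_snd _ _ (borel 'rV[R]_d) (borel 'rV[R]_d)) m1.
have nk z : normc (k z) = gauss_space (c *: z.1).
  by rewrite normcM normc_expi mulr1 normcR ger0_norm ?gauss_space_ge0.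
have iK : cintegrable (L \x L)%E K.
  apply: (@cintegrable_le _ (borel 'rV[R]_d * borel 'rV[R]_d)%type _ (L \x L)%E K
    (fun z => gauss_space (c *: z.1) * (normc Cd * M * spw z.2)) mK).
    apply: integrable_prod.
    - apply: measurable_funM; first exact: measurableT_comp mg measurable_fst.
      apply: measurable_funM => //; exact: measurableT_comp (@measurable_spw R d) measurable_snd.
    - by move=> z; rewrite mulr_ge0 ?gauss_space_ge0// !mulr_ge0 ?normc_ge0// ltW// spw_gt0.
    - have e xi : (\int[L]_y (gauss_space (c *: xi) * (normc Cd * M * spw y))%:E =
          (normc Cd * M * pi ^+ d * gauss_space (c *: xi))%:E)%E.
        under eq_integral do rewrite mulrA EFinM.
        rewrite ge0_integralZl//; last 3 first.
        + by apply/measurable_EFinP; exact: measurable_spw.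
        + by move=> y _; rewrite lee_fin ltW// spw_gt0.
        + by rewrite lee_fin !mulr_ge0 ?normc_ge0 ?gauss_space_ge0.
        by rewrite integral_spw -EFinM; congr EFin; ring.
      under eq_integral do rewrite e EFinM.
      rewrite ge0_integralZl//; last 3 first.
      + exact/measurable_EFinP.
      + by move=> y _; rewrite lee_fin gauss_space_ge0.
      + by rewrite lee_fin !mulr_ge0 ?normc_ge0 ?exprn_ge0 ?pi_ge0.
      by apply: lte_mul_pinfty; rewrite ?lee_fin ?mulr_ge0 ?normc_ge0 ?exprn_ge0 ?pi_ge0 ?integral_fune_lt_pinfty.
  move=> z; rewrite /K [leLHS]normcM [normc (Cd * _)]normcM nk mulrC -!mulrA ler_wpM2l ?gauss_space_ge0//.
  by rewrite ler_wpM2l ?normc_ge0.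
have := cint_prod1 iK; rewrite (cint_prod2 iK) => fub.
transitivity (cint L (fun xi => cint L (fun y => K (xi, y)))).
  congr (cint _ _); apply/funext => xi; rewrite fourier_spaceE /=.
  have ie := cintegrable_fourier xi t sp.
  rewrite -(cintZ _ ie) -(cintZ _ (cintegrableZ _ ie)) -(cintZ _ (cintegrableZ _ (cintegrableZ _ ie))).
  congr (cint _ _); apply/funext => y; rewrite /K /k /= dotpDl opprD expiD [dotp y xi]dotpC.
  by ring.
rewrite -fub; transitivity (cint L (fun y => psi (y, t) * (c ^- d * gauss_space (c^-1 *: (x + y)))%:C)).
  congr (cint _ _); apply/funext => y; rewrite /K /= cintZ; last first.
    apply: (cintegrable_le _ ig); last by move=> xi; rewrite nk.
    exact: (cmeasurable_comp (measurable_pair2 y) mk).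
  by rewrite -(gauss_kernel (x + y) c0) [RHS]mulrCA [RHS]mulrA.
have mh : measurable_fun setT (fun y : borel 'rV[R]_d => gauss_space (c^-1 *: (x + y))).
  have := measurableT_comp (@measurable_gauss_space R d) (measurable_affine (c^-1) (c^-1 *: x)).
  by congr measurable_fun; apply/funext => y /=; rewrite scalerDr addrC.
have fi : cintegrable L (fun y => psi (y, t) * (c ^- d * gauss_space (c^-1 *: (x + y)))%:C).
  apply: (@cintegrable_le _ (borel 'rV[R]_d) _ L _ (fun y => c ^- d * M * spw y)); [|exact: integrable_cspw|].
    apply: cmeasurableM; first exact: (cmeasurable_comp (measurable_slice t) (schwartz_measurable sp)).
    exact: cmeasurable_real (measurable_funM (measurable_cst _) mh).
  clear iK fub mK nk mk K k; move=> y.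
  rewrite normcM normcR mulrC ger0_norm ?(mulr_ge0 cd0 (gauss_space_ge0 _))//.
  rewrite -!mulrA; apply: (ler_wpM2l cd0).
  rewrite -[leRHS]mul1r; apply: ler_pM; rewrite ?normc_ge0 ?gauss_space_ge0 ?gauss_space_le1//.
rewrite (cint_affine (- x) c0 fi) -(cintZ _ (cintegrable_affine (- x) c0 fi)).
congr (cint _ _); apply/funext => u.
by rewrite eu ek.
Qed.

(** Let [c] tend to 0 in [regularized_inversion]. On the left the Gaussian tends to 1, with a
    majorant from the Schwartz function [fourier_space psi]; on the right [psi] is evaluated at
    [- x] in the limit, and the Gaussian integral cancels the normalization. *)
Lemma fourier_inversion_at : fourier_space (fourier_space psi) (x, t) = psi (- x, t).
Proof.
pose c n : R := n.+1%:R^-1; have c0 n : 0 < c n by rewrite invr_gt0.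
have cc : c n @[n --> \oo] --> (0 : R) by exact: cvg_harmonic.
have [M FM] := schwartz_slice_bound (fourier_schwartz sp).
have [M' psiM] : exists M, forall z, normc (psi z) <= M.
  have [M' h] := schwartz_decay sp 0; exists M' => z.
  by have := h z; rewrite expr0 mul1r.
pose A n (xi : borel 'rV[R]_d) := (gauss_space (c n *: xi))%:C * (expi (- dotp x xi) * fourier_space psi (xi, t)).
pose B n (u : borel 'rV[R]_d) := (gauss_space u)%:C * psi (c n *: u - x, t).
have cA : cint L (A n) @[n --> \oo] --> cint L (fun xi => expi (- dotp x xi) * fourier_space psi (xi, t)).
  apply: (@cvg_cint _ _ _ L A _ (fun x => M * spw x)).
  - move=> n; apply: cmeasurableM.
      apply: cmeasurable_real; apply/measurable_EFinP.
      exact: measurable_int (integrable_gauss_scale (c0 n)).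
    apply: cmeasurableM; first exact: cmeasurable_kernel.
    exact: (cmeasurable_comp (measurable_slice t) (schwartz_measurable (fourier_schwartz sp))).
  - move=> xi; set w := _ * _.
    have g1 : gauss_space (c n *: xi) @[n --> \oo] --> expR (0 : R).
      rewrite /gauss_space; under eq_fun do rewrite sqnorm_spaceZ.
      apply: continuous_cvg; first exact: continuous_expR.
      have : - (c n * c n * sqnorm_space xi / 2) @[n --> \oo] --> - (0 * 0 * sqnorm_space xi / 2 : R).
        by apply: cvgN; apply: cvgM; [apply: cvgM; [exact: cvgM|exact: cvg_cst]|exact: cvg_cst].
      by rewrite !mul0r oppr0.
    rewrite expR0 in g1; rewrite /A -/w; move: w => w; apply: cvg_complex.
      rewrite /comp; under eq_fun do rewrite cReM /= mul0r subr0.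
      by have h := cvgM g1 (cvg_cst (complex.Re w)); rewrite mul1r in h; exact: h.
    rewrite /comp; under eq_fun do rewrite cImM /= mul0r addr0.
    by have h := cvgM g1 (cvg_cst (complex.Im w)); rewrite mul1r in h; exact: h.
  - exact: integrable_cspw.
  - move=> n xi; rewrite /A 2!normcM normc_expi mul1r normcR ger0_norm ?gauss_space_ge0//.
    by rewrite -[leRHS]mul1r; apply: ler_pM; rewrite ?normc_ge0 ?gauss_space_ge0 ?gauss_space_le1.
have cB : cint L (B n) @[n --> \oo] --> cint L (fun u => (gauss_space u)%:C * psi (- x, t)).
  apply: (@cvg_cint _ _ _ L B _ (fun u => M' * gauss_space u)).
  - move=> n; apply: cmeasurableM; first by apply: cmeasurable_real; exact: measurable_gauss_space.
    have m1 := cmeasurable_comp (measurable_slice t) (schwartz_measurable sp).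
    exact: (cmeasurable_comp (measurable_affine (c n) (- x)) m1).
  - move=> u.
    have p1 : psi (c n *: u - x, t) @[n --> \oo] --> psi (- x, t).
      have p0 : c n *: u - x @[n --> \oo] --> - x.
        rewrite -[X in _ --> X]add0r; apply: cvgD; last exact: cvg_cst.
        by rewrite -(scale0r u); apply: cvgZl.
      have p2 : ((c n *: u - x, t) : E) @[n --> \oo] --> nbhs ((- x, t) : E).
        exact: (cvg_pair p0 (cvg_cst t)).
      have sc : continuous psi := schwartz_continuous sp.
      by move=> U /(sc (- x, t)); exact: p2.
    move: (psi (- x, t)) p1 => w p1; apply: cvg_complex; rewrite /B.
      rewrite /comp; under eq_fun do rewrite cReM /= mul0r subr0.
      by rewrite cReM /= mul0r subr0; apply: cvgM; [exact: cvg_cst|exact: cvg_cRe].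
    rewrite /comp; under eq_fun do rewrite cImM /= mul0r addr0.
    by rewrite cImM /= mul0r addr0; apply: cvgM; [exact: cvg_cst|exact: cvg_cIm].
  - have := integrableZl measurableT M' (integrable_gauss_space R d).
    by congr (_.-integrable _ _).
  - move=> n xi; rewrite !normcM normcR ger0_norm ?gauss_space_ge0// mulrC.
    by rewrite ler_wpM2r ?gauss_space_ge0.
have AB : (fun n => cint L (A n)) = (fun n => cint L (B n)).
  by apply/funext => n; exact: regularized_inversion.
rewrite AB in cA; rewrite fourier_spaceE /=.
have -> : cint L (fun xi => expi (- dotp x xi) * fourier_space psi (xi, t)) =
    cint L (fun u => (gauss_space u)%:C * psi (- x, t)).
  exact: cvg_complex_unique cA cB.
under [X in cint _ X]eq_fun do rewrite mulrC.
rewrite cintZ; last first.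
  apply: (cintegrable_le _ (integrable_gauss_space R d)).
    by apply: cmeasurable_real; exact: measurable_gauss_space.
  by move=> u; rewrite normcR ger0_norm ?gauss_space_ge0.
by rewrite mulrCA cint_gauss_space mulr1.
Qed.

End InversionAt.

Lemma fourier_inversion psi : schwartz psi ->
  fourier_space (fourier_space psi) = (fun z : E => psi (- z.1, z.2)).
Proof. by move=> sp; apply/funext => -[x t]; exact: fourier_inversion_at. Qed.

End FourierInversion.

(** * Uniqueness *)

Lemma cvg_complexM (R : realType) (u v : nat -> R[i]) (a b : R[i]) :
  u n @[n --> \oo] --> a -> v n @[n --> \oo] --> b -> u n * v n @[n --> \oo] --> a * b.
Proof.
move=> ua vb; apply: cvg_complex; rewrite /comp.
  under eq_fun do rewrite cReM; rewrite cReM.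
  by apply: cvgB; apply: cvgM; [exact: cvg_cRe ua|exact: cvg_cRe vb|exact: cvg_cIm ua|exact: cvg_cIm vb].
under eq_fun do rewrite cImM; rewrite cImM.
by apply: cvgD; apply: cvgM; [exact: cvg_cRe ua|exact: cvg_cIm vb|exact: cvg_cIm ua|exact: cvg_cRe vb].
Qed.

Lemma cvg_complexD (R : realType) (u v : nat -> R[i]) (a b : R[i]) :
  u n @[n --> \oo] --> a -> v n @[n --> \oo] --> b -> u n + v n @[n --> \oo] --> a + b.
Proof.
move=> ua vb; apply: cvg_complex; rewrite /comp.
  under eq_fun do rewrite cReD; rewrite cReD.
  by apply: cvgD; [exact: cvg_cRe ua|exact: cvg_cRe vb].
under eq_fun do rewrite cImD; rewrite cImD.
by apply: cvgD; [exact: cvg_cIm ua|exact: cvg_cIm vb].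
Qed.

(** * Functionals with dominated convergence *)

Section DominatedFunctional.
Context d (X : measurableType d) (R : realType).
Implicit Types (f g : X -> R[i]) (W : X -> R) (J : (X -> R[i]) -> R[i]).

Definition admissible W f :=
  cmeasurable f /\ exists C : R, forall x, normc (f x) <= C * W x.

Definition dominated_functional W J :=
  (forall (a : R[i]) f g, admissible W f -> admissible W g ->
     J (fun x => a * f x + g x) = a * J f + J g) /\
  (forall (F : nat -> X -> R[i]) f (C : R), (forall n, cmeasurable (F n)) ->
     (forall n x, normc (F n x) <= C * W x) ->
     (forall x, F n x @[n --> \oo] --> f x) -> J (F n) @[n --> \oo] --> J f).

Section DominatedTheory.
Context W J (dJ : dominated_functional W J).

Lemma admissible0 : admissible W (fun=> 0).
Proof. by split; [exact: cmeasurable_cst|exists 0 => x; rewrite Normc.normc0 mul0r]. Qed.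

Lemma admissibleD f g : admissible W f -> admissible W g -> admissible W (fun x => f x + g x).
Proof.
move=> [mf [C fC]] [mg [D gD]]; split; first exact: cmeasurableD.
by exists (C + D) => x; apply: le_trans (normcD _ _) _; rewrite mulrDl lerD.
Qed.

Lemma admissibleM f g (K : R) : cmeasurable g -> (forall x, normc (g x) <= K) ->
  admissible W f -> admissible W (fun x => g x * f x).
Proof.
move=> mg gK [mf [C fC]]; split; first exact: cmeasurableM.
exists (K * C) => x; rewrite normcM -mulrA; apply: ler_pM; rewrite ?normc_ge0//.
Qed.

Lemma admissibleZ (a : R[i]) f : admissible W f -> admissible W (fun x => a * f x).
Proof. by apply: (admissibleM (K := normc a)) => //; exact: cmeasurable_cst. Qed.

Lemma dominated0 : J (fun=> 0) = 0.
Proof.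
have := dJ.1 (-1) _ _ admissible0 admissible0.
rewrite [X in _ = X](_ : _ = 0) => [h|]; last by rewrite mulN1r addNr.
by rewrite -[RHS]h; congr J; apply/funext => x; rewrite mulr0 addr0.
Qed.

Lemma dominatedZ a f : admissible W f -> J (fun x => a * f x) = a * J f.
Proof.
move=> af; have := dJ.1 a _ _ af admissible0; rewrite dominated0 addr0 => <-.
by congr J; apply/funext => x; rewrite addr0.
Qed.

Lemma dominatedD f g : admissible W f -> admissible W g ->
  J (fun x => f x + g x) = J f + J g.
Proof.
move=> af ag; rewrite -[X in X + _]mul1r -dJ.1//.
by congr J; apply/funext => x; rewrite mul1r.
Qed.

Lemma dominated_sum0 (S : Type) (s : seq S) (F : S -> X -> R[i]) :
  (forall i, admissible W (F i)) -> (forall i, J (F i) = 0) ->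
  admissible W (fun x => \sum_(i <- s) F i x) /\ J (fun x => \sum_(i <- s) F i x) = 0.
Proof.
move=> aF JF; elim: s => [|i s [ih1 ih2]].
  by under eq_fun do rewrite big_nil; split; [exact: admissible0|exact: dominated0].
under eq_fun do rewrite big_cons; split; first exact: admissibleD.
by rewrite dominatedD// JF ih2 addr0.
Qed.

Lemma dominated_cvg0 (F : nat -> X -> R[i]) f (C : R) : (forall n, cmeasurable (F n)) ->
  (forall n x, normc (F n x) <= C * W x) ->
  (forall x, F n x @[n --> \oo] --> f x) -> (forall n, J (F n) = 0) -> J f = 0.
Proof.
move=> mF FC Ff JF; have := dJ.2 F f C mF FC Ff.
rewrite (_ : (fun n => J (F n)) = fun=> 0); last exact/funext.
by move=> h; apply: (cvg_complex_unique h); exact: cvg_cst.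
Qed.

End DominatedTheory.

Lemma cvg_rcomplex (u : nat -> R) (a : R) : u n @[n --> \oo] --> a ->
  (u n)%:C @[n --> \oo] --> a%:C.
Proof. by move=> ua; apply: cvg_complex => //; exact: cvg_cst. Qed.

Section Bounded.
Context J (dJ : dominated_functional (fun=> 1) J).

Lemma admissible_bounded f (K : R) : cmeasurable f -> (forall x, normc (f x) <= K) ->
  admissible (fun=> 1) f.
Proof. by move=> mf fK; split => //; exists K => x; rewrite mulr1. Qed.

Lemma admissible_indic (A : set X) : measurable A -> admissible (fun=> 1) (fun x => (\1_A x : R)%:C).
Proof.
move=> mA; apply: (@admissible_bounded _ 1); first by apply: cmeasurable_real; exact: measurable_indic.
by move=> x; rewrite normcR indicE ger0_norm//; case: (_ \in _).
Qed.

(** The sets whose indicator is annihilated form a Dynkin system: complements by linearity and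
    [J 1 = 0], disjoint unions by dominated convergence. *)
Lemma dominated_pi (G : set (set X)) : @measurable _ X = <<s G >> -> setI_closed G ->
  J (fun=> 1) = 0 -> (forall A, G A -> J (fun x => (\1_A x : R)%:C) = 0) ->
  forall A, measurable A -> J (fun x => (\1_A x : R)%:C) = 0.
Proof.
move=> GE GI J1 JG A; rewrite GE.
apply: (@dynkin_induction _ X G (fun A => J (fun x => (\1_A x : R)%:C) = 0)) => //.
- by rewrite -[RHS]J1; congr J; apply/funext => x; rewrite indicT.
- move=> B mB JB; have a1 := admissible_indic mB.
  have a2 : admissible (fun=> 1) (fun=> 1 : R[i]).
    by apply: (@admissible_bounded _ 1); [exact: cmeasurable_cst|move=> x; rewrite Normc.normc1].
  have := dJ.1 (-1) _ _ a1 a2; rewrite JB J1 mulr0 addr0 => <-; congr J; apply/funext => x.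
  by rewrite !indicE in_setC; case: (_ \in _); rewrite /= ?mulr0 ?mulr1 ?add0r ?addNr.
- move=> F mF tF JF.
  have JU n : measurable (\big[setU/set0]_(i < n) F i) /\
      J (fun x => (\1_(\big[setU/set0]_(i < n) F i) x : R)%:C) = 0.
    split; first exact: bigsetU_measurable.
    elim: n => [|n ih].
      rewrite -[RHS](dominated0 dJ); congr J; apply/funext => x.
      by rewrite big_ord0 indic0.
    have mU : measurable (\big[setU/set0]_(i < n) F i) by exact: bigsetU_measurable.
    have := dominatedD dJ (admissible_indic mU) (admissible_indic (mF n)).
    rewrite ih JF addr0 => <-; congr J; apply/funext => x.
    rewrite -rmorphD /= !indicE big_ord_recr /= in_setU.
    case: (boolP (x \in F n)) => xn; last by rewrite orbF addr0.
    case: (boolP (x \in _)) => xG; last by rewrite add0r.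
    move: xG xn; rewrite !inE -bigcup_mkord => -[i /= ltin Fi] xn.
    by have := tF i n I I (ex_intro _ x (conj Fi xn)) => ein; rewrite ein ltnn in ltin.
  apply: (@dominated_cvg0 _ _ dJ (fun n x => (\1_(\big[setU/set0]_(i < n) F i) x : R)%:C) _ 1).
  + by move=> n; have [mU _] := JU n; have [] := admissible_indic mU.
  + by move=> n x; rewrite normcR indicE mulr1 ger0_norm//; case: (_ \in _).
  + move=> x; apply: cvg_near_cst.
    have [[j _ Fj]|nU] := pselect ((\bigcup_n F n) x).
      exists j.+1 => // n /= jn; congr (_%:C); rewrite !indicE !mem_set//; first by exists j.
      by rewrite -bigcup_mkord; exists j.
    apply: nearW => n; congr (_%:C); rewrite !indicE !memNset//.
    by rewrite -bigcup_mkord => -[j _ Fj]; apply: nU; exists j.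
  + by move=> n; have [] := JU n.
Qed.

(** From indicators to simple functions by linearity, to nonnegative functions by approximation from
    below, then to real and complex ones. *)
Lemma dominated_bounded0 : (forall A, measurable A -> J (fun x => (\1_A x : R)%:C) = 0) ->
  forall f (K : R), cmeasurable f -> (forall x, normc (f x) <= K) -> J f = 0.
Proof.
move=> J0'.
have pos (k : X -> R) (K : R) : measurable_fun setT k -> (forall x, 0 <= k x <= K) ->
    J (fun x => (k x)%:C) = 0.
  move=> mk k0K; have mk' : measurable_fun setT (EFin \o k) by exact/measurable_EFinP.
  pose F n := nnsfun_approx measurableT mk' n.
  have Fk x : F n x @[n --> \oo] --> k x.
    have k0 y : [set: X] y -> (0 <= (EFin \o k) y)%E by move=> _ /=; rewrite lee_fin; case/andP: (k0K y).
    by have /fine_cvgP[_] := cvg_nnsfun_approx measurableT mk' k0 (I : [set: X] x).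
  have Fle n x : F n x <= k x.
    have nd : nondecreasing_seq (fun n => F n x).
      by move=> a b ab; have /lefP := nd_nnsfun_approx measurableT mk' ab; apply.
    rewrite -(cvg_lim (@Rhausdorff R) (Fk x)).
    by apply: (nondecreasing_cvgn_le nd); apply/cvg_ex; exists (k x); exact: Fk.
  apply: (@dominated_cvg0 _ _ dJ (fun n x => (F n x)%:C) _ K).
  - by move=> n; apply: cmeasurable_real; exact: measurable_funPT.
  - move=> n x; rewrite normcR mulr1 ger0_norm//; apply: le_trans (Fle n x) _.
    by case/andP: (k0K x).
  - by move=> x; exact: cvg_rcomplex.
  - move=> n; pose s := finmap.enum_fset (fset_set (range (F n))).
    have mS y : measurable (F n @^-1` [set y]) by exact: measurable_sfunP.
    have aS y : admissible (fun=> 1) (fun x => y%:C * (\1_(F n @^-1` [set y]) x : R)%:C).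
      by apply: admissibleZ; exact: admissible_indic.
    have J0 y : J (fun x => y%:C * (\1_(F n @^-1` [set y]) x : R)%:C) = 0.
      by rewrite (dominatedZ dJ _ (admissible_indic (mS y))) J0' ?mulr0.
    have [_ <-] := dominated_sum0 dJ s aS J0.
    congr J; apply/funext => x; rewrite fimfunE fsbig_finite//= rmorph_sum /=.
    by apply: eq_bigr => y _; rewrite rmorphM.
have real (k : X -> R) (K : R) : measurable_fun setT k -> (forall x, `|k x| <= K) ->
    J (fun x => (k x)%:C) = 0.
  move=> mk kK.
  (* [X] may be empty, so that [0 <= K] is known only in the presence of a point. *)
  have K0 (x : X) : 0 <= K by exact: le_trans (normr_ge0 _) (kK x).
  (* A shift by [K] makes the function nonnegative. *)
  have h1 : J (fun x => (k x + K)%:C) = 0.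
    apply: (pos _ (K + K)); first exact: measurable_funD.
    by move=> x; have := kK x; rewrite ler_norml lerD2r => /andP[h ->]; rewrite -lerBlDr sub0r h.
  have h2 : J (fun x : X => K%:C) = 0.
    by apply: (pos (fun=> K) K) => // x; rewrite lexx (K0 x).
  have a1 : admissible (fun=> 1) (fun x => (k x + K)%:C).
    apply: (@admissible_bounded _ (K + K)); first by apply: cmeasurable_real; exact: measurable_funD.
    move=> x; rewrite normcR; apply: le_trans (ler_normD _ _) _.
    by rewrite lerD// ger0_norm// (K0 x).
  have a2 : admissible (fun=> 1) (fun x : X => K%:C).
    by apply: (@admissible_bounded _ (normc K%:C)) => //; exact: cmeasurable_cst.
  have := dJ.1 (-1) _ _ a2 a1; rewrite h1 h2 mulr0 addr0 => <-; congr J; apply/funext => x.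
  by rewrite mulN1r -rmorphN -rmorphD /=; congr (_%:C); ring.
move=> f K [m1 m2] fK.
have k1 x : `|complex.Re (f x)| <= K by apply: le_trans (fK x); exact: ler_norm_cRe.
have k2 x : `|complex.Im (f x)| <= K by apply: le_trans (fK x); exact: ler_norm_cIm.
have a1 : admissible (fun=> 1) (fun x => (complex.Re (f x))%:C).
  by apply: (@admissible_bounded _ K); [exact: cmeasurable_real|move=> x; rewrite normcR].
have a2 : admissible (fun=> 1) (fun x => (complex.Im (f x))%:C).
  by apply: (@admissible_bounded _ K); [exact: cmeasurable_real|move=> x; rewrite normcR].
have := dJ.1 'i _ _ a2 a1; rewrite (real _ _ m1 k1) (real _ _ m2 k2) mulr0 addr0 => <-.
congr J; apply/funext => x.
by apply: complex_eqP; rewrite ?cReD ?cImD ?cReM ?cImM /=; ring.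
Qed.

End Bounded.

End DominatedFunctional.

(** * Orthants and exponentials of polynomials *)

Section Orthants.
Context d (X : measurableType d) (R : realType) (I : finType) (x : I -> X -> R).

Definition orthant (c : I -> R) : set X := [set z | forall i, c i < x i z].

Definition orthants : set (set X) := [set A | exists c, A = orthant c].

Lemma setI_closed_orthants : setI_closed orthants.
Proof.
move=> _ _ [c ->] [e ->]; exists (fun i => Num.max (c i) (e i)).
apply/seteqP; split=> [z [h1 h2] i|z h]; first by rewrite gt_max h1 h2.
by split=> i; have := h i; rewrite gt_max => /andP[].
Qed.

(** The second hypothesis says that [X] carries the sigma-algebra induced by its coordinates. It is
    applied to the identity, seen as a map from the space with the sigma-algebra generated by the
    orthants. *)
Lemma orthants_generate : (forall i, measurable_fun setT (x i)) ->
  (forall d' (Y : measurableType d') (f : Y -> X),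
     (forall i, measurable_fun setT (x i \o f)) -> measurable_fun setT f) ->
  @measurable _ X = <<s orthants >>.
Proof.
move=> mx gen; apply/seteqP; split; last first.
  apply: smallest_sub; first exact: sigma_algebra_measurable.
  move=> _ [c ->].
  rewrite (_ : orthant c = \bigcap_(i in [set: I]) (x i @^-1` [set s | c i < s])); last first.
    by apply/seteqP; split=> [z h i _|z h i]; exact: h.
  apply: fin_bigcap_measurable => // i _; rewrite -[X in measurable X]setTI.
  apply: mx => //; rewrite (_ : [set s | c i < s] = `]c i, +oo[%classic); first exact: measurable_itv.
  by apply/seteqP; split=> s; rewrite /= in_itv/= andbT.
have mid : measurable_fun setT ((fun z => z) : g_sigma_algebraType orthants -> X).
  apply: gen => i; apply: (measurability _ (RGenOInfty.measurableE R)) => /= _ [_ [a ->] <-].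
  (* The half-space [x_i > a] is the union over [n] of the orthants bounded below by [- n] in the
     other coordinates. *)
  rewrite setTI [X in measurable X](_ : _ = \bigcup_n orthant (fun j => if j == i then a else - n%:R)).
    apply: bigcupT_measurable => n; apply: sub_sigma_algebra; by eexists.
  apply/seteqP; split=> [z|z [n _ /(_ i)]] /=; rewrite ?eqxx; last first.
    by rewrite in_itv/= andbT.
  rewrite in_itv/= andbT => az.
  pose K := \sum_j `|x j z|.
  exists (Num.trunc K).+1 => // j; case: eqP => [->//|_].
  rewrite ltrNl; apply: le_lt_trans (ler_norm _) _; rewrite normrN.
  apply: (@le_lt_trans _ _ K); last by rewrite truncnS_gt.
  by rewrite /K (bigD1 j)//= lerDl sumr_ge0.
move=> A mA; have := mid measurableT A mA; by rewrite setTI.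
Qed.

End Orthants.

Section OrthantPolynomial.
Context (R : realType).

(* [orthant_poly n (x - c)] tends to [0] for [x > c] and to infinity for [x <= c]. *)
Definition orthant_poly (n : nat) (x : R) : R :=
  n.+1%:R * (1 - x / n.+1%:R) ^+ (2 * (n.+1 * n.+1)).

Lemma orthant_poly_ge0 n x : 0 <= orthant_poly n x.
Proof. by rewrite mulr_ge0// exprM exprn_ge0// sqr_ge0. Qed.

Lemma cvg_nat_exp (e : R) : 0 < e -> (n.+1%:R * expR (- (e * n.+1%:R))) @[n --> \oo] --> 0.
Proof.
move=> e0; have e2 : 0 < e / 2 by rewrite divr_gt0.
have [M hM] := exp_le_invX 1 e2.
have h : M * expR (- (e / 2)) ^+ n.+1 @[n --> \oo] --> (0 : R).
  rewrite -(mulr0 M); apply: cvgM; first exact: cvg_cst.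
  have := @cvg_expr R (expR (- (e / 2))).
  rewrite ger0_norm ?expR_ge0// expR_lt1 oppr_lt0 => /(_ e2) c.
  by rewrite (cvg_shiftS (fun n => expR (- (e / 2)) ^+ n)).
apply: (squeeze_cvgr _ (cvg_cst 0) h).
apply: nearW => n; rewrite mulr_ge0 ?expR_ge0//=.
rewrite -expRM_natl.
have -> : - (e * n.+1%:R) = - (e / 2 * n.+1%:R) + n.+1%:R * - (e / 2) by field.
by rewrite expRD mulrA ler_wpM2r ?expR_ge0//; have := hM n.+1%:R (ler0n _ _); rewrite expr1.
Qed.

(** With [m = n+1], the inequality [1 - y <= exp(- y)] at [y = x / m] turns the power [2 m^2] into
    [exp(- 2 x m)], which beats the factor [m]. The base is nonnegative only once [m >= x]. *)
Lemma exp_orthant_poly_pos x : 0 < x -> expR (- orthant_poly n x) @[n --> \oo] --> (1 : R).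
Proof.
move=> x0; rewrite -expR0; apply: continuous_cvg; first exact: continuous_expR.
rewrite -oppr0; apply: cvgN.
apply: (squeeze_cvgr _ (cvg_cst 0) (cvg_nat_exp x0)).
near=> n; rewrite orthant_poly_ge0/= ler_wpM2l//.
have xn : x / n.+1%:R <= 1.
  rewrite ler_pdivrMr// mul1r; near: n.
  exists (Num.trunc x) => // n /= hn; apply: ltW; apply: (lt_le_trans (truncnS_gt _)).
  by rewrite ler_nat.
have y0 : 0 <= 1 - x / n.+1%:R by rewrite subr_ge0.
apply: (@le_trans _ _ (expR (- (x / n.+1%:R)) ^+ (2 * (n.+1 * n.+1)))).
  by apply: lerXn2r; rewrite ?nnegrE ?expR_ge0//; exact: expR_ge1Dx.
rewrite -expRM_natl ler_expR !natrM.
have n0 : n.+1%:R != 0 :> R by [].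
have -> : 2 * (n.+1%:R * n.+1%:R) * - (x / n.+1%:R) = - (2 * (x * n.+1%:R)) :> R by field.
by rewrite lerN2 ler_peMl// ?mulr_ge0 ?ltW// ltr1n.
Unshelve. all: by end_near.
Qed.

Lemma cvg_expN_nat : expR (- n.+1%:R) @[n --> \oo] --> (0 : R).
Proof. by rewrite (cvg_shiftS (fun n => expR (- n%:R) : R)); exact: cvgn_expR. Qed.

(** Here the base is at least 1, and the prefactor [n+1] alone makes the polynomial unbounded. This
    covers [x = 0], whence the strict inequalities in [orthant]. *)
Lemma exp_orthant_poly_neg x : x <= 0 -> expR (- orthant_poly n x) @[n --> \oo] --> (0 : R).
Proof.
move=> x0; apply: (squeeze_cvgr _ (cvg_cst 0) cvg_expN_nat).
apply: nearW => n; rewrite expR_ge0/= ler_expR lerN2 ler_peMr//.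
by apply: exprn_ege1; rewrite lerBrDr gerDl -oppr_ge0 -mulNr divr_ge0// oppr_ge0.
Qed.

End OrthantPolynomial.

Section OrthantUniqueness.
Context d (X : measurableType d) (R : realType) (I : finType) (x : I -> X -> R).
Context (mx : forall i, measurable_fun setT (x i)).
Context (gen : forall d' (Y : measurableType d') (f : Y -> X),
  (forall i, measurable_fun setT (x i \o f)) -> measurable_fun setT f).

Lemma measurable_orthant c : measurable (orthant x c).
Proof. by rewrite (orthants_generate mx gen); apply: sub_sigma_algebra; exists c. Qed.

(** Constants are reached too: the orthants with corner [(- n, ..., - n)] exhaust the space, which
    gives [J 1 = 0] for the Dynkin argument. *)
Lemma dominated_orthants0 (J : (X -> R[i]) -> R[i]) : dominated_functional (fun=> 1) J ->
  (forall c, J (fun z => (\1_(orthant x c) z : R)%:C) = 0) ->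
  forall f (K : R), cmeasurable f -> (forall z, normc (f z) <= K) -> J f = 0.
Proof.
move=> dJ J0; apply: dominated_bounded0 => //.
apply: (dominated_pi dJ (orthants_generate mx gen) (@setI_closed_orthants _ _ _ _ x)); last first.
  by move=> _ [c ->].
apply: (@dominated_cvg0 _ _ _ _ _ dJ (fun n z => (\1_(orthant x (fun=> - n%:R)) z : R)%:C) _ 1) => //.
- by move=> n; apply: cmeasurable_real; apply: measurable_indic; exact: measurable_orthant.
- by move=> n z; rewrite normcR indicE mulr1 ger0_norm//; case: (_ \in _).
- move=> z; apply: cvg_near_cst; pose K := \sum_j `|x j z|.
  exists (Num.trunc K).+1 => // n /= hn; rewrite indicE mem_set// => j.
  rewrite ltrNl; apply: le_lt_trans (ler_norm _) _; rewrite normrN.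
  apply: (@le_lt_trans _ _ K); first by rewrite /K (bigD1 j)//= lerDl sumr_ge0.
  by apply: (lt_le_trans (truncnS_gt _)); rewrite ler_nat.
Qed.

(** Each factor tends to 1 inside the orthant; outside, a single factor that tends to 0 suffices
    because all are at most 1. As the exponent is a polynomial, indicators of orthants come within
    reach of test functions. *)
Lemma cvg_orthant c z :
  expR (- \sum_i orthant_poly n (x i z - c i)) @[n --> \oo] --> (\1_(orthant x c) z : R).
Proof.
rewrite indicE; case: (boolP (z \in _)) => [/set_mem zc|zc] /=.
  rewrite (_ : (fun n => _) = fun n => \prod_i expR (- orthant_poly n (x i z - c i))); last first.
    by apply/funext => n; rewrite -expR_sum sumrN.
  rewrite -[X in _ --> X](_ : \prod_(i : I) 1 = 1 :> R); last by rewrite big1.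
  elim: (index_enum I) => [|i s ih].
    by under eq_fun do rewrite big_nil; rewrite big_nil; exact: cvg_cst.
  under eq_fun do rewrite big_cons; rewrite big_cons; apply: cvgM => //.
  by apply: exp_orthant_poly_pos; rewrite subr_gt0; exact: zc.
have [i xi] : exists i, x i z <= c i.
  apply/not_existsP => h; move/negP: zc; apply; rewrite inE => i.
  by rewrite ltNge; apply/negP; exact: h.
have xi' : x i z - c i <= 0 by rewrite subr_le0.
apply: (squeeze_cvgr _ (cvg_cst 0) (exp_orthant_poly_neg xi')).
apply: nearW => n; rewrite expR_ge0/= ler_expR lerN2 (bigD1 i)//= lerDl.
by apply: sumr_ge0 => j _; exact: orthant_poly_ge0.
Qed.

End OrthantUniqueness.

Lemma measurable_fun_posV d (Y : measurableType d) (R : realType) (w : Y -> R) :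
  measurable_fun setT w -> (forall z, 0 < w z) -> measurable_fun setT (fun z => (w z)^-1).
Proof.
move=> mw w0; rewrite (_ : (fun z => _) = (fun r => r `^ (-1)) \o w).
  exact: measurableT_comp (measurable_powR (-1)) mw.
by apply/funext => z /=; rewrite powR_inv1// ltW.
Qed.

Section DominatedWeight.
Context d (Y : measurableType d) (R : realType) (W : Y -> R).
Context (J : (Y -> R[i]) -> R[i]) (dJ : dominated_functional W J).

(** A fixed admissible factor [w] turns [J] into the analogue of a finite measure, to be tested on
    bounded functions; [p] allows for functions of some of the variables only. *)
Lemma dominated_weight d' (X : measurableType d') (p : Y -> X) (w : Y -> R[i]) :
  measurable_fun setT p -> admissible W w ->
  dominated_functional (fun=> 1) (fun k : X -> R[i] => J (fun z => k (p z) * w z)).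
Proof.
move=> mp aw; have [mw [C wC]] := aw.
have adm f : admissible (fun=> 1) f -> admissible W (fun z => f (p z) * w z).
  move=> [mf [K fK]]; apply: (admissibleM (K := K)) => //.
    exact: (cmeasurable_comp mp mf).
  by move=> z; have := fK (p z); rewrite mulr1.
split=> [a f g af ag|F f K mF FK Ff].
  by rewrite -dJ.1; [|exact: adm|exact: adm]; congr J; apply/funext => z; rewrite mulrDl mulrA.
apply: (dJ.2 _ _ (K * C)).
- by move=> n; apply: cmeasurableM => //; exact: (cmeasurable_comp mp (mF n)).
- move=> n z; rewrite normcM -mulrA; apply: ler_pM; rewrite ?normc_ge0//.
  by have := FK n (p z); rewrite mulr1.
- by move=> z; apply: cvg_complexM; [exact: Ff|exact: cvg_cst].
Qed.

Lemma dominated_positive_weight (w : Y -> R) : (forall z, 0 < w z) ->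
  admissible W (fun z => (w z)%:C) ->
  (forall f (K : R), cmeasurable f -> (forall z, normc (f z) <= K) ->
     J (fun z => f z * (w z)%:C) = 0) ->
  forall f, admissible W f -> J f = 0.
Proof.
move=> w0 [mw [Cw wC]] J0 f [mf [C fC]].
have mw' : measurable_fun setT w := mw.1.
have mA (n : nat) : measurable [set z | normc (f z) <= n%:R * w z].
  have mnw : measurable_fun setT (fun z => n%:R * w z) by exact: measurable_funM.
  have := measurable_fun_le (@measurableT _ Y) (measurable_normc mf) mnw.
  by rewrite setTI.
apply: (@dominated_cvg0 _ _ _ _ _ dJ (fun n z => f z * (\1_[set z | normc (f z) <= n%:R * w z] z : R)%:C) _ C).
- move=> n; apply: cmeasurableM => //; apply: cmeasurable_real; exact: measurable_indic.
- move=> n z; rewrite normcM normcR indicE -[leRHS]mulr1; apply: ler_pM; rewrite ?normc_ge0//.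
  by rewrite ger0_norm//; case: (_ \in _).
- move=> z; apply: cvg_near_cst; exists (Num.trunc (normc (f z) / w z)).+1 => // n /= hn.
  rewrite indicE mem_set ?mulr1//=; rewrite -ler_pdivrMr//; apply: ltW.
  by apply: (lt_le_trans (truncnS_gt _)); rewrite ler_nat.
- move=> n.
  rewrite (_ : (fun z => _) = fun z => (f z * (\1_[set z | normc (f z) <= n%:R * w z] z / w z)%:C) * (w z)%:C).
    apply: (J0 _ n%:R).
      apply: cmeasurableM => //; apply: cmeasurable_real; apply: measurable_funM; first exact: measurable_indic.
      exact: measurable_fun_posV.
    move=> z; rewrite normcM normcR indicE; case: (boolP (z \in _)) => [/set_mem /= h|_]; last first.
      by rewrite mul0r normr0 mulr0.
    by rewrite /= mul1r ger0_norm ?invr_ge0 ?(ltW (w0 z))// ler_pdivrMr.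
  by apply/funext => z; rewrite -mulrA -rmorphM /= divfK// gt_eqF.
Qed.

End DominatedWeight.

Section SchwartzDensity.
Context (R : realType) (d : nat).
Local Notation E := (spacetime R d).

Lemma measurable_coordinate j : measurable_fun setT (fun z : borel E => coordinate j z).
Proof. by case: j => [j|]; [exact: measurable_fst_coord|exact: measurable_time]. Qed.

Lemma measurable_fun_coordinate d' (Y : measurableType d') (f : Y -> borel E) :
  (forall j, measurable_fun setT (@coordinate R d j \o f)) -> measurable_fun setT f.
Proof.
by move=> mf; apply: measurable_fun_spacetime => [i|]; [exact: (mf (Some i))|exact: (mf None)].
Qed.

Lemma rpoly_coordinate j : rpoly (@coordinate R d j).
Proof. by case: j => [j|]; [exact: rpoly_coord|exact: rpoly_time]. Qed.

Lemma rpoly_orthant n c (x : E -> R) : rpoly x -> rpoly (fun z => orthant_poly n (x z - c)).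
Proof.
move=> rx; rewrite /orthant_poly; apply: rpolyM; first exact: rpoly_cst.
apply: rpolyX.
rewrite (_ : (fun z => _) = fun z => (1 + c / n.+1%:R) + (- n.+1%:R^-1) * x z).
  by apply: rpolyD; [exact: rpoly_cst|apply: rpolyM => //; exact: rpoly_cst].
by apply/funext => z; rewrite mulrBl; ring.
Qed.

Lemma growth_wgt (g : 'rV[R]_d -> R[i]) (c : R) M N (z : E) :
  (forall x, normc (g x) <= c * (1 + sqnorm_space x) ^+ M) ->
  normc (g z.1) * wgt (N + M) z <= c * wgt N z.
Proof.
move=> gM; have s0 := sqnorm1_gt0 z.
have x0 : 0 < 1 + sqnorm_space z.1 by rewrite ltr_pwDl// sqnorm_space_ge0.
have c0 : 0 <= c by have := le_trans (normc_ge0 _) (gM z.1); rewrite pmulr_lge0// exprn_gt0.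
rewrite /wgt exprD invfM [X in _ * X]mulrC mulrA ler_wpM2r ?invr_ge0 ?exprn_ge0 ?(ltW s0)//.
rewrite ler_pdivrMr ?exprn_gt0//; apply: le_trans (gM _) _; rewrite ler_wpM2l//.
by apply: lerXn2r; rewrite ?nnegrE ?(ltW s0) ?(ltW x0)// lerD2l /sqnorm lerDl sqr_ge0.
Qed.

Lemma admissible_growth (g : 'rV[R]_d -> R[i]) (c : R) M N (f : E -> R[i]) :
  @cmeasurable _ (borel 'rV[R]_d) _ g ->
  (forall x, normc (g x) <= c * (1 + sqnorm_space x) ^+ M) ->
  @admissible _ (borel E) R (wgt (N + M)) f -> @admissible _ (borel E) R (wgt N) (fun z => g z.1 * f z).
Proof.
move=> mg gM [mf [C fC]]; split.
  by apply: cmeasurableM => //; exact: (cmeasurable_comp (@measurable_space R d) mg).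
exists (C * c) => z; have C0 : 0 <= C.
  by have := le_trans (normc_ge0 _) (fC z); rewrite pmulr_lge0 ?wgt_gt0.
rewrite normcM -[leRHS]mulrA; apply: le_trans (ler_wpM2l C0 (growth_wgt N z gM)).
by rewrite mulrCA ler_wpM2l ?normc_ge0.
Qed.

Definition gaussw (z : E) : R := expR (- sqnorm z).

Lemma schwartz_admissible N (psi : E -> R[i]) : schwartz psi -> @admissible _ (borel E) R (wgt N) psi.
Proof.
move=> sp; split; first exact: schwartz_measurable.
by have [C hC] := decay_wgt N (schwartz_decay sp); exists C.
Qed.

Lemma schwartz_gaussw : schwartz (fun z : E => (gaussw z)%:C).
Proof.
by apply: (@schwartz_exp _ _ _ 1 0) => //; [exact: rpoly_sqnorm|move=> z; rewrite mul1r subr0].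
Qed.

(** With the weight [exp(- |z|^2)] it is enough to reach indicators of orthants, and these times the
    weight are limits of the Schwartz functions [exp(- Q n)]. *)
Theorem schwartz_dense N (J : (borel E -> R[i]) -> R[i]) :
  dominated_functional (wgt N : borel E -> R) J ->
  (forall chi, schwartz chi -> J chi = 0) ->
  forall f, @admissible _ (borel E) R (wgt N) f -> J f = 0.
Proof.
move=> dJ J0; have aw := schwartz_admissible N schwartz_gaussw.
apply: (@dominated_positive_weight _ _ _ _ _ dJ gaussw) => //; first by move=> z; exact: expR_gt0.
have dK := dominated_weight dJ (p := fun z => z) (@measurable_id _ (borel E) setT) aw.
apply: (dominated_orthants0 measurable_coordinate measurable_fun_coordinate dK) => c.
have [_ [C gC]] := aw.
pose Q n (z : E) := (\sum_j orthant_poly n (coordinate j z - c j)) + sqnorm z.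
have sQ n : schwartz (fun z : E => (expR (- Q n z))%:C).
  apply: (@schwartz_exp _ _ _ 1 0) => //.
    apply: rpolyD; last exact: rpoly_sqnorm.
    by apply: rpoly_sum => j; apply: rpoly_orthant; exact: rpoly_coordinate.
  move=> z; rewrite mul1r subr0 lerDr sumr_ge0// => j _; exact: orthant_poly_ge0.
apply: (@dominated_cvg0 _ _ _ _ _ dJ (fun n z => (expR (- Q n z))%:C) _ C).
- by move=> n; exact: schwartz_measurable.
- move=> n z; apply: le_trans (gC z); rewrite !normcR !ger0_norm ?expR_ge0//.
  rewrite ler_expR lerN2 lerDr sumr_ge0// => j _; exact: orthant_poly_ge0.
- move=> z; rewrite -rmorphM; apply: cvg_rcomplex.
  rewrite /Q; under eq_fun do rewrite opprD expRD.
  by apply: cvgM; [exact: (@cvg_orthant _ (borel E) R _ (@coordinate R d) c z)|exact: cvg_cst].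
- by move=> n; exact: J0.
Qed.

End SchwartzDensity.

(** * Uniqueness for the homogeneous evolution equation *)

Section EvolutionUniqueness.
Context (R : realType) (d : nat).
Local Notation E := (spacetime R d).
Context (g : 'rV[R]_d -> R[i]) (mg : @cmeasurable _ (borel 'rV[R]_d) _ g).
Context (c0 : R) (M : nat) (gM : forall x, normc (g x) <= c0 * (1 + sqnorm_space x) ^+ M).
Context (gR0 : forall x, 0 <= complex.Re (g x)).
Context (N : nat) (J : (borel E -> R[i]) -> R[i]).
Context (dJ : dominated_functional (wgt N : borel E -> R) J).
Context (J_future : forall f, @admissible _ (borel E) R (wgt N) f ->
  (forall z : E, 0 <= z.2 -> f z = 0) -> J f = 0).
Context (J_equation : forall chi, schwartz chi ->
  J (fun z : E => - pderiv None chi z + g z.1 * chi z) = 0).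

Local Notation adm := (@admissible _ (borel E) R (wgt N)).

(** The exponentials [exp(- p t)] are unbounded for [t < 0]; this factor keeps them admissible, and
    [J] cannot see it by [J_future]. *)
Definition future (z : E) : R := \1_[set z : E | 0 <= z.2] z.

Lemma futureE z : future z = (0 <= z.2)%R%:R.
Proof. by rewrite /future indicE; congr (nat_of_bool _)%:R; apply/idP/idP; rewrite inE. Qed.

Lemma future_lt0 z : z.2 < 0 -> future z = 0.
Proof. by rewrite futureE ltNge => /negbTE ->. Qed.

Lemma measurable_future : measurable_fun setT (future : borel E -> R).
Proof.
apply: measurable_indic.
have := measurable_fun_le (@measurableT _ (borel E)) (measurable_cst (0 : R)) (@measurable_time R d).
by rewrite setTI.
Qed.

Definition damping (p : R) (z : E) : R := expR (- (sqnorm_space z.1 + p * z.2)).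

Lemma damping_le p K : 0 < p ->
  exists C, 0 <= C /\ forall z : E, 0 <= z.2 -> damping p z <= C * wgt K z.
Proof.
(* The power [2 K] in time comes from [1 + |x|^2 + t^2 <= (1 + |x|^2) (1 + t)^2] for [t >= 0]. The
   factors [exp 1] and [exp p] make up for the exponents [1 + |x|^2] and [p (1 + t)]. *)
move=> p0; have [A hA] := exp_le_invX K (@ltr01 R); have [B hB] := exp_le_invX (2 * K) p0.
have A0 : 0 <= A by apply: le_trans (hA 0 (lexx _)); rewrite mulr_ge0 ?exprn_ge0 ?expR_ge0.
have B0 : 0 <= B by apply: le_trans (hB 0 (lexx _)); rewrite mulr_ge0 ?exprn_ge0 ?expR_ge0.
exists (A * expR 1 * (B * expR p)); split; first by rewrite !mulr_ge0 ?expR_ge0.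
case=> x t /= t0; rewrite /wgt ler_pdivlMr ?exprn_gt0 ?sqnorm1_gt0// mulrC.
have x0 := sqnorm_space_ge0 x.
apply: (@le_trans _ _ (((1 + sqnorm_space x) ^+ K * expR (- (1 * (1 + sqnorm_space x))) * expR 1) *
   ((1 + t) ^+ (2 * K) * expR (- (p * (1 + t))) * expR p))); last first.
  apply: ler_pM; rewrite ?mulr_ge0 ?exprn_ge0 ?expR_ge0 ?addr_ge0//.
    by rewrite ler_wpM2r ?expR_ge0// hA// addr_ge0.
  by rewrite ler_wpM2r ?expR_ge0// hB// addr_ge0.
have e1 : expR (- (1 * (1 + sqnorm_space x))) * expR 1 = expR (- sqnorm_space x).
  by rewrite -expRD; congr expR; ring.
have e2 : expR (- (p * (1 + t))) * expR p = expR (- (p * t)).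
  by rewrite -expRD; congr expR; ring.
rewrite -[X in _ <= X * _]mulrA -[X in _ <= _ * X]mulrA e1 e2 mulrACA -expRD -opprD.
rewrite ler_wpM2r ?expR_ge0//.
rewrite exprM -exprMn; apply: lerXn2r; rewrite ?nnegrE ?(ltW (sqnorm1_gt0 _))//.
  by rewrite mulr_ge0 ?addr_ge0 ?sqr_ge0.
rewrite /sqnorm /=; nra.
Qed.

Lemma measurable_damping p : measurable_fun setT (damping p : borel E -> R).
Proof.
apply: measurableT_comp; first exact: measurable_expR.
apply: measurableT_comp => //; apply: measurable_funD.
  by apply: measurable_sum => i; apply: measurable_funX; exact: measurable_fst_coord.
by apply: measurable_funM => //; exact: measurable_time.
Qed.

Lemma future_admissible p (f : E -> R[i]) (K : R) (L : nat) : 0 < p ->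
  @cmeasurable _ (borel E) _ f ->
  (forall z : E, 0 <= z.2 -> normc (f z) <= K * (1 + sqnorm z) ^+ L * damping p z) ->
  exists C, forall z, normc ((future z)%:C * f z) <= C * wgt N z.
Proof.
move=> p0 mf fK; have [C [C0 hC]] := damping_le (L + N) p0.
exists (`|K| * C) => z; rewrite normcM normcR futureE.
have [z0|z0] := leP 0 z.2; last first.
  by rewrite normr0 mul0r !mulr_ge0 ?wgt_ge0.
rewrite normr1 mul1r; apply: (le_trans (fK z z0)).
have s0 : 0 < (1 + sqnorm z) ^+ L by rewrite exprn_gt0 ?sqnorm1_gt0.
apply: (@le_trans _ _ (`|K| * (1 + sqnorm z) ^+ L * (C * wgt (L + N) z))).
  apply: ler_pM; rewrite ?expR_ge0 ?hC//.
    have := le_trans (normc_ge0 _) (fK z z0); by rewrite pmulr_lge0 ?expR_gt0.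
  by rewrite ler_wpM2r ?ler_norm// ltW.
rewrite le_eqVlt; apply/orP; left; apply/eqP.
by rewrite /wgt exprD; field; rewrite !gt_eqF ?exprn_gt0 ?sqnorm1_gt0.
Qed.

Lemma evolution_admissible chi : schwartz chi ->
  adm (fun z => - pderiv None chi z + g z.1 * chi z).
Proof.
move=> sc; apply: admissibleD; last by apply: (admissible_growth mg gM); exact: schwartz_admissible.
have := admissibleZ (-1) (schwartz_admissible N (schwartz_pderiv None sc)).
by congr admissible; apply/funext => z; rewrite mulN1r.
Qed.

Section DampedTest.
Context (p : R) (p0 : 0 < p) (c : 'I_d -> R).

(** The term [t^2 / (n+1)] makes the exponent coercive also for [t] tending to minus infinity, where
    [p t] is negative, and disappears in the limit. *)
Definition damped_exponent n (z : E) : R :=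
  \sum_i orthant_poly n (z.1 0 i - c i) + sqnorm_space z.1 + (p * z.2 + z.2 ^+ 2 / n.+1%:R).

Lemma rpoly_damped n : rpoly (damped_exponent n).
Proof.
apply: rpolyD; first apply: rpolyD.
- by apply: rpoly_sum => i; apply: rpoly_orthant; exact: rpoly_coord.
- by apply: rpoly_sum => i; apply: rpolyX; exact: rpoly_coord.
- apply: rpolyD; first by apply: rpolyM; [exact: rpoly_cst|exact: rpoly_time].
  by apply: rpolyM; [apply: rpolyX; exact: rpoly_time|exact: rpoly_cst].
Qed.

Lemma schwartz_damped n : schwartz (fun z : E => (expR (- damped_exponent n z))%:C).
Proof.
have n0 : 0 < n.+1%:R :> R by [].
(* Completing the square, with [m = n+1]: [t^2/m + p t = t^2/(2m) + (t/m + p)^2 m/2 - p^2 m/2]. *)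
apply: (@schwartz_exp _ _ _ (2 * n.+1%:R)^-1 (p ^+ 2 * n.+1%:R / 2)).
- exact: rpoly_damped.
- by rewrite invr_gt0 mulr_gt0.
- move=> z; rewrite /damped_exponent /sqnorm.
  have o0 : 0 <= \sum_i orthant_poly n (z.1 0 i - c i).
    by apply: sumr_ge0 => i _; exact: orthant_poly_ge0.
  have s0 := sqnorm_space_ge0 z.1.
  have h : (2 * n.+1%:R)^-1 * sqnorm_space z.1 <= sqnorm_space z.1.
    by rewrite ler_piMl// invf_le1 ?mulr_gt0// -natrM ler1n.
  have q : 0 <= (z.2 / n.+1%:R + p) ^+ 2 * n.+1%:R / 2.
    by rewrite divr_ge0// mulr_ge0// sqr_ge0.
  have qE : (z.2 / n.+1%:R + p) ^+ 2 * n.+1%:R / 2 = (2 * n.+1%:R)^-1 * z.2 ^+ 2 + p * z.2 + p ^+ 2 * n.+1%:R / 2.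
    by field.
  have hE : z.2 ^+ 2 / n.+1%:R = (2 * n.+1%:R)^-1 * z.2 ^+ 2 + (2 * n.+1%:R)^-1 * z.2 ^+ 2.
    by field.
  set a := (2 * _)^-1 in h qE hE *; set b := p ^+ 2 * _ / 2 in qE *.
  rewrite qE in q; clear qE; clearbody b; rewrite hE mulrDr; move: o0 s0 h q.
  move: (\sum_i _) (sqnorm_space z.1) (a * sqnorm_space z.1) (a * z.2 ^+ 2) (p * z.2) => x1 x2 x3 x4 x5.
  lra.
Qed.

Lemma pderiv_damped n : pderiv None (fun z : E => (expR (- damped_exponent n z))%:C) =
  (fun z : E => - (p + 2 * z.2 / n.+1%:R)%:C * (expR (- damped_exponent n z))%:C).
Proof.
apply: pd_pderiv; apply: pd_exp => z.
have e (h : R) : damped_exponent n (h *: direction R None + z) =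
    h * (h * n.+1%:R^-1 + (p + 2 * z.2 / n.+1%:R)) + damped_exponent n z.
  case: z => x t; rewrite direction_None /damped_exponent /=; field.
  by [].
under [X in cder X]eq_fun do rewrite e.
apply: cder_real.
pose proof (is_deriveD (is_deriveM (is_derive_id (0:R) (1:R)) (is_derive_affine (n.+1%:R^-1) (p + 2 * z.2 / n.+1%:R) 0))
  (is_derive_cst (damped_exponent n z) (0:R) (1:R))) as h.
by apply: (is_derive_eqv h); rewrite /GRing.scale /=; ring.
Qed.

(** What [- D_t + g] makes of [damping p], cut off to [t >= 0]. *)
Definition resolvent_weight (z : E) : R[i] := (future z)%:C * ((p%:C + g z.1) * (damping p z)%:C).

Lemma measurable_g : @cmeasurable _ (borel E) _ (fun z => g z.1).
Proof. exact: (cmeasurable_comp (@measurable_space R d) mg). Qed.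

Lemma c0_ge0 : 0 <= c0.
Proof.
have := le_trans (normc_ge0 _) (gM 0); rewrite pmulr_lge0// exprn_gt0//.
by rewrite ltr_pwDl// sqnorm_space_ge0.
Qed.

(** The term [2 t] majorizes [2 t / (n+1)], the time derivative of the regularizing term, uniformly
    in [n]. *)
Lemma symbol_bound (a : R) (z : E) : 0 <= a -> 0 <= z.2 ->
  a + 2 * z.2 + normc (g z.1) <= (a + 2 + c0) * (1 + sqnorm z) ^+ M.+1.
Proof.
move=> a0 z0; have s1 := sqnorm1_ge1 z; have c00 := c0_ge0.
have sM : 1 <= (1 + sqnorm z) ^+ M by exact: exprn_ege1.
have h1 : z.2 <= 1 + sqnorm z by apply: le_trans (ler_norm _) (ler_time_sqnorm1 z).
have h2 : normc (g z.1) <= c0 * (1 + sqnorm z) ^+ M.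
  apply: le_trans (gM _) _; rewrite ler_wpM2l//; apply: lerXn2r; rewrite ?nnegrE.
  - by rewrite addr_ge0// sqnorm_space_ge0.
  - by rewrite ltW// sqnorm1_gt0.
  - by rewrite lerD2l /sqnorm lerDl sqr_ge0.
rewrite exprSr; set A := (1 + sqnorm z) ^+ M in sM h2 *; set B := 1 + sqnorm z in s1 h1 *.
have AB : A <= A * B by rewrite ler_peMr// (le_trans _ sM).
have AB2 : B <= A * B by rewrite ler_peMl// (le_trans _ s1).
have AB1 : 1 <= A * B by apply: le_trans s1 AB2.
have : a * 1 <= a * (A * B) by rewrite ler_wpM2l.
have : c0 * A <= c0 * (A * B) by rewrite ler_wpM2l.
lra.
Qed.

Lemma admissible_resolvent : adm resolvent_weight.
Proof.
split.
  apply: cmeasurableM; first exact: cmeasurable_real measurable_future.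
  apply: cmeasurableM; last exact: cmeasurable_real (measurable_damping p).
  by apply: cmeasurableD; [exact: cmeasurable_cst|exact: measurable_g].
apply: (@future_admissible p _ (p + 2 + c0) M.+1) => //.
  apply: cmeasurableM; last exact: cmeasurable_real (measurable_damping p).
  by apply: cmeasurableD; [exact: cmeasurable_cst|exact: measurable_g].
move=> z z0; rewrite normcM normcR [`|_|]ger0_norm ?expR_ge0// ler_wpM2r ?expR_ge0//.
apply: le_trans (symbol_bound (ltW p0) z0).
apply: le_trans (normcD _ _) _; rewrite normcR (ger0_norm (ltW p0)) lerD2r lerDl mulr_ge0//.
Qed.

(** The difference of the two arguments vanishes for [t >= 0]. *)
Lemma dominated_future0 f : adm f -> J (fun z => (future z)%:C * f z) = J f.
Proof.
move=> af.
have af' : adm (fun z => (future z)%:C * f z).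
  apply: (admissibleM (K := 1)) => //; first exact: cmeasurable_real measurable_future.
  by move=> z; rewrite normcR futureE; case: (0 <= _); rewrite ?normr0 ?normr1.
have afN := admissibleZ (-1) af.
have : J (fun z => (future z)%:C * f z + -1 * f z) = 0.
  apply: J_future; first exact: admissibleD.
  by move=> z z0; rewrite futureE z0 mul1r mulN1r subrr.
rewrite (dominatedD dJ)// (dominatedZ dJ)// mulN1r => /eqP.
by rewrite subr_eq0 => /eqP.
Qed.

(** The equation is tested with [exp(- damped_exponent n)]. On [t >= 0] the results are dominated by
    [p + 2 t + |g|] times [damping p], and they converge to the resolvent weight on the orthant. *)
Lemma resolvent_orthant :
  J (fun z : E => (\1_(orthant (fun i (x : borel 'rV[R]_d) => x 0 i) c) (z.1 : borel 'rV[R]_d) : R)%:C * resolvent_weight z) = 0.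
Proof.
pose chi n (z : E) : R[i] := (expR (- damped_exponent n z))%:C.
pose F n (z : E) : R[i] := ((p + 2 * z.2 / n.+1%:R)%:C + g z.1) * chi n z.
have sc n : schwartz (chi n) := schwartz_damped n.
have FE n : F n = fun z => - pderiv None (chi n) z + g z.1 * chi n z.
  by apply/funext => z; rewrite /F pderiv_damped mulNr opprK mulrDl.
have aF n : adm (F n) by rewrite FE; exact: evolution_admissible.
have mbd : @cmeasurable _ (borel E) R (fun z => (p + 2 * `|z.2| + normc (g z.1))%:C * (damping p z)%:C).
  apply: cmeasurableM; last exact: cmeasurable_real (measurable_damping p).
  apply: cmeasurable_real; apply: measurable_funD; last exact: measurable_normc measurable_g.
  apply: measurable_funD => //; apply: measurable_funM => //.
  by apply: measurableT_comp => //; exact: measurable_time.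
have bd (z : E) : 0 <= z.2 -> normc ((p + 2 * `|z.2| + normc (g z.1))%:C * (damping p z)%:C) <=
    (p + 2 + c0) * (1 + sqnorm z) ^+ M.+1 * damping p z.
  move=> z0; rewrite normcM !normcR ger0_norm; last first.
    by rewrite !addr_ge0 ?normc_ge0 ?mulr_ge0// ltW.
  rewrite [`|damping _ _|]ger0_norm ?expR_ge0// ler_wpM2r ?expR_ge0// ger0_norm//.
  by apply: symbol_bound => //; exact: ltW.
have [C hC] := future_admissible p0 mbd bd.
apply: (@dominated_cvg0 _ _ _ _ _ dJ (fun n z => (future z)%:C * F n z) _ C).
- move=> n; apply: cmeasurableM; first exact: cmeasurable_real measurable_future.
  by have [] := aF n.
- move=> n z; apply: le_trans (hC z); rewrite !normcM !normcR; rewrite futureE.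
  case: (leP 0 z.2) => z0; last by rewrite normr0 !mul0r.
  rewrite normr1 !mul1r; apply: ler_pM; rewrite ?normc_ge0//.
    apply: le_trans (normcD _ _) _; rewrite normcR.
    rewrite [leRHS]ger0_norm; last by rewrite !addr_ge0 ?normc_ge0 ?mulr_ge0// ltW.
    rewrite lerD2r ger0_norm; last by rewrite addr_ge0 ?(ltW p0)// divr_ge0// mulr_ge0.
    rewrite lerD2l ger0_norm// ler_pdivrMr// ler_peMr ?mulr_ge0//.
    by rewrite ler1n.
  rewrite !ger0_norm ?expR_ge0// ler_expR lerN2 /damped_exponent.
  have o0 : 0 <= \sum_i orthant_poly n (z.1 0 i - c i).
    by apply: sumr_ge0 => i _; exact: orthant_poly_ge0.
  have q0 : 0 <= z.2 ^+ 2 / n.+1%:R by rewrite divr_ge0 ?sqr_ge0.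
  by move: o0 q0; move: (\sum_i _) (sqnorm_space _) (p * _) (_ / _) => x1 x2 x3 x4; lra.
- move=> z; have h0 : (n.+1%:R^-1 : R) @[n --> \oo] --> (0 : R) by exact: cvg_harmonic.
  rewrite /resolvent_weight mulrCA; apply: cvg_complexM; first exact: cvg_cst.
  rewrite mulrCA; apply: cvg_complexM.
    apply: cvg_complexD; last exact: cvg_cst.
    apply: cvg_rcomplex; rewrite -[X in _ --> X]addr0; apply: cvgD; first exact: cvg_cst.
    by rewrite -(mulr0 (2 * z.2)); apply: cvgM => //; exact: cvg_cst.
  rewrite -rmorphM /=; apply: cvg_rcomplex.
  rewrite /damped_exponent; under eq_fun do rewrite -addrA opprD expRD.
  apply: cvgM.
    exact: (@cvg_orthant _ (borel 'rV[R]_d) R _ (fun i (x : borel 'rV[R]_d) => x 0 i) c z.1).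
  rewrite /damping; apply: continuous_cvg; first exact: continuous_expR.
  apply: cvgN; apply: cvgD; first exact: cvg_cst.
  rewrite -[X in _ --> X]addr0; apply: cvgD; first exact: cvg_cst.
  by rewrite -(mulr0 (z.2 ^+ 2)); apply: cvgM => //; exact: cvg_cst.
- by move=> n; rewrite (dominated_future0 (aF n)) FE J_equation.
Qed.

End DampedTest.

(** Here [Re g >= 0] enters the uniqueness: [Re (p + g) >= p > 0], so that [1 / (p + g)] is bounded
    by [1 / p] and can be absorbed into the bounded function [f]. *)
Lemma dominated_damping p (f : borel 'rV[R]_d -> R[i]) (K : R) : 0 < p ->
  cmeasurable f -> (forall x, normc (f x) <= K) ->
  J (fun z : E => f z.1 * ((future z)%:C * (damping p z)%:C)) = 0.
Proof.
move=> p0 mf fK.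
have K0 : 0 <= K := le_trans (normc_ge0 _) (fK 0).
pose u x : R[i] := p%:C + g x.
have mu : @cmeasurable _ (borel 'rV[R]_d) _ u by apply: cmeasurableD => //; exact: cmeasurable_cst.
have u0 x : p <= complex.Re (u x) by rewrite /u cReD /= lerDl.
pose q x : R := complex.Re (u x) ^+ 2 + complex.Im (u x) ^+ 2.
have q0 x : 0 < q x by rewrite ltr_pwDl ?sqr_ge0// exprn_gt0// (lt_le_trans p0).
(* The inverse of [u] as conjugate over squared modulus, so that its measurability can be read off
   from real and imaginary parts. *)
pose v x : R[i] := (complex.Re (u x) +i* - complex.Im (u x)) * ((q x)^-1)%:C.
have vu x : v x * u x = 1.
  rewrite /v mulrAC (_ : _ * u x = (q x)%:C).
    by rewrite -rmorphM /= divff// gt_eqF.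
  by apply: complex_eqP; rewrite ?cReM ?cImM /= /q; ring.
have mv : @cmeasurable _ (borel 'rV[R]_d) _ v.
  apply: cmeasurableM.
    by split; [exact: mu.1|apply: measurableT_comp => //; exact: mu.2].
  apply: cmeasurable_real; apply: measurable_fun_posV => //.
  by apply: measurable_funD; apply: measurable_funX; [exact: mu.1|exact: mu.2].
have vp x : normc (v x) <= p^-1.
  have e : normc (v x) * normc (u x) = 1 by rewrite -normcM vu Normc.normc1.
  have pu : p <= normc (u x) by apply: le_trans (u0 x) _; apply: le_trans (ler_norm _) (ler_norm_cRe _).
  rewrite -[leRHS]mul1r ler_pdivlMr// -e ler_wpM2l ?normc_ge0//.
have dK := dominated_weight dJ (@measurable_space R d) (admissible_resolvent p0).
have dE := @dominated_orthants0 _ (borel 'rV[R]_d) R _ (fun i (x : borel 'rV[R]_d) => x 0 i) (@measurable_coord R d)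
  (fun d' Y => @measurable_fun_rV R d' Y d) _ dK (resolvent_orthant p0).
have := dE (fun x => f x * v x) (K * p^-1) (cmeasurableM mf mv) _.
have h x : normc (f x * v x) <= K * p^-1 by rewrite normcM; apply: ler_pM; rewrite ?normc_ge0.
move=> /(_ h) <-; congr J; apply/funext => z; rewrite /resolvent_weight -/(u z.1).
transitivity ((v z.1 * u z.1) * (f z.1 * ((future z)%:C * (damping p z)%:C))).
  by rewrite vu mul1r.
by move: (v z.1) (u z.1) => v' u'; ring.
Qed.

(* The entire function [exp(- a e^(-n t))] is a series of the dampings already
   handled; with [a = n e^(n c)] it tends to the indicator of [t > c]. *)
Lemma dominated_ray (c : R) (f : borel 'rV[R]_d -> R[i]) (K : R) :
  cmeasurable f -> (forall x, normc (f x) <= K) ->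
  J (fun z : E => f z.1 * (\1_[set t : R | c < t] z.2)%:C * ((future z)%:C * (damping 1 z)%:C)) = 0.
Proof.
move=> mf fK; have K0 : 0 <= K := le_trans (normc_ge0 _) (fK 0).
have mf' : @cmeasurable _ (borel E) _ (fun z => f z.1) := cmeasurable_comp (@measurable_space R d) mf.
have mD p : @cmeasurable _ (borel E) R (fun z => (future z)%:C * (damping p z)%:C).
  by apply: cmeasurableM; [exact: cmeasurable_real measurable_future|exact: cmeasurable_real (measurable_damping p)].
have [C hC] : exists C, forall z : E, normc ((future z)%:C * (damping 1 z)%:C) <= C * wgt N z.
  apply: (@future_admissible 1 _ 1 0) => //; first exact: cmeasurable_real (measurable_damping 1).
  by move=> z z0; rewrite expr0 !mul1r normcR ger0_norm ?expR_ge0.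
have admp (p : R) : 0 < p -> adm (fun z : E => f z.1 * ((future z)%:C * (damping p z)%:C)).
  move=> p0; apply: (admissibleM (K := K)) => //; split => //.
  apply: (@future_admissible p _ 1 0) => //; first exact: cmeasurable_real (measurable_damping p).
  by move=> z z0; rewrite expr0 !mul1r normcR ger0_norm ?expR_ge0.
have bnd (h : E -> R[i]) (B : R) (z : E) : (0 <= z.2 -> normc (h z) <= B) -> 0 <= B ->
    normc (f z.1 * h z * ((future z)%:C * (damping 1 z)%:C)) <= K * B * C * wgt N z.
  move=> hB B0; have C0 : 0 <= C * wgt N z := le_trans (normc_ge0 _) (hC z).
  have -> : K * B * C * wgt N z = K * (B * (C * wgt N z)) by ring.
  rewrite normcM [normc (f _ * _)]normcM -mulrA; have [z0|z0] := leP 0 z.2.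
    apply: ler_pM; rewrite ?mulr_ge0 ?normc_ge0//; apply: ler_pM; rewrite ?normc_ge0//.
    exact: hB.
  rewrite [normc ((future z)%:C * _)]normcM normcR future_lt0// normr0 mul0r !mulr0.
  exact: mulr_ge0 K0 (mulr_ge0 B0 C0).
have step (a : R) n : 0 <= a ->
    J (fun z : E => f z.1 * (expR (- (a * expR (- (n%:R * z.2)))))%:C * ((future z)%:C * (damping 1 z)%:C)) = 0.
  move=> a0; pose S m (z : E) : R := series (exp_coeff (- (a * expR (- (n%:R * z.2))))) m.
  have mS m : measurable_fun setT (S m : borel E -> R).
    apply: measurable_sum => k; apply: measurable_funM => //; apply: measurable_funX.
    apply: measurableT_comp => //; apply: measurable_funM => //.
    apply: measurableT_comp; first exact: measurable_expR.
    by apply: measurableT_comp => //; apply: measurable_funM => //; exact: measurable_time.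
  apply: (@dominated_cvg0 _ _ _ _ _ dJ (fun m z => f z.1 * (S m z)%:C * ((future z)%:C * (damping 1 z)%:C)) _ (K * expR a * C)).
  - by move=> m; apply: cmeasurableM => //; apply: cmeasurableM => //; exact: cmeasurable_real.
  (* On [t >= 0] one has [exp(- n t) <= 1], so that all partial sums are bounded by [exp a]. *)
  - move=> m z; apply: (bnd (fun z => (S m z)%:C)); last exact: expR_ge0.
    move=> z0; rewrite normcR; set y := a * expR (- (n%:R * z.2)).
    have y0 : 0 <= y by rewrite mulr_ge0 ?expR_ge0.
    apply: (@le_trans _ _ (series (exp_coeff y) m)).
      rewrite /S /series /=; apply: le_trans (ler_norm_sum _ _ _) _; apply: ler_sum => k _.
      by rewrite /exp_coeff /= normrM normrX normrN (ger0_norm y0) ger0_norm// invr_ge0.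
    apply: (@le_trans _ _ (expR y)).
      apply: nondecreasing_cvgn_le; last exact: is_cvg_series_exp_coeff.
      by apply: nondecreasing_series => k _ _; rewrite /exp_coeff /= divr_ge0 ?exprn_ge0.
    by rewrite ler_expR /y -[leRHS]mulr1 ler_wpM2l// -expR0 ler_expR oppr_le0 mulr_ge0.
  - move=> z; apply: cvg_complexM; last exact: cvg_cst.
    apply: cvg_complexM; first exact: cvg_cst.
    by apply: cvg_rcomplex; exact: is_cvg_series_exp_coeff.
  (* [exp(- n t)^k] times [damping 1] is [damping (1 + k n)]; the summand 1 keeps the parameter
     positive also for [k n = 0]. *)
  - move=> m; pose F k (z : E) : R[i] := ((- a) ^+ k / k`!%:R)%:C *
      (f z.1 * ((future z)%:C * (damping (1 + k%:R * n%:R) z)%:C)).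
    have p0 k : 0 < 1 + k%:R * n%:R :> R by rewrite ltr_pwDl// mulr_ge0.
    have aF k : adm (F k) by apply: admissibleZ; exact: admp.
    have JF k : J (F k) = 0.
      by rewrite (dominatedZ dJ _ (admp _ (p0 k))) (dominated_damping (p0 k) mf fK) mulr0.
    have [_ <-] := dominated_sum0 dJ (index_iota 0 m) aF JF.
    congr J; apply/funext => z; rewrite /S /series /= rmorph_sum /= mulr_sumr mulr_suml.
    apply: eq_bigr => k _; rewrite /F /exp_coeff /=.
    have -> : damping (1 + k%:R * n%:R) z = expR (- (n%:R * z.2)) ^+ k * damping 1 z.
      by rewrite /damping -expRM_natl -expRD; congr expR; ring.
    by rewrite -mulNr exprMn !rmorphM /=; ring.
(* Then [a n exp(- (n+1) t) = (n+1) exp(- (n+1) (t - c))], which tends to 0 for [t > c] and is at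
   least [n+1] for [t <= c]. The prefactor settles the boundary case [t = c]. *)
pose a n : R := n.+1%:R * expR (n.+1%:R * c).
apply: (@dominated_cvg0 _ _ _ _ _ dJ (fun n z => f z.1 * (expR (- (a n * expR (- (n.+1%:R * z.2)))))%:C *
   ((future z)%:C * (damping 1 z)%:C)) _ (K * 1 * C)).
- move=> n; apply: cmeasurableM => //; apply: cmeasurableM => //; apply: cmeasurable_real.
  apply: measurableT_comp; first exact: measurable_expR.
  apply: measurableT_comp => //; apply: measurable_funM => //.
  apply: measurableT_comp; first exact: measurable_expR.
  by apply: measurableT_comp => //; apply: measurable_funM => //; exact: measurable_time.
- move=> n z; apply: (bnd (fun z => (expR (- (a n * expR (- (n.+1%:R * z.2)))))%:C)) => // z0; rewrite normcR ger0_norm ?expR_ge0// -expR0 ler_expR.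
  by rewrite oppr_le0 mulr_ge0 ?expR_ge0// mulr_ge0 ?expR_ge0.
- move=> z; apply: cvg_complexM; last exact: cvg_cst.
  apply: cvg_complexM; first exact: cvg_cst.
  apply: cvg_rcomplex; rewrite indicE.
  have aE n : a n * expR (- (n.+1%:R * z.2)) = n.+1%:R * expR (- ((z.2 - c) * n.+1%:R)).
    by rewrite /a -mulrA -expRD; congr (_ * expR _); ring.
  under eq_fun do rewrite aE.
  case: (boolP (z.2 \in _)) => [/set_mem /= cz|/negP cz].
    have h : expR (- (n.+1%:R * expR (- ((z.2 - c) * n.+1%:R)))) @[n --> \oo] --> expR (- 0 : R).
      apply: continuous_cvg; first exact: continuous_expR.
      by apply: cvgN; apply: cvg_nat_exp; rewrite subr_gt0.
    by rewrite oppr0 expR0 in h; exact: h.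
  have zc : z.2 <= c by rewrite leNgt; apply/negP => h; apply: cz; rewrite inE.
  apply: (squeeze_cvgr _ (cvg_cst 0) (@cvg_expN_nat R)).
  apply: nearW => n; rewrite expR_ge0/= ler_expR lerN2 ler_peMr//.
  by rewrite -[leLHS]expR0 ler_expR -mulNr mulr_ge0// opprB subr_ge0.
- by move=> n; apply: step; rewrite mulr_ge0 ?expR_ge0.
Qed.

(** The weight is [damping 1] at [(x, |t|)]: positive and admissible on all of space-time, and equal
    to [damping 1] on [t >= 0]. An orthant of space-time is an orthant in space times a ray in time,
    so that [dominated_ray] applies to the indicator of the former. *)
Theorem evolution_unique f : adm f -> J f = 0.
Proof.
have [C hC] : exists C, forall z : E, normc ((damping 1 (z.1, `|z.2|))%:C) <= C * wgt N z.
  have [C [C0 hC]] := damping_le N (@ltr01 R); exists C => z.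
  rewrite normcR ger0_norm ?expR_ge0//; apply: le_trans (hC (z.1, `|z.2|) (normr_ge0 _)) _.
  by rewrite /wgt /sqnorm /= real_normK ?num_real.
have mw : measurable_fun setT (fun z : borel E => damping 1 (z.1, `|z.2|) : R).
  have mp : measurable_fun setT (fun z : borel E => (z.1, `|z.2|) : borel E).
    apply: measurable_fun_spacetime => [i|] /=; first exact: measurable_fst_coord.
    by apply: measurableT_comp => //; exact: measurable_time.
  exact: measurableT_comp (measurable_damping 1) mp.
have aw : adm (fun z => (damping 1 (z.1, `|z.2|))%:C).
  by split; [exact: cmeasurable_real|exists C].
apply: (@dominated_positive_weight _ _ _ _ _ dJ (fun z : E => damping 1 (z.1, `|z.2|))) => //.
  by move=> z; exact: expR_gt0.
have af : adm (fun z => (future z)%:C * (damping 1 (z.1, `|z.2|))%:C).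
  apply: (admissibleM (K := 1)) => //; first exact: cmeasurable_real measurable_future.
  by move=> z; rewrite normcR futureE; case: (0 <= _); rewrite ?normr0 ?normr1.
have dK := dominated_weight dJ (@measurable_id _ (borel E) setT) af.
move=> k K mk kK.
have ak : adm (fun z => k z * (damping 1 (z.1, `|z.2|))%:C) by apply: (admissibleM (K := K)).
rewrite -(dominated_future0 ak).
rewrite (_ : (fun z => _) = (fun z : borel E => k z * ((future z)%:C * (damping 1 (z.1, `|z.2|))%:C))); last first.
  by apply/funext => z; rewrite mulrCA.
apply: (@dominated_orthants0 _ (borel E) R _ (@coordinate R d) (@measurable_coordinate R d)
  (fun d' Y => @measurable_fun_coordinate R d d' Y) _ dK _ k K mk kK) => c.
pose o : set (borel 'rV[R]_d) := orthant (fun i (x : borel 'rV[R]_d) => x 0 i) (fun i => c (Some i)).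
have mo : measurable o.
  exact: (@measurable_orthant _ (borel 'rV[R]_d) R _ (fun i (x : borel 'rV[R]_d) => x 0 i) (@measurable_coord R d)
    (fun d' Y => @measurable_fun_rV R d' Y d)).
have := @dominated_ray (c None) (fun x => (\1_o x : R)%:C) 1 _ _.
move=> <-; last 2 first.
- by apply: cmeasurable_real; exact: measurable_indic.
- by move=> x; rewrite normcR indicE ger0_norm//; case: (_ \in _).
congr J; apply/funext => z.
have [z0|z0] := leP 0 z.2; last by rewrite future_lt0// !mul0r !mulr0.
rewrite (_ : (z.1, `|z.2|) = z); last by rewrite ger0_norm// -surjective_pairing.
rewrite -[X in _ = X * _]rmorphM /=; congr (_%:C * _).
rewrite !indicE -natrM mulnb; congr (nat_of_bool _)%:R.
apply/idP/idP => [/set_mem h|/andP[/set_mem h1 /set_mem h2]].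
  by apply/andP; split; apply/mem_set; [move=> i; exact: (h (Some i))|exact: (h None)].
by apply/mem_set => -[i|]; [exact: h1|exact: h2].
Qed.

End EvolutionUniqueness.

(** * Fourier transforms of measures *)

Section MeasureFunctionals.
Context (R : realType) (d : nat).
Local Notation E := (spacetime R d).
Implicit Types (f : E -> R[i]) (mu : set E -> R[i]).
Local Notation adm N := (@admissible _ (borel E) R (wgt N)).
Local Notation dominated N J := (@dominated_functional _ (borel E) R (wgt N) J).

(** Continuity for the Schwartz seminorms is read off from this uniform bound; dominated convergence
    alone is sequential. *)
Definition bounded_functional N (J : (E -> R[i]) -> R[i]) :=
  exists K : R, forall f (C : R), @cmeasurable _ (borel E) _ f ->
    (forall z, normc (f z) <= C * wgt N z) -> normc (J f) <= K * C.

Lemma admissible_le N N' f : (N <= N')%N -> adm N' f -> adm N f.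
Proof.
move=> NN' [mf [C fC]]; split => //; exists C => z; apply: le_trans (fC z) _.
have C0 : 0 <= C by have := le_trans (normc_ge0 _) (fC z); rewrite pmulr_lge0 ?wgt_gt0.
by rewrite ler_wpM2l// le_wgt.
Qed.

Lemma dominatedB N J J' : dominated N J -> dominated N J' -> dominated N (fun f => J f - J' f).
Proof.
move=> [l1 c1] [l2 c2]; split=> [a f g af ag|F f C mF FC Ff].
  by rewrite l1// l2//; ring.
apply: cvg_complexD; first exact: (c1 F f C).
have hm : (fun _ : nat => -1 : R[i]) @ \oo --> (-1 : R[i]) by exact: cvg_cst.
have h := cvg_complexM hm (c2 F f C mF FC Ff); rewrite mulN1r in h.
rewrite (_ : (fun n => - J' (F n)) = fun n => -1 * J' (F n)); first exact: h.
by apply/funext => n; rewrite mulN1r.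
Qed.

Lemma admissible_cvg N (F : nat -> E -> R[i]) f (C : R) :
  (forall n, @cmeasurable _ (borel E) _ (F n)) ->
  (forall n z, normc (F n z) <= C * wgt N z) ->
  (forall z, F n z @[n --> \oo] --> f z) -> adm N f.
Proof.
move=> mF FC Ff; split; first exact: (@cmeasurable_cvg _ (borel E) _ F).
exists C => z; rewrite normcE.
have hr : complex.Re (F n z) @[n --> \oo] --> complex.Re (f z) by exact: cvg_cRe (Ff z).
have hi : complex.Im (F n z) @[n --> \oo] --> complex.Im (f z) by exact: cvg_cIm (Ff z).
have h : normc (F n z) @[n --> \oo] --> Num.sqrt (complex.Re (f z) ^+ 2 + complex.Im (f z) ^+ 2).
  under eq_fun do rewrite normcE.
  apply: continuous_cvg; first exact: sqrt_continuous.
  by apply: cvgD; rewrite expr2; under eq_fun do rewrite expr2; exact: cvgM.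
rewrite -(cvg_lim (@Rhausdorff R) h); apply: limr_le; first by apply/cvg_ex; eexists; exact: h.
by apply: nearW => n; exact: FC.
Qed.

(** Agreement on admissible functions suffices, as the limit in dominated convergence is itself
    admissible. *)
Lemma dominated_ext N J J' : dominated N J -> (forall f, adm N f -> J' f = J f) -> dominated N J'.
Proof.
move=> dJ e; split=> [a f g af ag|F f C mF FC Ff].
  rewrite !e//; first exact: dJ.1.
  by apply: admissibleD => //; exact: admissibleZ.
rewrite e; last exact: (@admissible_cvg N F f C).
rewrite (_ : (fun n => _) = fun n => J (F n)); first exact: (dJ.2 F f C).
by apply/funext => n; rewrite e//; split => //; exists C.
Qed.

Section Representation.
Context d' (T : measurableType d') (m : {measure set T -> \bar R}).
Context (p : T -> borel E) (h : T -> R[i]).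

Lemma weighted_density_le N N' : (N <= N')%N ->
  weighted_density m p h N -> weighted_density m p h N'.
Proof.
move=> NN' [mp mh ih]; split => //; apply: (integrable_le _ ih).
  apply: measurable_funM; first exact: measurable_normc.
  exact: measurableT_comp (measurable_wgt N') mp.
move=> x; rewrite ger0_norm ?mulr_ge0 ?normc_ge0 ?wgt_ge0//.
by rewrite ler_wpM2l ?normc_ge0// le_wgt.
Qed.

Context N (wd : weighted_density m p h N).

Lemma cint_rep_bound f (C : R) : @cmeasurable _ (borel E) _ f ->
  (forall z, normc (f z) <= C * wgt N z) ->
  normc (cint m (fun x => h x * f (p x))) <= 2 * (\int[m]_x (normc (h x) * wgt N (p x))) * C.
Proof.
move=> mf fC; have [_ _ ih] := wd.
have ihC : m.-integrable setT (EFin \o (fun x => C * (normc (h x) * wgt N (p x)))).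
  by rewrite /comp; under eq_fun do rewrite EFinM; exact: integrableZl.
apply: (le_trans (normc_cint_le (cintegrable_rep wd mf fC) ihC _)).
  by move=> x; rewrite normcM mulrCA ler_wpM2l ?normc_ge0.
by rewrite RintegralZl// -mulrA [C * _]mulrC mulrA.
Qed.

Lemma cint_rep_dominated : dominated N (fun f => cint m (fun x => h x * f (p x))).
Proof.
have [mp mh ih] := wd; split=> [a f g [mf [C fC]] [mg [D gD]]|F f C mF FC Ff].
  have i1 := cintegrable_rep wd mf fC; have i2 := cintegrable_rep wd mg gD.
  rewrite -cintZ// -cintD//; last exact: cintegrableZ.
  by congr (cint m _); apply/funext => x; ring.
apply: (@cvg_cint _ _ _ m (fun n x => h x * F n (p x)) _ (fun x => C * (normc (h x) * wgt N (p x)))).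
- by move=> n; apply: cmeasurableM => //; exact: (cmeasurable_comp mp (mF n)).
- by move=> x; apply: cvg_complexM; [exact: cvg_cst|exact: Ff].
- by rewrite /comp; under eq_fun do rewrite EFinM; exact: integrableZl.
- by move=> n x; rewrite normcM mulrCA ler_wpM2l ?normc_ge0.
Qed.

End Representation.

(** All large orders are allowed, so that several measures can be compared at a common one. *)
Lemma slow_growing_dominated mu : slow_growing mu -> exists N0, forall N, (N0 <= N)%N ->
  dominated N (radon_integral mu setT) /\ bounded_functional N (radon_integral mu setT).
Proof.
move=> sg; have [m [h [N0 [wd rep _]]]] := slow_growing_rep sg; exists N0 => N N0N.
have wdN := weighted_density_le N0N wd.
have repN f : adm N f -> radon_integral mu setT f = cint m (fun x => h x * f x.1.1).
  by move=> /(admissible_le N0N)[mf [C fC]]; exact: rep fC.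
split; first exact: dominated_ext (cint_rep_dominated wdN) repN.
exists (2 * (\int[m]_x (normc (h x) * wgt N x.1.1))) => f C mf fC.
rewrite repN; first exact: (cint_rep_bound wdN).
by split => //; exists C.
Qed.

Lemma slow_growing_pos_future mu : slow_growing_pos mu -> exists N0, forall N, (N0 <= N)%N ->
  forall f, adm N f -> (forall z, 0 <= z.2 -> f z = 0) -> radon_integral mu setT f = 0.
Proof.
move=> sg; have [m [p [h [N0 [wd p0 rep]]]]] := slow_growing_pos_rep sg; exists N0 => N N0N.
move=> f /(admissible_le N0N)[mf [C fC]] f0; rewrite (rep f C)//.
rewrite (_ : (fun x => _) = fun=> 0); last by apply/funext => x; rewrite f0 ?mulr0.
by apply: complex_eqP => /=; rewrite /Rintegral integral0.
Qed.

(** In the representation the density [h] becomes [h g]; the order rises by the growth exponent [M]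
    of the symbol. *)
Lemma slow_growing_mul (g : 'rV[R]_d -> R[i]) (c : R) (M : nat) mu :
  @cmeasurable _ (borel 'rV[R]_d) _ g ->
  (forall x, normc (g x) <= c * (1 + sqnorm_space x) ^+ M) -> slow_growing mu ->
  slow_growing (mul_measure g mu) /\
  exists N0, forall N, (N0 <= N)%N -> forall f, adm (N + M) f ->
    radon_integral (mul_measure g mu) setT f = radon_integral mu setT (fun z => g z.1 * f z).
Proof.
move=> mg gM sg; have [m [h [N0 [wd rep _]]]] := slow_growing_rep sg.
have [mp mh ih] := wd.
have mg' : @cmeasurable _ (borel E) _ (fun z => g z.1) := cmeasurable_comp (@measurable_space R d) mg.
have gN z : normc (g z.1) * wgt (N0 + M) z <= c * wgt N0 z.
  exact: growth_wgt.
have gf f (C : R) z : normc (f z) <= C * wgt (N0 + M) z -> normc (g z.1 * f z) <= C * c * wgt N0 z.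
  move=> fC; have C0 : 0 <= C.
    by have := le_trans (normc_ge0 _) fC; rewrite pmulr_lge0 ?wgt_gt0.
  rewrite normcM -[leRHS]mulrA; apply: le_trans (ler_wpM2l C0 (gN z)).
  by rewrite mulrCA ler_wpM2l ?normc_ge0.
have wd' : weighted_density m (fun x => x.1.1) (fun x => h x * g x.1.1.1) (N0 + M).
  split => //; first by apply: cmeasurableM => //; exact: (cmeasurable_comp mp mg').
  have ihc : m.-integrable setT (EFin \o (fun x => c * (normc (h x) * wgt N0 x.1.1))).
    by rewrite /comp; under eq_fun do rewrite EFinM; exact: integrableZl.
  apply: (integrable_le _ ihc).
    apply: measurable_funM; last exact: measurableT_comp (measurable_wgt _) mp.
    by apply: measurable_normc; apply: cmeasurableM => //; exact: (cmeasurable_comp mp mg').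
  move=> x; rewrite ger0_norm ?mulr_ge0 ?normc_ge0 ?wgt_ge0//.
  by rewrite normcM -mulrA [leRHS]mulrCA; apply: ler_wpM2l; [exact: normc_ge0|exact: gN].
have dr : density_rep m (fun x => x.1.1) (fun x => h x * g x.1.1.1) (mul_measure g mu).
  move=> A bA; rewrite /mul_measure radon_integral_restrict.
  have [C hC] := indic_le_wgt (N0 + M) bA.2.
  rewrite (rep _ (C * c)).
  - by congr (cint m _); apply/funext => x; rewrite mulrA.
  - by apply: cmeasurableM => //; apply: cmeasurable_indic; exact: bA.1.
  - by move=> z; apply: (gf (fun z => (\1_A z : R)%:C)); rewrite normcR.
have sgm := density_rep_slow_growing wd' dr.
split => //.
exists N0 => N N0N f /(admissible_le (leq_add N0N (leqnn M)))[mf [C fC]].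
rewrite (radon_integral_rep wd' dr mf fC) (rep _ (C * c)).
- by congr (cint m _); apply/funext => x; rewrite mulrA.
- exact: cmeasurableM.
- by move=> z; exact: gf.
Qed.

(** By Fourier inversion, composition with this map is the square of the spatial transform on
    Schwartz functions. *)
Definition reflect_space (z : E) : E := (- z.1, z.2).

Lemma measurable_reflect_space : measurable_fun setT (reflect_space : borel E -> borel E).
Proof.
apply: measurable_fun_spacetime => [i|] /=; last exact: measurable_time.
by under eq_fun do rewrite mxE; apply: measurableT_comp => //; exact: measurable_fst_coord.
Qed.

Lemma wgt_reflect_space N z : wgt N (reflect_space z) = wgt N z.
Proof.
by rewrite /wgt /sqnorm /sqnorm_space /=; under eq_bigr do rewrite mxE sqrrN.
Qed.

Lemma slow_growing_reflect mu : slow_growing mu -> exists2 mu', slow_growing mu' &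
  exists N0, forall N, (N0 <= N)%N -> forall f, adm N f ->
    radon_integral mu' setT f = radon_integral mu setT (f \o reflect_space).
Proof.
move=> sg; have [m [h [N0 [[mp mh ih] rep _]]]] := slow_growing_rep sg.
have wd : weighted_density m (fun x => reflect_space x.1.1 : borel E) h N0.
  split => //; first exact: measurableT_comp measurable_reflect_space mp.
  by rewrite (_ : EFin \o _ = EFin \o (fun x => normc (h x) * wgt N0 x.1.1))//; apply/funext => x /=; rewrite wgt_reflect_space.
pose mu' A := cint m (fun x => h x * (\1_A (reflect_space x.1.1))%:C).
have dr : density_rep m (fun x => reflect_space x.1.1 : borel E) h mu' by [].
have sg' := density_rep_slow_growing wd dr.
exists mu' => //.
exists N0 => N N0N f /(admissible_le N0N)[mf [C fC]].
rewrite (radon_integral_rep wd dr mf fC) (rep (f \o reflect_space) C)//.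
  exact: (cmeasurable_comp measurable_reflect_space mf).
by move=> z; have := fC (reflect_space z); rewrite wgt_reflect_space.
Qed.

Lemma admissible_reflect N f : adm N f -> adm N (f \o reflect_space).
Proof.
move=> [mf [C fC]]; split; first exact: (cmeasurable_comp measurable_reflect_space mf).
by exists C => z; have := fC (reflect_space z); rewrite wgt_reflect_space.
Qed.

(** So the third power of the transform inverts it on Schwartz functions, and every Schwartz
    function is a transform. *)
Lemma fourier4 (psi : E -> R[i]) : schwartz psi ->
  fourier_space (fourier_space (fourier_space (fourier_space psi))) = psi.
Proof.
move=> sp; rewrite fourier_inversion; last by do 2 apply: fourier_schwartz.
apply/funext => z; rewrite fourier_inversion//=.
by rewrite opprK -surjective_pairing.
Qed.

Lemma fourier_spaceB (f g : E -> R[i]) : schwartz f -> schwartz g ->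
  fourier_space (fun z => f z - g z) = (fun z => fourier_space f z - fourier_space g z).
Proof.
move=> sf sg; rewrite (_ : (fun z => f z - g z) = (fun z => f z + -1 * g z)).
  rewrite fourier_spaceD//; last exact: schwartzZ.
  by rewrite fourier_spaceZ//; apply/funext => z; rewrite mulN1r.
by apply/funext => z; rewrite mulN1r.
Qed.

(** Serves with [rho] the identity for the transform of a measure, and with [rho] the reflection for
    the inverse transform. *)
Lemma tempered_fourier N J (rho : E -> E) :
  measurable_fun setT (rho : borel E -> borel E) -> (forall z, wgt N (rho z) = wgt N z) ->
  dominated N J -> bounded_functional N J ->
  tempered (fun psi => J (fourier_space psi \o rho)).
Proof.
move=> mr wr dJ [K JK].
have adF psi : schwartz psi -> adm N (fourier_space psi \o rho).
  move=> sp; have [m [C hC]] := schwartz_admissible N (fourier_schwartz sp).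
  split; first exact: (cmeasurable_comp mr m).
  by exists C => z; have := hC (rho z); rewrite wr.
split=> [a phi psi sphi spsi|phi sphi e e0].
  rewrite fourier_spaceD//; last exact: schwartzZ.
  by rewrite fourier_spaceZ// -dJ.1//; exact: adF.
have [K' [C [C0 hC]]] := fourier_space_seminorm R d N.
have D0 : 0 < `|K| * C + 1 by rewrite ltr_wpDl ?mulr_ge0.
exists K', (e / (`|K| * C + 1)); split; first by rewrite divr_gt0.
move=> psi spsi hpsi.
have sB := schwartzB spsi sphi.
have -> : J (fourier_space psi \o rho) - J (fourier_space phi \o rho) =
    J (fourier_space (fun z => psi z - phi z) \o rho).
  rewrite fourier_spaceB//.
  have := dJ.1 (-1) _ _ (adF _ sphi) (adF _ spsi); rewrite mulN1r [RHS]addrC => <-.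
  by congr J; apply/funext => z /=; rewrite mulN1r addrC.
have bF z : normc ((fourier_space (fun z => psi z - phi z) \o rho) z) <= C * (e / (`|K| * C + 1)) * wgt N z.
  have h := hC _ _ sB hpsi (rho z).
  by rewrite -wr /wgt ler_pdivlMr ?exprn_gt0 ?sqnorm1_gt0// mulrC.
have [mF _] := adF _ sB.
have KC : K * C <= `|K| * C + 1.
  by apply: (@le_trans _ _ (`|K| * C)); [rewrite ler_wpM2r ?ler_norm|rewrite lerDl].
apply: le_trans (JK _ _ mF bF) _; rewrite mulrA mulrA ler_pdivrMr// mulrC.
by apply: ler_wpM2l => //; exact: ltW.
Qed.

(** As [U] is the transform of [mu], its own transform is the reflected measure, so that the choice
    in [measure_of_distr] has a candidate. Density of Schwartz functions then identifies the chosen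
    measure on all admissible functions. *)
Lemma measure_of_fourier_distr U mu : slow_growing mu ->
  eq_distr U (fourier_distr (distr_of_measure mu)) ->
  slow_growing (measure_of_distr (fourier_distr U)) /\
  exists N0, forall N, (N0 <= N)%N -> forall f, adm N f ->
    radon_integral (measure_of_distr (fourier_distr U)) setT f =
    radon_integral mu setT (f \o reflect_space).
Proof.
move=> sg UE.
have FU psi : schwartz psi -> fourier_distr U psi = radon_integral mu setT (psi \o reflect_space).
  move=> sp; rewrite /fourier_distr UE; last exact: fourier_schwartz.
  by rewrite /fourier_distr /distr_of_measure fourier_inversion.
have [sg' mE] : [set nu | slow_growing nu /\ eq_distr (fourier_distr U) (distr_of_measure nu)]
    (measure_of_distr (fourier_distr U)).
  apply: getPex; have [nu sgnu [N0 nuE]] := slow_growing_reflect sg.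
  exists nu; split => // psi sp; rewrite FU// /distr_of_measure (nuE N0)//.
  exact: schwartz_admissible.
split => //; have [N1 h1] := slow_growing_dominated sg'.
have [N2 h2] := slow_growing_dominated sg.
exists (maxn N1 N2) => N; rewrite geq_max => /andP[/h1[d1 _] /h2[d2 _]] f af.
have d2' : dominated N (fun f => radon_integral mu setT (f \o reflect_space)).
  split=> [a f1 f2 a1 a2|F f0 C mF FC Ff].
    by rewrite -d2.1; [|exact: admissible_reflect|exact: admissible_reflect].
  apply: (d2.2 (fun n => F n \o reflect_space) (f0 \o reflect_space) C).
  - by move=> n; exact: (cmeasurable_comp measurable_reflect_space (mF n)).
  - by move=> n z; rewrite -wgt_reflect_space; exact: FC.
  - by move=> z; exact: Ff.
have := schwartz_dense (dominatedB d1 d2') _ af.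
move=> /(_ _)/wrap[]; last by move=> /eqP; rewrite subr_eq0 => /eqP.
move=> chi sc; apply/eqP; rewrite subr_eq0 -FU//; apply/eqP.
by rewrite mE.
Qed.

(** * The operator on Fourier transforms of measures *)

Section Operator.
Context (g : 'rV[R]_d -> R[i]) (mg : @cmeasurable _ (borel 'rV[R]_d) _ g).
Context (c : R) (M : nat) (gM : forall x, normc (g x) <= c * (1 + sqnorm_space x) ^+ M).

(** The symbol appears at [- xi] because [U] is the transform, not the inverse transform, of [mu]:
    the measure of [F_S U] is the reflection of [mu]. *)
Lemma LopE U mu : slow_growing mu -> eq_distr U (fourier_distr (distr_of_measure mu)) ->
  forall psi, schwartz psi ->
    Lop g U psi = radon_integral mu setT (fun z => g (- z.1) * fourier_space psi z).
Proof.
move=> sg UE psi sp.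
have [sg' [N1 h1]] := measure_of_fourier_distr sg UE.
rewrite /Lop; set mu' := measure_of_distr _ in sg' h1 *.
have [sgm [N2 h2]] := slow_growing_mul mg gM sg'.
have [N3 h3] := slow_growing_dominated sgm.
have [_ WE] : [set W | tempered W /\ eq_distr (fourier_distr W) (distr_of_measure (mul_measure g mu'))]
    (inv_fourier_distr (distr_of_measure (mul_measure g mu'))).
  (* A preimage under the transform: on test functions, [F_S] followed by the reflection is the
     inverse of [F_S]. *)
  apply: getPex; exists (fun psi => radon_integral (mul_measure g mu') setT (fourier_space psi \o reflect_space)).
  split.
    have [d3 b3] := h3 N3 (leqnn _).
    exact: tempered_fourier measurable_reflect_space (@wgt_reflect_space N3) d3 b3.
  move=> phi sphi; rewrite /fourier_distr /distr_of_measure; congr radon_integral.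
  apply/funext => z /=; rewrite fourier_inversion//=.
  by case: z => x t /=; rewrite opprK.
(* The test function whose transform is [psi], so that the defining property of the preimage gives
   its value at [psi]. *)
pose phi := fourier_space (fourier_space (fourier_space psi)).
have sphi : schwartz phi by do 3 apply: fourier_schwartz.
have := WE phi sphi; rewrite {1}/fourier_distr fourier4// => ->.
pose N := maxn N1 N2.
rewrite /distr_of_measure (h2 N); last 2 first.
- exact: leq_maxr.
- exact: schwartz_admissible.
rewrite (h1 N); last 2 first.
- exact: leq_maxl.
- by apply: (admissible_growth mg gM); exact: schwartz_admissible.
congr radon_integral; apply/funext => z /=; congr (_ * _).
rewrite /phi fourier_inversion; last exact: fourier_schwartz.
by rewrite opprK -surjective_pairing.
Qed.

End Operator.

End MeasureFunctionals.

(** * Existence *)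

Section HalfLine.
Context (R : realType).
Local Notation mu := (@lebesgue_measure R).

(** The fundamental theorem of calculus on [[0, n+1]], then dominated convergence; hence a limit of
    [G] along the integers suffices. *)
Lemma integral_halfline_derive (G G' : R -> R) :
  (forall r, is_derive r (1 : R) G (G' r)) -> continuous G' ->
  G n%:R @[n --> \oo] --> (0 : R) ->
  mu.-integrable setT (EFin \o (fun r => \1_[set r : R | 0 <= r] r * G' r)) ->
  \int[mu]_r (\1_[set r : R | 0 <= r] r * G' r) = - G 0.
Proof.
move=> dG cG' G0 iG'.
have mG' : measurable_fun setT G' by exact: continuous_measurable_fun.
have cG : continuous G.
  by move=> s; apply: differentiable_continuous; apply/derivable1_diffP; have [] := dG s.
pose F n (r : R) := \1_(`[0, n.+1%:R]%classic : set R) r * G' r.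
have FE n : \int[mu]_r F n r = G n.+1%:R - G 0.
  have n0 : (0 : R) < n.+1%:R by [].
  have h := @continuous_FTC2 R G' G 0 n.+1%:R n0 _ _ _.
  have e : (\int[mu]_(x in `[0%R, n.+1%:R]) (G' x)%:E = (G n.+1%:R)%:E - (G 0)%:E)%E.
    apply: h.
    - exact: continuous_subspaceT.
    - split.
      + by move=> x _; have [] := dG x.
      + by apply: cvg_at_right_filter; exact: cG.
      + by apply: cvg_at_left_filter; exact: cG.
    - by move=> x _; rewrite derive1E; exact: (@derive_val _ _ _ _ _ _ _ (dG x)).
  rewrite /Rintegral (_ : (\int[mu]_r (F n r)%:E)%E = (\int[mu]_(x in `[0%R, n.+1%:R]) (G' x)%:E)%E).
    by rewrite e.
  rewrite [in RHS]integral_mkcond; apply: eq_integral => r _.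
  rewrite /F patchE indicE; case: ifPn => _; by rewrite ?mul1r ?mul0r.
have c1 : \int[mu]_r F n r @[n --> \oo] --> \int[mu]_r (\1_[set r : R | 0 <= r] r * G' r).
  apply: (@cvg_Rintegral _ _ _ mu F _ (fun r => `|\1_[set r : R | 0 <= r] r * G' r|)).
  - move=> n; apply: measurable_funM => //; apply: measurable_indic; exact: measurable_itv.
  - move=> r; apply: cvg_near_cst; exists (Num.trunc `|r|).+1 => // n /= hn; congr (_ * _).
    rewrite !indicE; congr (nat_of_bool _)%:R; apply/idP/idP; rewrite !inE /= in_itv /=.
      by case/andP.
    move=> r0; rewrite r0 /=; apply: le_trans (ler_norm _) _; apply: ltW.
    by apply: (lt_le_trans (truncnS_gt _)); rewrite ler_nat; exact: leqW.
  - exact: integrable_norm.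
  - move=> n r; rewrite !normrM ler_wpM2r// !indicE !ger0_norm// ler_nat.
    case: (boolP (r \in _)) => //; rewrite inE /= in_itv /= => /andP[r0 _].
    by rewrite mem_set.
have c2 : \int[mu]_r F n r @[n --> \oo] --> 0 - G 0.
  under eq_fun do rewrite FE; apply: cvgB; last exact: cvg_cst.
  by rewrite (cvg_shiftS (fun n => G n%:R)).
by rewrite -sub0r -(cvg_lim (@Rhausdorff R) c1) (cvg_lim (@Rhausdorff R) c2).
Qed.

End HalfLine.

Lemma integrable_oneDsqrV (R : realType) (c : R) :
  (@lebesgue_measure R).-integrable setT (EFin \o (fun r => c * (1 + r ^+ 2)^-1)).
Proof.
rewrite /comp; under eq_fun do rewrite EFinM; apply: integrableZl => //.
have p0 (r : R) : 0 < 1 + r ^+ 2 by rewrite ltr_pwDl// sqr_ge0.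
apply/integrableP; split.
  apply/measurable_EFinP; apply: measurable_fun_posV => //.
  by apply: measurable_funD => //; exact: measurable_funX.
under eq_integral => r _ do rewrite /= ger0_norm ?invr_ge0 ?(ltW (p0 r))//.
by rewrite integralT_oneDsqrV ltry.
Qed.

(** * Propagation along half-lines *)

Section Duhamel.
Context (R : realType) (d : nat).
Local Notation E := (spacetime R d).
Local Notation mu := (@lebesgue_measure R).

(** The function [exp(- a r)] for complex [a], solution of [y' = - a y] with value 1 at 0. *)
Definition cexp (a : R[i]) (r : R) : R[i] :=
  (expR (- (complex.Re a * r)))%:C * expi (- (complex.Im a * r)).

Lemma cder_cexp a r : cder (cexp a) r (- a * cexp a r).
Proof.
have h0 := is_derive_affine (- complex.Re a) 0 r.
have h1 := cder_real (is_derive_chain (is_derive_expR _) h0).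
have h2 := cder_expi (- complex.Im a) 0 r.
have := cderM h1 h2; congr cder.
  by apply/funext => u; rewrite /cexp !addr0 !mulrN ![u * _]mulrC.
rewrite /cexp !addr0 !mulrN ![r * _]mulrC.
by apply: complex_eqP; rewrite ?cReD ?cImD ?cReM ?cImM ?cReN ?cImN /=; ring.
Qed.

Lemma cexp0 a : cexp a 0 = 1.
Proof. by rewrite /cexp !mulr0 oppr0 expR0 expi0 mulr1. Qed.

Lemma normc_cexp_le1 a r : 0 <= complex.Re a -> 0 <= r -> normc (cexp a r) <= 1.
Proof.
move=> a0 r0; rewrite normcM normc_expi mulr1 normcR ger0_norm ?expR_ge0//.
by rewrite -expR0 ler_expR oppr_le0 mulr_ge0.
Qed.

Local Notation nneg := (\1_[set r : R | 0 <= r] : R -> R).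

Lemma measurable_nneg : measurable_fun setT nneg.
Proof.
apply: measurable_indic; rewrite (_ : [set r : R | 0 <= r] = `[0, +oo[%classic); first exact: measurable_itv.
by apply/seteqP; split=> r /=; rewrite in_itv /= andbT.
Qed.

Lemma nneg_lt0 r : r < 0 -> nneg r = 0.
Proof. by move=> r0; rewrite indicE memNset//= leNgt r0. Qed.

Lemma nneg_ge0 r : 0 <= r -> nneg r = 1.
Proof. by move=> r0; rewrite indicE mem_set. Qed.

Section HalfLineTest.
Context (a : R[i]) (a0 : 0 <= complex.Re a) (xi : 'rV[R]_d) (s : R) (s0 : 0 <= s).

Definition damped_line (psi : E -> R[i]) (r : R) : R[i] := cexp a r * psi (xi, r + s).

Lemma cder_damped_line psi r : schwartz psi ->
  cder (damped_line psi) r (damped_line (fun z => pderiv None psi z - a * psi z) r).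
Proof.
move=> sp; have c1 := pd_curve (xi, s) r (schwartz_pd None sp).
have := cderM (cder_cexp a r) c1; congr cder.
  by apply/funext => u; rewrite direction_None.
by rewrite /damped_line direction_None; ring.
Qed.

Lemma continuous_damped_line psi : schwartz psi ->
  continuous (cRe \o damped_line psi) /\ continuous (cIm \o damped_line psi).
Proof.
move=> sp; split=> r; apply: differentiable_continuous; apply/derivable1_diffP.
  by have [[]] := cder_damped_line r sp.
by have [_ []] := cder_damped_line r sp.
Qed.

(** For [r, s >= 0] the decay of [psi] at time [r + s] is at least that at time [r], and the
    exponential is bounded by 1 as [Re a >= 0]. *)
Lemma damped_line_bound psi : schwartz psi ->
  exists C : R, forall r, 0 <= r -> normc (damped_line psi r) <= C * (1 + r ^+ 2)^-1.
Proof.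
move=> sp; have [C hC] := decay_wgt 1 (schwartz_decay sp); exists C => r r0.
have C0 : 0 <= C by have := le_trans (normc_ge0 _) (hC 0); rewrite pmulr_lge0 ?wgt_gt0.
rewrite /damped_line normcM -[leRHS]mul1r; apply: ler_pM; rewrite ?normc_ge0 ?normc_cexp_le1//.
apply: le_trans (hC _) _; rewrite ler_wpM2l// /wgt expr1 lef_pV2 ?posrE ?sqnorm1_gt0//; last first.
  by rewrite ltr_pwDl// sqr_ge0.
rewrite lerD2l; apply: le_trans (sqr_time_le_sqnorm (xi, r + s)) => /=.
by apply: lerXn2r; rewrite ?nnegrE ?addr_ge0// lerDl.
Qed.

Lemma cmeasurable_damped_line psi : schwartz psi -> @cmeasurable _ (measurableTypeR R) R (damped_line psi).
Proof.
by move=> /continuous_damped_line[c1 c2]; split; exact: continuous_measurable_fun.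
Qed.

Lemma integrable_damped_line psi : schwartz psi ->
  cintegrable mu (fun r => (nneg r)%:C * damped_line psi r).
Proof.
move=> sp; have [C hC] := damped_line_bound sp.
have C0 : 0 <= C.
  by have := le_trans (normc_ge0 _) (hC 0 (lexx _)); rewrite expr0n addr0 invr1 mulr1.
apply: (@cintegrable_le _ _ _ mu _ (fun r => C * (1 + r ^+ 2)^-1)).
- apply: cmeasurableM; last exact: cmeasurable_damped_line.
  by apply: cmeasurable_real; exact: measurable_nneg.
- exact: integrable_oneDsqrV.
- move=> r; rewrite normcM normcR; have [r0|r0] := leP 0 r.
    by rewrite nneg_ge0// normr1 mul1r hC.
  by rewrite nneg_lt0// normr0 mul0r mulr_ge0// invr_ge0 addr_ge0 ?sqr_ge0.
Qed.

(** The integrand is the derivative of [damped_line psi], which is [psi(xi, s)] at [r = 0] and tends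
    to 0 at infinity. So [exp(- a r) dr] on the half-line is the fundamental solution of [D_t + a]
    with pole at [(xi, s)]. *)
Lemma integral_damped_line psi : schwartz psi ->
  cint mu (fun r => (nneg r)%:C * damped_line (fun z => pderiv None psi z - a * psi z) r) =
  - psi (xi, s).
Proof.
move=> sp; set psi' := fun z => pderiv None psi z - a * psi z.
have sp' : schwartz psi' by apply: schwartzB; [exact: schwartz_pderiv|exact: schwartzZ].
have [i1 i2] := integrable_damped_line sp'.
have [c1 c2] := continuous_damped_line sp'.
have [C hC] := damped_line_bound sp.
have lim : (2 * C * n.+1%:R^-1) @[n --> \oo] --> (0 : R).
  rewrite -(mulr0 (2 * C)); apply: cvgM; first exact: cvg_cst.
  exact: cvg_harmonic.
have bnd n : normc (damped_line psi n%:R) <= 2 * C * n.+1%:R^-1.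
  have C0 : 0 <= C.
    by have := le_trans (normc_ge0 _) (hC 0 (lexx _)); rewrite expr0n addr0 invr1 mulr1.
  apply: le_trans (hC n%:R (ler0n _ _)) _; rewrite [2 * C]mulrC -mulrA ler_wpM2l//.
  have n0 : 0 <= n%:R :> R by [].
  rewrite -[leLHS]mul1r ler_pdivrMr ?ltr_pwDl ?sqr_ge0// mulrAC ler_pdivlMr// mul1r -natr1.
  have := sqr_ge0 (n%:R - 1 : R); nra.
have sq (u : nat -> R) : (forall n, `|u n| <= 2 * C * n.+1%:R^-1) -> u n @[n --> \oo] --> (0 : R).
  move=> ub; apply: (@squeeze_cvgr _ _ _ _ (fun n => - (2 * C * n.+1%:R^-1)) (fun n => 2 * C * n.+1%:R^-1)) => //.
    by apply: nearW => n; rewrite -ler_norml.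
  by rewrite -oppr0; exact: cvgN.
have l1 : (complex.Re (damped_line psi n%:R)) @[n --> \oo] --> (0 : R).
  by apply: sq => n; apply: le_trans (bnd n); exact: ler_norm_cRe.
have l2 : (complex.Im (damped_line psi n%:R)) @[n --> \oo] --> (0 : R).
  by apply: sq => n; apply: le_trans (bnd n); exact: ler_norm_cIm.
have p0 : damped_line psi 0 = psi (xi, s) by rewrite /damped_line cexp0 mul1r add0r.
have e1 r : complex.Re ((nneg r)%:C * damped_line psi' r) = nneg r * complex.Re (damped_line psi' r).
  by rewrite cReM /= mul0r subr0.
have e2 r : complex.Im ((nneg r)%:C * damped_line psi' r) = nneg r * complex.Im (damped_line psi' r).
  by rewrite cImM /= mul0r addr0.
apply: complex_eqP; rewrite /= ?cReN ?cImN -p0.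
  under eq_Rintegral do rewrite e1.
  apply: (@integral_halfline_derive R (cRe \o damped_line psi) (cRe \o damped_line psi')) => //.
    by move=> r; have [] := cder_damped_line r sp.
  by move: i1; congr (_.-integrable _ _); apply/funext => r /=; rewrite e1.
under eq_Rintegral do rewrite e2.
apply: (@integral_halfline_derive R (cIm \o damped_line psi) (cIm \o damped_line psi')) => //.
  by move=> r; have [] := cder_damped_line r sp.
by move: i2; congr (_.-integrable _ _); apply/funext => r /=; rewrite e2.
Qed.

End HalfLineTest.

Section Propagated.
Context (g : 'rV[R]_d -> R[i]) (mg : @cmeasurable _ (borel 'rV[R]_d) _ g).
Context (c : R) (M : nat) (gM : forall x, normc (g x) <= c * (1 + sqnorm_space x) ^+ M).
Context (gR0 : forall x, 0 <= complex.Re (g x)).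
Local Notation adm N := (@admissible _ (borel E) R (wgt N)).

Lemma exists_propagated_measure mX : slow_growing_pos mX ->
  exists2 mu0, slow_growing_pos mu0 & forall chi, schwartz chi ->
    radon_integral mu0 setT (fun z => - pderiv None chi z + g z.1 * chi z) =
    radon_integral mX setT chi.
Proof.
move=> sgX; have [m [p [h [N [[mp mh ih] p0 rep]]]]] := slow_growing_pos_rep sgX.
set X := (borel E * bool * bool)%type in m p h mp mh ih p0 rep *.
pose Y := (X * measurableTypeR R)%type.
pose nu := (m \x mu)%E.
(* The absolute value keeps the image in [t >= 0] for every [r]; the density [k] vanishes for
   [r < 0], so that only the half-line counts. *)
pose q (y : Y) : borel E := ((p y.1).1, (p y.1).2 + `|y.2|).
pose k (y : Y) : R[i] := h y.1 * ((nneg y.2)%:C * cexp (g (p y.1).1) y.2).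
have mq : measurable_fun setT q.
  apply: measurable_fun_spacetime => [i|] /=.
    exact: measurableT_comp (measurable_fst_coord i) (measurableT_comp mp measurable_fst).
  apply: measurable_funD.
    exact: measurableT_comp (@measurable_time R d) (measurableT_comp mp measurable_fst).
  by apply: measurableT_comp => //; exact: measurable_snd.
have mgp : @cmeasurable _ Y R (fun y => g (p y.1).1).
  exact: (cmeasurable_comp (measurableT_comp (@measurable_space R d) (measurableT_comp mp measurable_fst)) mg).
have mk : @cmeasurable _ Y R k.
  apply: cmeasurableM; first exact: (cmeasurable_comp measurable_fst mh).
  apply: cmeasurableM.
    by apply: cmeasurable_real; exact: measurableT_comp measurable_nneg measurable_snd.
  apply: cmeasurableM.
    apply: cmeasurable_real; apply: measurableT_comp; first exact: measurable_expR.
    by apply: measurableT_comp => //; apply: measurable_funM; [exact: mgp.1|exact: measurable_snd].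
  apply: cmeasurable_expi; apply: measurableT_comp => //.
  by apply: measurable_funM; [exact: mgp.2|exact: measurable_snd].
have knorm y : normc (k y) <= normc (h y.1).
  rewrite /k normcM -[leRHS]mulr1 ler_wpM2l ?normc_ge0// normcM normcR.
  have [y0|y0] := leP 0 y.2.
    by rewrite nneg_ge0// normr1 mul1r normc_cexp_le1.
  by rewrite nneg_lt0// normr0 mul0r.
(* One more order of decay pays for the integral over [r]: since [s >= 0], the squared time
   [(s + |r|)^2] is at least [s^2] and at least [r^2]. *)
have wq y : wgt N.+1 (q y) <= wgt N (p y.1) * (1 + y.2 ^+ 2)^-1.
  rewrite /wgt exprSr invfM; apply: ler_pM; rewrite ?invr_ge0 ?exprn_ge0 ?(ltW (sqnorm1_gt0 _))//.
    rewrite lef_pV2 ?posrE ?exprn_gt0 ?sqnorm1_gt0//.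
    apply: lerXn2r; rewrite ?nnegrE ?(ltW (sqnorm1_gt0 _))// lerD2l /sqnorm /= lerD2l.
    by apply: lerXn2r; rewrite ?nnegrE ?addr_ge0 ?p0// lerDl.
  rewrite lef_pV2 ?posrE ?sqnorm1_gt0//; last by rewrite ltr_pwDl// sqr_ge0.
  rewrite lerD2l; apply: le_trans (sqr_time_le_sqnorm (q y)) => /=.
  by rewrite -[y.2 ^+ 2]real_normK ?num_real//; apply: lerXn2r; rewrite ?nnegrE ?addr_ge0 ?p0// lerDr p0.
have iB : nu.-integrable setT (EFin \o (fun y : Y => normc (h y.1) * wgt N (p y.1) * (1 + y.2 ^+ 2)^-1)).
  have mA : measurable_fun setT (fun x => normc (h x) * wgt N (p x)).
    by apply: measurable_funM; [exact: measurable_normc|exact: measurableT_comp (measurable_wgt _) mp].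
  have A0 x : 0 <= normc (h x) * wgt N (p x) by rewrite mulr_ge0 ?normc_ge0 ?wgt_ge0.
  have V0 (r : R) : 0 <= (1 + r ^+ 2)^-1 by rewrite invr_ge0 addr_ge0 ?sqr_ge0.
  have mV : measurable_fun setT (fun r : R => (1 + r ^+ 2)^-1).
    apply: measurable_fun_posV; last by move=> r; rewrite ltr_pwDl// sqr_ge0.
    by apply: measurable_funD => //; exact: measurable_funX.
  apply: integrable_prod.
  - apply: measurable_funM; first exact: measurableT_comp mA measurable_fst.
    exact: measurableT_comp mV measurable_snd.
  - by move=> y; rewrite mulr_ge0.
  - under eq_integral => x _.
      under eq_integral do rewrite /= EFinM.
      rewrite ge0_integralZl ?lee_fin//; last 2 first.
      + exact/measurable_EFinP.
      + by move=> r _; rewrite lee_fin.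
      rewrite integralT_oneDsqrV -EFinM; over.
    under eq_integral do rewrite mulrC EFinM.
    rewrite ge0_integralZl ?lee_fin ?pi_ge0//; last 2 first.
    - exact/measurable_EFinP.
    - by move=> x _; rewrite lee_fin.
    by apply: lte_mul_pinfty; rewrite ?lee_fin ?pi_ge0 ?integral_fune_lt_pinfty.
have wd : weighted_density nu q k N.+1.
  split => //; apply: (integrable_le _ iB).
    by apply: measurable_funM; [exact: measurable_normc|exact: measurableT_comp (measurable_wgt _) mq].
  move=> y; rewrite ger0_norm ?mulr_ge0 ?normc_ge0 ?wgt_ge0// -mulrA.
  by apply: ler_pM; rewrite ?normc_ge0 ?wgt_ge0.
pose mu0 A := cint nu (fun y => k y * (\1_A (q y))%:C).
have dr : density_rep nu q k mu0 by [].
have q0 y : 0 <= (q y).2 by rewrite /q /= addr_ge0 ?p0.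
have sg0 := density_rep_slow_growing_pos wd dr q0.
exists mu0 => // chi sc.
have [mf [C fC]] := evolution_admissible mg gM N.+1 sc.
rewrite (radon_integral_rep wd dr mf fC).
have [mchi [D chiD]] := schwartz_admissible N sc.
rewrite (rep _ D mchi chiD).
rewrite cint_prod1; last exact: (cintegrable_rep wd mf fC).
(* For fixed [x] the integral over [r] is that of [integral_damped_line], started at the point [p x]
   with [a = g((p x).1)]. *)
congr cint; apply/funext => x.
have sp' : schwartz (fun z => pderiv None chi z - g (p x).1 * chi z).
  by apply: schwartzB; [exact: schwartz_pderiv|exact: schwartzZ].
have := integral_damped_line (gR0 (p x).1) (p x).1 (p0 x) sc.
have iL := integrable_damped_line (gR0 (p x).1) (p x).1 (p0 x) sp'.
rewrite -surjective_pairing => e.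
transitivity (- h x * - chi (p x)); last by rewrite mulrNN.
rewrite -e -cintZ//; congr cint; apply/funext => r.
rewrite /k /q /=; have [r0|r0] := leP 0 r; last by rewrite nneg_lt0// !mul0r !mulr0 mul0r.
by rewrite /damped_line ger0_norm// [r + _]addrC; ring.
Qed.

End Propagated.

End Duhamel.

(** * The evolution equation *)

Section Solutions.
Context (R : realType) (d : nat).
Local Notation E := (spacetime R d).
Local Notation adm N := (@admissible _ (borel E) R (wgt N)).
Context (g : 'rV[R]_d -> R[i]) (mg : @cmeasurable _ (borel 'rV[R]_d) _ g).
Context (c : R) (M : nat) (gM : forall x, normc (g x) <= c * (1 + sqnorm_space x) ^+ M).

Let gN x := g (- x).

Lemma measurable_opp_symbol : @cmeasurable _ (borel 'rV[R]_d) _ gN.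
Proof.
have mN : measurable_fun setT (fun x : borel 'rV[R]_d => - x : borel 'rV[R]_d).
  apply: measurable_fun_rV => i; under eq_fun do rewrite mxE.
  by apply: measurableT_comp => //; exact: measurable_coord.
exact: (cmeasurable_comp mN mg).
Qed.

Lemma growth_opp_symbol x : normc (gN x) <= c * (1 + sqnorm_space x) ^+ M.
Proof.
apply: le_trans (gM _) _; rewrite /sqnorm_space.
by under eq_bigr do rewrite mxE sqrrN.
Qed.

(** The time derivative commutes with the spatial transform, and [LopE] treats the operator. A given
    [chi] is reached by testing with [psi = F_S^3 chi]. *)
Lemma solutionP X U mX mu : slow_growing mu ->
  eq_distr X (fourier_distr (distr_of_measure mX)) ->
  eq_distr U (fourier_distr (distr_of_measure mu)) ->
  solution g X U <-> forall chi, schwartz chi ->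
    radon_integral mu setT (fun z => - pderiv None chi z + gN z.1 * chi z) =
    radon_integral mX setT chi.
Proof.
move=> sg XE UE.
have [N h] := slow_growing_dominated sg; have [dJ _] := h N (leqnn _).
have key psi : schwartz psi -> time_derivative U psi + Lop g U psi =
    radon_integral mu setT (fun z => - pderiv None (fourier_space psi) z + gN z.1 * fourier_space psi z).
  move=> sp; have sF := fourier_schwartz sp.
  rewrite (LopE mg gM sg UE sp) /time_derivative UE; last exact: schwartz_pderiv.
  rewrite /fourier_distr /distr_of_measure -(pd_pderiv (pd_fourier_time sp)).
  have a1 := schwartz_admissible N (schwartz_pderiv None sF).
  have a2 : adm N (fun z => gN z.1 * fourier_space psi z).
    by apply: (admissible_growth measurable_opp_symbol growth_opp_symbol); exact: schwartz_admissible.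
  have := dJ.1 (-1) _ _ a1 a2; rewrite mulN1r => <-.
  by congr radon_integral; apply/funext => z; rewrite mulN1r.
split=> [sol chi sc|sol psi sp].
  pose psi := fourier_space (fourier_space (fourier_space chi)).
  have sp : schwartz psi by do 3 apply: fourier_schwartz.
  have := sol psi sp; rewrite key// XE// /fourier_distr /distr_of_measure.
  by rewrite fourier4.
rewrite key// XE// /fourier_distr /distr_of_measure.
by apply: sol; exact: fourier_schwartz.
Qed.

End Solutions.

Theorem corollary3p3 (R : realType) (d : nat) (hd : (1 <= d)%N)
    (g : 'rV[R]_d -> R[i]) (hg : symbol_function g) (g_cont : continuous g)
    (gR_ge0 : forall xi, 0 <= complex.Re (g xi))
    (X : functional R d) (hX : VCFD_dual_pos X) :
  exists U : functional R d,
    VCFD_dual_pos U /\ solution g X U /\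
    forall U' : functional R d,
      VCFD_dual_pos U' -> solution g X U' -> eq_distr U' U.
Proof.
have [_ [c [M gM]] _ _] := hg.
have mg : @cmeasurable _ (borel 'rV[R]_d) _ g.
  split; apply: continuous_measurable_rV => x.
    exact: cvg_cRe (g_cont x).
  exact: cvg_cIm (g_cont x).
have [_ [mX sgX XE]] := hX.
have mgN := measurable_opp_symbol mg; have gNM := growth_opp_symbol gM.
have gN0 x : 0 <= complex.Re (g (- x)) by exact: gR_ge0.
have [mu sgmu muE] := exists_propagated_measure mgN gNM gN0 sgX.
pose U : functional R d := fourier_distr (distr_of_measure mu).
have UE : eq_distr U (fourier_distr (distr_of_measure mu)) by [].
have [N0 h0] := slow_growing_dominated sgmu.1.
exists U; split; last split.
- split; last by exists mu.
  have [d0 b0] := h0 N0 (leqnn _).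
  exact: (@tempered_fourier _ _ N0 (radon_integral mu setT) (fun z => z) (@measurable_id _ (borel (spacetime R d)) setT) _ d0 b0).
- by apply/(solutionP mg gM sgmu.1 XE UE).
move=> U' [_ [mu' sgmu' U'E]] /(solutionP mg gM sgmu'.1 XE U'E) sol' psi sp.
have [N1 h1] := slow_growing_dominated sgmu'.1.
have [N2 h2] := slow_growing_pos_future sgmu.
have [N3 h3] := slow_growing_pos_future sgmu'.
(* A common order at which both integrals satisfy dominated convergence and vanish on functions that
   are zero for [t >= 0]. *)
pose N := maxn (maxn N0 N1) (maxn N2 N3).
have [d0 _] := h0 N (leq_trans (leq_maxl N0 N1) (leq_maxl _ _)).
have [d1 _] := h1 N (leq_trans (leq_maxr N0 N1) (leq_maxl _ _)).
have f2 := h2 N (leq_trans (leq_maxl N2 N3) (leq_maxr _ _)).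
have f3 := h3 N (leq_trans (leq_maxr N2 N3) (leq_maxr _ _)).
have sF := fourier_schwartz sp.
rewrite U'E// UE// /fourier_distr /distr_of_measure; apply/eqP; rewrite -subr_eq0; apply/eqP.
(* The difference of the two integrals satisfies the homogeneous equation and is blind to [t < 0];
   it is evaluated at [F_S psi]. *)
apply: (evolution_unique mgN gNM gN0 (dominatedB d1 d0)) (schwartz_admissible N sF).
- by move=> f af f0; rewrite f2// f3// subrr.
- by move=> chi sc; rewrite sol'// muE// subrr.
Qed.
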